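(* Let $k \geq 1$ and let $X$ be a process satisfying general self-similarity with $\mathcal{C}^k$ invariance components on a connected $\mathcal{C}^k$-differentiable manifold $\mathcal{M}$. Fix a point $y_0 \in \mathcal{M}$ to be the reference point. Assume that either Assumption 1 or Assumption 2 is satisfied for $E=\mathcal{M}$ and that $Sym(X_{y_0})$ is discrete. Then there are an internal composition law $\star$ on $\mathcal{M}$ and a $\mathcal{C}^k$-function $h : \mathcal{M} \to \mathbb{R}_+$ such that (i) $(\mathcal{M},\star)$ is a $\mathcal{C}^k$-Lie group with neutral element $y_0$; (ii) $h$ is a $\mathcal{C}^k$-Lie group homomorphism from $(\mathcal{M},\star)$ to $(\mathbb{R}_+^*,\times)$; (iii) there is a Lévy process $L$ (starting from $y_0$) on $(\mathcal{M},\star)$ such that, if we define $\varphi(t) := \int_0^t \frac{1}{h(L(s))}\, ds$ for all $t \in [0,+\infty]$, then $\zeta(X_{y_0}) = \varphi(+\infty)$ and $$\forall\, 0 \leq t < \varphi(+\infty),\quad X_{y_0}(t) = L(\varphi^{-1}(t)).$$ Moreover, if we let $\xi(\cdot) := \log(1/h(L(\cdot)))$, then $\xi$ is a real Lévy process and $\zeta(X_{y_0}) = \int_0^{+\infty} e^{\xi(s)}\, ds$.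
   Context: Processes and life-time. Let $E$ be a locally compact separable metric space. A strongly Markovian càdlàg process $X$ on $E$ is given through the processes $X_y$ ($y\in E$), $X_y$ being $X$ started from $y$; $P_y$ is the law of $X_y$. The process $X_y$ may have a finite life-time $\zeta(X_y)\in(0,+\infty]$, namely the time at which every compact subset of $E$ containing $y$ has been left by $X_y$ (the limit of the first exit times from an increasing sequence of compact sets such that every compact subset of $E$ is contained in one of them). If $\mathbb{P}(\zeta(X_y)<+\infty)>0$ one adds a cemetery point $\Delta$ to $E$, whose neighborhoods are the sets $K^c\cup\{\Delta\}$, $K\subset E$ compact, and puts $X_y(t)=\Delta$ for $t\ge \zeta(X_y)$. There is no instantaneous killing: $\Delta$ is absorbing and can only be reached continuously. A homeomorphism $f$ of $E$ is extended to $E\cup\{\Delta\}$ by $f(\Delta)=\Delta$. General self-similarity. $X$ satisfies general self-similarity on $E$ if for some point $y_0\in E$, $$\forall y\in E,\ (X_y(t),\ t\ge 0)\overset{\mathcal L}{=}(f_y(X_{y_0}(c_y t)),\ t\ge 0),$$ where $(f_y,\ y\in E)$ is a family of homeomorphisms of $E$ such that $(y,x)\mapsto f_y(x)$ and $(y,x)\mapsto f_y^{-1}(x)$ are continuous from $E\times E$ to $E$, and $(c_y,\ y\in E)$ is a family of positive constants with $y\mapsto c_y$ continuous. Then $((f_y,c_y),\ y\in E)$ is called a family of invariance components for $X$ relatively to the reference point $y_0$. (The reference point can be chosen arbitrarily: if $((f_y,c_y))$ are invariance components relatively to some $y_1$, then $((f_y\circ f_{y_2}^{-1},c_y/c_{y_2}))$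 are invariance components relatively to $y_2$.) $\mathcal{C}^k$ invariance components. If $E$ is a $\mathcal{C}^k$-differentiable manifold, invariance components are called $\mathcal{C}^k$ if $(y,x)\mapsto f_y(x)$, $(y,x)\mapsto f_y^{-1}(x)$ and $y\mapsto c_y$ are of class $\mathcal{C}^k$. Support, symmetries and assumptions. $Supp(X_y):=\overline{\bigcup_{t\ge0}Supp(X_y(t))}=\{z\in E:\ \forall\epsilon>0,\ \exists t\ge0,\ \mathbb{P}(X_y(t)\in B(z,\epsilon))>0\}$. Assumption 1: $E=Supp(X_{y_0})$. Assumption 2: there exists $y\in E$ such that $y$ belongs to the interior of $Supp(X_y)$. $Sym(X_y):=\{h\in Hom(E):\ X_y\overset{\mathcal L}{=}h(X_y)\}$, where $Hom(E)$ is the group of homeomorphisms of $E$; it is regarded as a subset of $\mathcal{C}^0(E,E)$ with the topology of uniform convergence on compact sets, and ''discrete'' refers to this topology. Lévy processes on groups. A Lévy process $L$ on a topological group $(G,\star)$ means a left Lévy process: a càdlàg process starting from the neutral element such that for every $t\ge0$ the process $(L(t))^{-1}\star L(t+\cdot)$ is independent of the past of $L$ up to time $t$ and has the same law as $L$. A $\mathcal{C}^k$-Lie group is a group on a $\mathcal{C}^k$-manifold whose multiplication and inversion are $\mathcal{C}^k$. $\mathbb{R}_+^*=]0,+\infty[$. $\varphi^{-1}$ is the inverse of the increasing bijection $\varphi:[0,+\infty[\to[0,\varphi(+\infty)[$. *)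

(* Defs.v *)
From HB Require Import structures.
From mathcomp Require Import all_boot all_order all_algebra.
From mathcomp Require Import all_classical all_reals all_analysis.

Set Implicit Arguments.
Unset Strict Implicit.
Unset Printing Implicit Defensive.

Import Order.TTheory GRing.Theory Num.Theory.
Import numFieldNormedType.Exports.

Local Open Scope classical_set_scope.
Local Open Scope ring_scope.

(** * C^k manifolds and C^k maps *)

(* [U] is meant to be open: only the germs of [f] at the points of [U] matter.
   In finite dimension, the differential is C^k as soon as each of its values
   ['D_v f] at a fixed vector [v] is. *)
Fixpoint Ck_on (R : realType) (V W : normedModType R) (k : nat)
    (f : V -> W) (U : set V) : Prop :=
  if k is k'.+1 then
    (forall x, U x -> differentiable f x) /\
    (forall v, Ck_on k' (fun x => 'D_v f x) U)
  else forall x, U x -> {for x, continuous f}.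

(* [chart_map] and [chart_inv] are total functions; they are meaningful on
   [chart_dom] and [chart_cod] only. *)
Record chart (R : realType) (M : topologicalType) (V : normedModType R) :=
  Chart {
    chart_dom : set M;
    chart_cod : set V;
    chart_map : M -> V;
    chart_inv : V -> M }.

Definition is_chart (R : realType) (M : topologicalType) (V : normedModType R)
    (a : chart M V) : Prop :=
  [/\ open (chart_dom a) /\ open (chart_cod a),
      forall x, chart_dom a x -> chart_cod a (chart_map a x),
      forall v, chart_cod a v -> chart_dom a (chart_inv a v),
      (forall x, chart_dom a x -> chart_inv a (chart_map a x) = x) /\
      (forall v, chart_cod a v -> chart_map a (chart_inv a v) = v) &
      (forall x, chart_dom a x -> {for x, continuous (chart_map a)}) /\
      (forall v, chart_cod a v -> {for v, continuous (chart_inv a)})].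

Definition Ck_atlas (R : realType) (M : topologicalType) (V : normedModType R)
    (k : nat) (A : set (chart M V)) : Prop :=
  [/\ forall a, A a -> is_chart a,
      forall x, exists2 a, A a & chart_dom a x &
      forall a b, A a -> A b ->
        Ck_on k (chart_map b \o chart_inv a)
          [set v | chart_cod a v /\ chart_dom b (chart_inv a v)]].

(* A metric space is Hausdorff, and being separable it is second countable. *)
Definition Ck_manifold (R : realType) (M : metricType R) (n k : nat)
    (A : set (chart M 'rV[R]_n)) : Prop :=
  (exists2 D : set M, countable D & dense D) /\ Ck_atlas k A.

Definition prod_atlas (R : realType) (M N : topologicalType)
    (V W : normedModType R) (A : set (chart M V)) (B : set (chart N W)) :
    set (chart (M * N)%type (V * W)%type) :=
  [set Chart (chart_dom a `*` chart_dom b) (chart_cod a `*` chart_cod b)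
         (fun p => (chart_map a p.1, chart_map b p.2))
         (fun q => (chart_inv a q.1, chart_inv b q.2)) | a in A & b in B].

Definition id_atlas (R : realType) (V : normedModType R) : set (chart V V) :=
  [set Chart setT setT id id].

Definition Ck_map (R : realType) (M N : topologicalType)
    (V W : normedModType R) (k : nat)
    (A : set (chart M V)) (B : set (chart N W)) (f : M -> N) : Prop :=
  continuous f /\
  forall a b, A a -> B b ->
    Ck_on k (chart_map b \o f \o chart_inv a)
      [set v | chart_cod a v /\ chart_dom b (f (chart_inv a v))].

Definition Ck_lie_group (R : realType) (M : topologicalType)
    (V : normedModType R) (k : nat) (A : set (chart M V))
    (op : M -> M -> M) (inv : M -> M) (e : M) : Prop :=
  [/\ associative op, left_id e op /\ right_id e op,
      left_inverse e inv op /\ right_inverse e inv op,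
      Ck_map k (prod_atlas A A) A (fun p => op p.1 p.2) &
      Ck_map k A A inv].

(* Since ]0, +oo[ is open in [R], a map into it is C^k iff it is C^k as a
   map into [R]. *)
Definition Ck_hom_to_posreals (R : realType) (M : topologicalType)
    (V : normedModType R) (k : nat) (A : set (chart M V))
    (op : M -> M -> M) (h : M -> R) : Prop :=
  [/\ forall x, 0 < h x,
      forall x y, h (op x y) = h x * h y &
      Ck_map k A (@id_atlas R R^o) h].

(** * Processes and their laws *)

(* A process with values in [S] is a map [T -> R -> S] of which only the
   restriction to the times [t >= 0] matters. *)

Definition borel (S : topologicalType) : set (set S) := <<s @open S >>.

Definition path_sigma (R : realType) (S : topologicalType) :
    set (set (R -> S)) :=
  <<s [set C | exists (t : R) (B : set S),
         [/\ 0 <= t, borel B & C = [set w : R -> S | B (w t)]]] >>.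

Definition measurable_process (R : realType) (S : topologicalType)
    (d : measure_display) (T : measurableType d) (X : T -> R -> S) : Prop :=
  forall (t : R) (B : set S), 0 <= t -> borel B -> measurable [set om | B (X om t)].

Definition past (R : realType) (S : topologicalType)
    (d : measure_display) (T : measurableType d) (X : T -> R -> S) (t : R) :
    set (set T) :=
  <<s [set A | exists (s : R) (B : set S),
         [/\ 0 <= s <= t, borel B & A = [set om | B (X om s)]]] >>.

Definition law (R : realType) (S : topologicalType) (d : measure_display)
    (T : measurableType d) (P : probability T R) (X : T -> R -> S)
    (C : set (R -> S)) : \bar R := P (X @^-1` C).

Definition eq_law (R : realType) (S : topologicalType) (d : measure_display)
    (T : measurableType d) (P : probability T R) (X Y : T -> R -> S) : Prop :=
  forall C, path_sigma C -> law P X C = law P Y C.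

Definition cadlag (R : realType) (S : topologicalType) (w : R -> S) : Prop :=
  (forall t : R, 0 <= t -> w s @[s --> t^'+] --> w t) /\
  (forall t : R, 0 < t -> exists l : S, w s @[s --> t^'-] --> l).

Definition levy_process (R : realType) (G : topologicalType)
    (op : G -> G -> G) (inv : G -> G) (e : G) (d : measure_display)
    (T : measurableType d) (P : probability T R) (L : T -> R -> G) : Prop :=
  [/\ measurable_process L, forall om, cadlag (L om), forall om, L om 0 = e &
      forall t : R, 0 <= t ->
        let incr := fun om s => op (inv (L om t)) (L om (t + s)) in
        eq_law P incr L /\
        forall A C, past L t A -> path_sigma C ->
          P (A `&` incr @^-1` C) = (P A * law P incr C)%E].

(** * Strong Markov processes with life-time *)

(* The cemetery point is the point [None] of the library's one-point
   compactification. When [E] is compact, [None] is isolated, hence can not be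
   reached continuously. *)
Notation cemetery_ext := one_point_compactification.

Definition exit_time (R : realType) (E : topologicalType)
    (w : R -> cemetery_ext E) (K : set E) : \bar R :=
  ereal_inf [set t%:E | t in [set t : R | 0 <= t /\ ~ (Some @` K) (w t)]].

Definition lifetime (R : realType) (E : topologicalType)
    (w : R -> cemetery_ext E) : \bar R :=
  ereal_sup [set exit_time w K | K in
               [set K | compact K /\ (Some @` K) (w 0)]].

Definition stopping_time (R : realType) (S : topologicalType)
    (d : measure_display) (T : measurableType d) (X : T -> R -> S)
    (tau : T -> \bar R) : Prop :=
  (forall om, (0 <= tau om)%E) /\
  forall t : R, 0 <= t -> past X t [set om | (tau om <= t%:E)%E].

Definition stopped_past (R : realType) (S : topologicalType)
    (d : measure_display) (T : measurableType d) (X : T -> R -> S)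
    (tau : T -> \bar R) (A : set T) : Prop :=
  measurable A /\
  forall t : R, 0 <= t -> past X t (A `&` [set om | (tau om <= t%:E)%E]).

(* [X y] is the process started from [y]; the one started from the cemetery
   point stays there. *)
Definition started (R : realType) (E T : Type)
    (X : E -> T -> R -> cemetery_ext E) (x : cemetery_ext E) :
    T -> R -> cemetery_ext E :=
  if x is Some y then X y else fun _ _ => None.

Record strong_markov_process (R : realType) (E : topologicalType)
    (d : measure_display) (T : measurableType d) (P : probability T R)
    (X : E -> T -> R -> cemetery_ext E) : Prop := {
  process_start : forall y om, X y om 0 = Some y;
  process_measurable : forall y, measurable_process (X y);
  process_cadlag : forall y om, cadlag (X y om);
  process_absorbed : forall y om (t : R), 0 <= t ->
    (lifetime (X y om) <= t%:E)%E -> X y om t = None;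
  process_no_killing : forall y om (z : R), lifetime (X y om) = z%:E ->
    X y om s @[s --> z^'-] --> (None : cemetery_ext E);
  process_kernel : forall C : set (R -> cemetery_ext E), path_sigma C ->
    forall B : set (\bar R), borel B ->
      borel [set y | B (law P (X y) C)];
  process_strong_markov : forall y tau A C,
    stopping_time (X y) tau -> stopped_past (X y) tau A -> path_sigma C ->
    let D := A `&` [set om | (tau om < +oo)%E] in
    P (D `&` [set om | C (fun s => X y om (fine (tau om) + s))]) =
    (\int[P]_(om in D) law P (started X (X y om (fine (tau om)))) C)%E
}.

Definition process_support (R : realType) (E : pseudoMetricType R)
    (d : measure_display) (T : measurableType d) (P : probability T R)
    (Y : T -> R -> cemetery_ext E) : set E :=
  [set z | forall eps : R, 0 < eps -> exists2 t : R, 0 <= t &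
     (0 < P [set om | (Some @` ball z eps) (Y om t)])%E].

(** * Self-similarity and symmetries *)

Definition homeomorphism (E : topologicalType) (g : E -> E) : Prop :=
  continuous g /\
  exists ginv : E -> E, [/\ continuous ginv, cancel g ginv & cancel ginv g].

Definition symmetries (R : realType) (E : topologicalType)
    (d : measure_display) (T : measurableType d) (P : probability T R)
    (Y : T -> R -> cemetery_ext E) : set (E -> E) :=
  [set g | homeomorphism g /\ eq_law P Y (fun om t => omap g (Y om t))].

(* [{family compact, E -> E}] carries the topology of uniform convergence on
   the compact subsets of [E]. *)
Definition discrete_homs (R : realType) (E : pseudoMetricType R)
    (H : set (E -> E)) : Prop :=
  forall g, H g ->
    \forall g' \near (g : {family compact, E -> E}), H g' -> g' = g.

(* [finv y] is the inverse of [f y]. *)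
Record invariance_components (R : realType) (E : topologicalType)
    (d : measure_display) (T : measurableType d) (P : probability T R)
    (X : E -> T -> R -> cemetery_ext E) (y0 : E)
    (f finv : E -> E -> E) (c : E -> R) : Prop := {
  component_fK : forall y, cancel (f y) (finv y);
  component_fVK : forall y, cancel (finv y) (f y);
  component_f_continuous : continuous (fun p : E * E => f p.1 p.2);
  component_fV_continuous : continuous (fun p : E * E => finv p.1 p.2);
  component_c_gt0 : forall y, 0 < c y;
  component_c_continuous : continuous c;
  component_law : forall y,
    eq_law P (X y) (fun om t => omap (f y) (X y0 om (c y * t)))
}.

Record Ck_invariance_components (R : realType) (M : topologicalType)
    (V : normedModType R) (k : nat) (A : set (chart M V))
    (d : measure_display) (T : measurableType d) (P : probability T R)
    (X : M -> T -> R -> cemetery_ext M) (y0 : M)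
    (f finv : M -> M -> M) (c : M -> R) : Prop := {
  Ck_component_inv : invariance_components P X y0 f finv c;
  Ck_component_f : Ck_map k (prod_atlas A A) A (fun p => f p.1 p.2);
  Ck_component_fV : Ck_map k (prod_atlas A A) A (fun p => finv p.1 p.2);
  Ck_component_c : Ck_map k A (@id_atlas R R^o) c
}.

(* The reference point is existentially quantified, as it can be changed at
   will. *)
Definition Ck_self_similar (R : realType) (M : topologicalType)
    (V : normedModType R) (k : nat) (A : set (chart M V))
    (d : measure_display) (T : measurableType d) (P : probability T R)
    (X : M -> T -> R -> cemetery_ext M) : Prop :=
  exists y1 f finv c, Ck_invariance_components k A P X y1 f finv c.

(** * The time change *)

(* [clock h w t] is the integral of [1 / h (w s)] over [0 <= s < t], and
   [t = +oo] is allowed. *)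
Definition clock (R : realType) (G : Type) (h : G -> R) (w : R -> G)
    (t : \bar R) : \bar R :=
  (\int[lebesgue_measure]_(s in [set s : R | (0 <= s)%R /\ s%:E < t])
     ((h (w s))^-1)%:E)%E.

Definition clock_inv (R : realType) (G : Type) (h : G -> R) (w : R -> G)
    (t : R) : R :=
  'pinv_(fun=> 0) `[0, +oo[%classic (fun s => clock h w s%:E) t%:E.

(* Main.v *)
Require Import Defs.
From HB Require Import structures.
From mathcomp Require Import all_boot all_order all_algebra.
From mathcomp Require Import all_classical all_reals all_analysis.
From mathcomp Require Import measurable_realfun.
From mathcomp Require Import zify ring lra.

Set Implicit Arguments.
Unset Strict Implicit.
Unset Printing Implicit Defensive.

Import Order.TTheory GRing.Theory Num.Theory.
Import numFieldNormedType.Exports.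

Local Open Scope classical_set_scope.
Local Open Scope ring_scope.

(* Write (f_y, c_y) for the invariance components, normalised by f_(y0) = id. For all
   x, y the homeomorphism g = f_(f_x y)^-1 o f_x o f_y, with time scale
   a = c_x c_y / c_(f_x y), maps the law of the process to itself from one starting
   point; the Markov property, the support assumption and connectedness propagate
   this to all starting points. If a = 1 identically, the maps g form a continuous
   family of symmetries, constant by discreteness, so that f_x o f_y = f_(f_x y):
   the product x * y = f_x y is a group law with homomorphism c. Otherwise some curve
   of maps g has time scales e^u, extends to a C^k flow of similarities fixing y0,
   and composing f_y with the flow at time - ln c_y gives components with c = 1.
   For the Levy process, run the process X with the inverse of its age
   A(t) = int_0^t c(X(s)) ds. By self-similarity A(+oo) has the same law from every
   starting point; since X leaves a compact neighborhood of y0 before its age stops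
   growing, this forces A(+oo) = +oo almost surely. The strong Markov property at the
   times where A reaches t gives stationary independent increments, and A is inverted
   by the integral of 1 / c along the time-changed path: both sides are continuous
   with the same right derivative. *)

(** * Metric spaces *)

(** Laws are compared on cylinders only, without a topology on the space of paths, so limits in the
    starting point need a substitute: paths confined in compact sets during short time intervals.
    Discreteness says nothing about similarities of ratio different from 1, which may form a
    continuum. It is therefore always applied to quotients of two similarities of equal ratio fixing
    y0, and the constant is read off where the family is visibly the identity: at y = y0 for the
    maps g, at time 0 for the flow. The age is invariant because c is multiplicative: f_y multiplies
    the speed c(X) by c_y, while the durations are divided by c_y. Paths are only right-continuous,
    so ages have right derivatives only; identities between clocks come from uniqueness of a
    left-continuous function with a given right derivative, not from a change of variables.
    Integrals along paths are measurable on regular paths only, and the probability space is not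
    completed. Measurability is thus settled on the space of paths first, and the paths of finite
    total age receive a constant image. *)

Section metric_topology.
Variables (R : realType) (M : metricType R).
Implicit Types (x y z : M) (O K : set M).

(** The distance to the complement of [O], truncated at 1 so that the infimum is over a nonempty set
    even when [O] is the whole space. For open [O] it is a continuous function positive exactly on
    [O], which turns membership into an inequality between real numbers. *)
Definition dist_out O x : R :=
  inf ([set 1] `|` [set mdist x y | y in ~` O]).

Lemma dist_out_has_lbound O x :
  lbound ([set 1] `|` [set mdist x y | y in ~` O]) (0 : R).
Proof. by move=> r [->//|[y _ <-]]; exact: mdist_ge0. Qed.

Lemma dist_out_lip O x y : dist_out O x <= mdist x y + dist_out O y.
Proof.
rewrite -lerBlDl; apply: lb_le_inf; first by exists 1; left.
move=> r [->|[z Oz <-]]; rewrite lerBlDl.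
  apply: (@le_trans _ _ 1); last by rewrite lerDr mdist_ge0.
  by apply: ge_inf; [exists 0; exact: dist_out_has_lbound|left].
apply: (le_trans _ (metric_triangle x y z)).
by apply: ge_inf; [exists 0; exact: dist_out_has_lbound|right; exists z].
Qed.

Lemma near_ball_mdist x (e : R) : 0 < e -> \forall y \near x, mdist x y < e.
Proof.
by move=> e0; have := nbhsx_ballx x _ e0; apply: filterS => y; rewrite ballEmdist.
Qed.

Lemma continuous_dist_out O : continuous (dist_out O).
Proof.
move=> x; apply/cvgrPdist_lt => e e0; near=> y.
have xy : mdist x y < e by near: y; exact: near_ball_mdist.
rewrite ltr_norml; apply/andP; split.
  rewrite ltrBrDl; have := dist_out_lip O y x.
  rewrite metric_sym => h; rewrite ltrBlDr; apply: le_lt_trans h _.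
  by rewrite addrC ltrD2l.
by rewrite ltrBlDr (le_lt_trans (dist_out_lip O x y))// ltrD2r.
Unshelve. all: by end_near. Qed.

Lemma dist_out_gt0 O x : open O -> (0 < dist_out O x) = (x \in O).
Proof.
move=> oO; apply/idP/idP => [|/set_mem Ox].
  apply: contraTT => /negP nOx; rewrite -leNgt.
  rewrite -(mdistxx x); apply: ge_inf; first by exists 0; exact: dist_out_has_lbound.
  by right; exists x => // Ox; apply: nOx; exact: mem_set.
have : nbhs x O by exact: open_nbhs_nbhs.
rewrite -nbhs_ballE => -[e /= e0 xeO].
apply: (@lt_le_trans _ _ (Num.min 1 e)); first by rewrite lt_min ltr01.
apply: lb_le_inf; first by exists 1; left.
move=> r [->|[z Oz <-]]; first by rewrite ge_min lexx.
rewrite ge_min; apply/orP; right; rewrite leNgt; apply/negP => xz.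
by apply: Oz; apply: xeO; rewrite ballEmdist.
Qed.

Lemma closed_dist_out O (r : R) : closed [set x | r <= dist_out O x].
Proof.
rewrite (_ : [set _ | _] = dist_out O @^-1` [set s | r <= s])//.
apply: preimage_closed; last exact: closed_ge.
by move=> x _; exact: continuous_dist_out.
Qed.

Lemma open_dist_out O (r : R) : open [set x | r < dist_out O x].
Proof.
rewrite (_ : [set _ | _] = dist_out O @^-1` [set s | r < s])//.
apply: open_comp; last exact: open_gt.
by move=> x _; exact: continuous_dist_out.
Qed.

Definition locally_cpt := forall x, exists2 K, compact K & nbhs x K.
Definition separable := exists2 D : set M, countable D & dense D.

Hypothesis lc : locally_cpt.
Hypothesis sep : separable.
Variable y0 : M.

Lemma dense_sequence : exists u : nat -> M, dense (range u).
Proof.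
have [D /countable_injP[f finj] dD] := sep.
pose u n := xget y0 [set x | D x /\ f x = n].
exists u; move=> O Oex oO; have [x [Ox Dx]] := dD O Oex oO.
exists x; split => //; exists (f x) => //; rewrite /u.
case: xgetP => [y _ [Dy fyx]|/(_ x)]; last by case.
by apply: finj => //; exact: mem_set.
Qed.

Lemma dense_sequence_ball (u : nat -> M) x (e : R) : dense (range u) -> 0 < e ->
  exists n, ball x e (u n).
Proof.
move=> du e0.
have [|y [xy [n _ un]]] := du (interior (ball x e)) _ (open_interior _).
  by exists x; apply: nbhsx_ballx.
by exists n; rewrite un; exact: interior_subset.
Qed.

(** The balls of radius 1/(j+1) around a dense sequence are filtered: only those with compact
    closure are kept, and [S m] collects the first ones. Every point is interior to some [S m] by
    local compactness, and the near-covering form of compactness makes [m] uniform on [K]. *)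
Lemma compact_exhaustion : exists S : nat -> set M,
  [/\ forall m, compact (S m), forall m n, (m <= n)%N -> S m `<=` S n &
      forall K, compact K -> exists m, K `<=` interior (S m)].
Proof.
have [u du] := dense_sequence.
pose B i j := ball (u i) (j.+1%:R^-1 : R).
pose C i j := if `[< compact (closure (B i j)) >] then closure (B i j)
              else set0.
pose S m := \bigcup_(i in `I_m) \bigcup_(j in `I_m) C i j.
have mS m n : (m <= n)%N -> S m `<=` S n.
  move=> mn x [i /= im [j /= jm Cx]].
  exists i; first exact: leq_trans mn.
  by exists j => //; exact: leq_trans mn.
have iS x : exists m, interior (S m) x.
  have [K cK xK] := lc x.
  move: xK; rewrite -nbhs_ballE => -[e /= e0 xeK].
  (* The closure of a ball of radius [r] whose center is within [r] of [x] stays within [3 * r] of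
     [x]; this must be less than [e]. *)
  pose j := Num.truncn (3 / e).
  pose r : R := j.+1%:R^-1.
  have r0 : 0 < r by rewrite invr_gt0.
  have re : 3 * r < e.
    by rewrite /r ltr_pdivrMr// mulrC -ltr_pdivrMr// truncnS_gt.
  have [i xi] := dense_sequence_ball x du r0.
  have cB : closure (B i j) `<=` K.
    move=> y /(_ (ball y r) (nbhsx_ballx _ _ r0)) [z [Bz yz]].
    apply: xeK; apply: (@le_ball _ _ _ (r + r + r)).
      by rewrite (le_trans _ (ltW re))//; lra.
    by apply: ball_triangle (ball_sym yz); apply: ball_triangle Bz.
  exists (maxn i j).+1.
  apply: (@filterS _ _ _ (B i j)).
    move=> y By; exists i; first by rewrite /= ltnS leq_maxl.
    exists j; first by rewrite /= ltnS leq_maxr.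
    rewrite /C; case: asboolP => [_|[]]; first exact: subset_closure.
    apply: (subclosed_compact _ cK cB); exact: closed_closure.
  have xB : ball x r (u i) by [].
  have : nbhs x (ball x (r - mdist x (u i))).
    by apply: nbhsx_ballx; rewrite subr_gt0; move: xB; rewrite ballEmdist.
  apply: filterS => y; rewrite /B ballEmdist /= ballEmdist /= -/r => h.
  apply: (le_lt_trans (metric_triangle (u i) x y)).
  by rewrite (metric_sym (u i) x) -ltrBrDl.
exists S; split => //.
  move=> m; rewrite /S bigcup_mkord; apply: bigsetU_compact => i _.
  rewrite bigcup_mkord; apply: bigsetU_compact => j _.
  by rewrite /C; case: asboolP => // _; exact: compact0.
move=> K /compact_near_coveringP cK.
have := cK nat \oo (fun m x => interior (S m) x) _.
case => [x Kx|m _ hm]; last by exists m; exact: (hm m (leqnn m)).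
have [m xm] := iS x.
exists (interior (S m), [set n | (m <= n)%N]).
  split => /=; first exact: nbhs_interior xm.
  by exists m.
move=> [x' n] /= [x'm mn]; rewrite /interior /=; apply: filterS x'm.
exact: mS.
Qed.

(** Second countability of the product. It makes the group operation measurable for the pair of
    coordinates of a path, since Borel events are available for each coordinate separately. Triples
    (center, center, radius) are enumerated by [pickle], those whose rectangle leaves [W] being
    replaced by the empty set. *)
Lemma open_prod_rectangles (W : set (M * M)) : open W ->
  exists U V : nat -> set M, [/\ forall i, open (U i), forall i, open (V i) &
     W = \bigcup_i (U i `*` V i)].
Proof.
move=> oW; have [u du] := dense_sequence.
pose B i j := interior (ball (u i) (j.+1%:R^-1 : R)).
pose ok (p : nat * nat * nat) := (B p.1.1 p.2 `*` B p.1.2 p.2) `<=` W.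
pose dec (n : nat) : nat * nat * nat :=
  if unpickle n is Some p then p else (0%N, 0%N, 0%N).
pose U n := if `[< ok (dec n) >] then B (dec n).1.1 (dec n).2 else set0.
pose V n := if `[< ok (dec n) >] then B (dec n).1.2 (dec n).2 else set0.
exists U, V; split.
- by move=> i; rewrite /U; case: ifP => _; [exact: open_interior|exact: open0].
- by move=> i; rewrite /V; case: ifP => _; [exact: open_interior|exact: open0].
apply/seteqP; split; last first.
  move=> p [n _]; rewrite /U /V; case: asboolP => [okn|_ []//].
  by move=> [? ?]; exact: okn.
move=> [x y] Wxy.
have : nbhs (x, y) W by exact: open_nbhs_nbhs.
rewrite -nbhs_ballE => -[e /= e0 xyW].
pose j := Num.truncn (2 / e).
pose r : R := j.+1%:R^-1.
have r0 : 0 < r by rewrite invr_gt0.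
have re : 2 * r < e.
  by rewrite /r ltr_pdivrMr// mulrC -ltr_pdivrMr// truncnS_gt.
have [a xa] := dense_sequence_ball x du r0.
have [b yb] := dense_sequence_ball y du r0.
have inB w i : ball w r (u i) -> B i j w.
  move=> wi.
  have : nbhs w (ball w (r - mdist w (u i))).
    by apply: nbhsx_ballx; rewrite subr_gt0; move: wi; rewrite ballEmdist.
  apply: filterS => z; rewrite !ballEmdist /= -/r => h.
  apply: (le_lt_trans (metric_triangle (u i) w z)).
  by rewrite (metric_sym (u i) w) -ltrBrDl.
have okab : ok (a, b, j).
  move=> [x' y'] /= [/interior_subset x'a /interior_subset y'b]; apply: xyW.
  have e2 : r + r <= e by rewrite (le_trans _ (ltW re))//; lra.
  by split; apply: (le_ball e2); [apply: ball_triangle x'a|apply: ball_triangle y'b].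
exists (pickle (a, b, j)) => //; rewrite /U /V /dec pickleK.
by case: asboolP => // _; split => /=; apply: inB.
Qed.

End metric_topology.

(** A closed ball in the image of a chart is compact by finite dimension, and its inverse image by
    the chart is a neighborhood by continuity of [chart_map]. *)
Lemma manifold_locally_cpt (R : realType) (M : metricType R) (n k : nat)
    (A : set (chart M 'rV[R]_n)) : Ck_manifold k A -> locally_cpt M.
Proof.
move=> [_ [isA covA _]] x; have [a Aa ax] := covA x.
have [[odom ocod] mdom mcod [mK vK] [cm cv]] := isA a Aa.
have : nbhs (chart_map a x) (chart_cod a).
  by apply: open_nbhs_nbhs; split => //; exact: mdom.
rewrite -nbhs_ballE => -[e /= e0 xecod].
pose r := e / 2.
have r0 : 0 < r by rewrite divr_gt0.
have sub : closed_ball (chart_map a x) r `<=` chart_cod a.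
  move=> v; rewrite closed_ballE// /closed_ball_ /= => h; apply: xecod.
  by rewrite -ball_normE /= (le_lt_trans h)// /r ltr_pdivrMr// ltr_pMr// ltr1n.
exists (chart_inv a @` closed_ball (chart_map a x) r).
  apply: continuous_compact.
    apply: continuous_in_subspaceT => v /set_mem /sub; exact: cv.
  apply: bounded_closed_compact; last exact: closed_ball_closed.
  exists (`|chart_map a x| + r); split; first by rewrite num_real.
  move=> s hs v /=; rewrite closed_ballE// /closed_ball_ /= => h.
  rewrite (le_trans _ (ltW hs))// -[v](subrK (chart_map a x)) addrC.
  by rewrite (le_trans (ler_normD _ _))// lerD2l distrC.
have nd : \forall y \near x, chart_dom a y by exact: open_nbhs_nbhs.
have nb : \forall y \near x, ball (chart_map a x) r (chart_map a y).
  by apply: (cm x ax); exact: nbhsx_ballx.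
near=> y; exists (chart_map a y); last by apply: mK; near: y.
by apply: subset_closed_ball; near: y.
Unshelve. all: by end_near. Qed.

(** * Laws of paths *)

(** The sigma-algebra [H] is a bare set of sets because the lemma serves for pasts and traces as
    well as for the measurable sets of a measurable space. *)
Lemma sigma_algebra_preimage_sub (S S' : Type) (F : S -> S')
    (H : set (set S)) (G : set (set S')) :
  sigma_algebra setT H -> (forall C, G C -> H (F @^-1` C)) ->
  forall C, <<s G >> C -> H (F @^-1` C).
Proof.
move=> [H0 HC HU] HG C; apply: (@smallest_sub _ _ _ [set C | H (F @^-1` C)]) => //.
split => /=; first by rewrite preimage_set0.
- by move=> B HB; rewrite setTD -preimage_setC -setTD; exact: HC.
- by move=> B HB; rewrite preimage_bigcup; exact: HU.
Qed.

Lemma g_sigma (S : Type) (G : set (set S)) : sigma_algebra setT <<s G >>.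
Proof. exact: smallest_sigma_algebra. Qed.

Lemma g_sigma_sub (S : Type) (G H : set (set S)) :
  (forall C, G C -> <<s H >> C) -> forall C, <<s G >> C -> <<s H >> C.
Proof. by move=> GH C; apply: smallest_sub => //; exact: g_sigma. Qed.

Section paths.
Variables (R : realType) (S : topologicalType).

Lemma path_sigma_algebra : sigma_algebra setT (@path_sigma R S).
Proof. exact: g_sigma. Qed.

Lemma path_sigmaC (C : set (R -> S)) : path_sigma C -> path_sigma (~` C).
Proof. by rewrite -setTD; have [_ h _] := path_sigma_algebra; exact: h. Qed.

Lemma path_sigma_bigcup (F : nat -> set (R -> S)) :
  (forall n, path_sigma (F n)) -> path_sigma (\bigcup_n F n).
Proof. by have [_ _ h] := path_sigma_algebra; exact: h. Qed.

Lemma path_sigmaT : path_sigma [set: R -> S].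
Proof. by rewrite -setC0; apply: path_sigmaC; have [] := path_sigma_algebra. Qed.

Lemma path_sigma_bigcap (F : nat -> set (R -> S)) :
  (forall n, path_sigma (F n)) -> path_sigma (\bigcap_n F n).
Proof.
move=> h; rewrite -(setCK (\bigcap_n F n)) setC_bigcap; apply: path_sigmaC.
by apply: path_sigma_bigcup => n; exact: path_sigmaC.
Qed.

Lemma path_sigmaI (C D : set (R -> S)) :
  path_sigma C -> path_sigma D -> path_sigma (C `&` D).
Proof.
by move=> pC pD; rewrite -bigcap2E; apply: path_sigma_bigcap => -[|[|n]] //=; exact: path_sigmaT.
Qed.

Lemma path_sigma_coord (t : R) (B : set S) : 0 <= t -> borel B ->
  path_sigma [set w : R -> S | B (w t)].
Proof. by move=> t0 bB; apply: sub_sigma_algebra; exists t, B. Qed.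

Lemma path_sigma_preimage (U : Type) (H : set (set U)) (F : U -> R -> S) :
  sigma_algebra setT H ->
  (forall (t : R) (O : set S), 0 <= t -> open O -> H [set u | O (F u t)]) ->
  forall C, path_sigma C -> H (F @^-1` C).
Proof.
move=> sH HF; apply: sigma_algebra_preimage_sub => // C [t [B [t0 bB ->]]].
apply: (@sigma_algebra_preimage_sub _ _ (fun u => F u t) _ _ sH _ _ bB) => O oO.
exact: HF.
Qed.

Context (d : measure_display) (T : measurableType d) (P : probability T R).
Implicit Types (Y Z : T -> R -> S).

Lemma measurable_process_path Y C : measurable_process Y -> path_sigma C ->
  measurable (Y @^-1` C).
Proof.
move=> mY; apply: path_sigma_preimage; first exact: sigma_algebra_measurable.
by move=> t O t0 oO; apply: mY => //; exact: sub_sigma_algebra.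
Qed.

Lemma eq_law_sym Y Z : eq_law P Y Z -> eq_law P Z Y.
Proof. by move=> h C pC; rewrite h. Qed.

Lemma eq_law_trans Z Y W : eq_law P Y Z -> eq_law P Z W -> eq_law P Y W.
Proof. by move=> h h' C pC; rewrite h// h'. Qed.

(** Dynkin's theorem: the events on which two probability laws agree form a Dynkin system, which
    contains the sigma-algebra generated by any subsystem stable under intersection. *)
Lemma eq_law_pi Y Z (G : set (set (R -> S))) :
  measurable_process Y -> measurable_process Z ->
  setI_closed G -> G `<=` @path_sigma R S ->
  (forall C, path_sigma C -> <<s G >> C) ->
  (forall C, G C -> law P Y C = law P Z C) -> eq_law P Y Z.
Proof.
move=> mY mZ GI Gp pG GYZ C /pG; rewrite -(setI_closed_g_dynkin_g_sigma_algebra GI).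
move=> /(_ [set C | path_sigma C /\ law P Y C = law P Z C]).
case=> //; split; last by move=> D GD; split; [exact: Gp|exact: GYZ].
split.
- by split; [exact: path_sigmaT|rewrite /law !preimage_setT !probability_setT].
- move=> D [pD YZ]; split; first exact: path_sigmaC.
  have hC U : measurable_process U -> law P U (~` D) = (1 - law P U D)%E.
    by move=> mU; exact: (probability_setC P (measurable_process_path mU pD)).
  by rewrite !hC// YZ.
- move=> F tF pF; split; first by apply: path_sigma_bigcup => n; case: (pF n).
  rewrite /law !preimage_bigcup !measure_bigcup //=.
  + by apply: eq_eseriesr => n _; case: (pF n).
  + by move=> i _; apply: measurable_process_path => //; case: (pF i).
  + by move=> i j _ _ [u [/= ui uj]]; apply: tF => //; exists (Z u).
  + by move=> i _; apply: measurable_process_path => //; case: (pF i).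
  + by move=> i j _ _ [u [/= ui uj]]; apply: tF => //; exists (Y u).
Qed.

End paths.

(** * Paths with values in the one-point compactification *)

Section cemetery_paths.
Variables (R : realType) (M : metricType R).
Local Notation E := (cemetery_ext M).
Implicit Types (w : R -> E) (O : set M).

(** The image of [O] under [Some], written as a match so that it computes on both constructors. *)
Definition live O : set E := fun x => if x is Some y then O y else False.

Lemma liveE O : Some @` O = live O.
Proof.
by apply/seteqP; split => [_ [y Oy <-]//|[y|//] Oy]; exists y.
Qed.

Lemma live_omap (g : M -> M) O (x : E) : live O (omap g x) = live (g @^-1` O) x.
Proof. by case: x. Qed.

Let GS := [set live O | O in @open M].

(** An open set is its live part, together possibly with the cemetery, and the singleton of the
    cemetery is the complement of [live setT]. Events can therefore be tested on open sets of [M]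
    alone. *)
Lemma borel_opc (B : set E) : borel B -> <<s GS >> B.
Proof.
apply: g_sigma_sub => V oV.
have -> : V = live (Some @^-1` V) `|` (V `&` [set None]).
  apply/seteqP; split => x.
    by case: x => [y|] Vx; [left|right].
  by case: x => [y|] [|[]].
have [s0 sC sU] := g_sigma GS.
have sub Q : open Q -> <<s GS >> (live Q).
  by move=> oQ; apply: sub_sigma_algebra; exists Q.
have s2 A B' : <<s GS >> A -> <<s GS >> B' -> <<s GS >> (A `|` B').
  by move=> sA sB; rewrite -bigcup2E; apply: sU => -[|[|n]].
apply: s2.
  apply: sub; have := @one_point_compactification_some_continuous M.
  by move/continuousP; apply.
have [VN|nVN] := pselect (V None); last first.
  rewrite (_ : _ `&` _ = set0)//; apply/seteqP; split => // x [+ xN].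
  by rewrite xN.
suff -> : V `&` [set None] = setT `\` live setT by apply: sC; apply: sub; exact: openT.
by apply/seteqP; split => [x [_ ->]|[x|]] /=; [split|case=> _ []|split].
Qed.

Lemma open_opc_live O : open O -> @borel E (live O).
Proof.
move=> oO; apply: sub_sigma_algebra; rewrite -liveE.
exact: one_point_compactification_open_some.
Qed.

Definition open_cylinders : set (set (R -> E)) :=
  [set C | exists2 s : seq (R * set M),
     (forall p, p \in s -> 0 <= p.1 /\ open p.2) &
     C = [set w | forall p, p \in s -> live p.2 (w p.1)]].

Lemma open_cylinders_setI : setI_closed open_cylinders.
Proof.
move=> _ _ [s hs ->] [s' hs' ->]; exists (s ++ s').
  by move=> p; rewrite mem_cat => /orP[]; [exact: hs|exact: hs'].
apply/seteqP; split=> w /=.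
  by move=> [h h'] p; rewrite mem_cat => /orP[]; [exact: h|exact: h'].
by move=> h; split => p ps; apply: h; rewrite mem_cat ps ?orbT.
Qed.

Lemma path_sigma_live (t : R) O : 0 <= t -> open O ->
  path_sigma [set w : R -> E | live O (w t)].
Proof. by move=> t0 oO; apply: path_sigma_coord => //; exact: open_opc_live. Qed.

Lemma path_sigma_finI (s : seq (R * set M)) (Q : R * set M -> set (R -> E)) :
  (forall p, p \in s -> path_sigma (Q p)) ->
  path_sigma [set w | forall p, p \in s -> Q p w].
Proof.
elim: s => [_|p s IH hs].
  rewrite (_ : [set _ | _] = setT); first exact: path_sigmaT.
  by apply/seteqP; split => // w _ /= p; rewrite in_nil.
rewrite (_ : [set _ | _] = Q p `&` [set w | forall p, p \in s -> Q p w]).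
  apply: path_sigmaI; first by apply: hs; rewrite mem_head.
  by apply: IH => q qs; apply: hs; rewrite in_cons qs orbT.
apply/seteqP; split => w /=.
  move=> h; split; first by apply: h; rewrite mem_head.
  by move=> q qs; apply: h; rewrite in_cons qs orbT.
by move=> [h h'] q; rewrite in_cons => /orP[/eqP->//|]; exact: h'.
Qed.

Lemma open_cylinders_path : open_cylinders `<=` @path_sigma R E.
Proof.
move=> _ [s hs ->].
by apply: path_sigma_finI => p /hs[? ?]; exact: path_sigma_live.
Qed.

Lemma path_open_cylinders C : path_sigma C -> <<s open_cylinders >> C.
Proof.
apply: g_sigma_sub => _ [t [B [t0 bB ->]]].
apply: (@sigma_algebra_preimage_sub _ _ (fun w : R -> E => w t) _ _ _ _ _
  (borel_opc bB)); first exact: g_sigma.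
move=> _ [Q oQ <-]; apply: sub_sigma_algebra.
exists [:: (t, Q)].
  by move=> p; rewrite inE => /eqP->.
apply/seteqP; split => w /=.
  by move=> h p; rewrite inE => /eqP->.
by move=> h; apply: (h (t, Q)); rewrite inE.
Qed.

Lemma path_sigma_live_preimage (U : Type) (H : set (set U)) (F : U -> R -> E) :
  sigma_algebra setT H ->
  (forall (t : R) O, 0 <= t -> open O -> H [set u | live O (F u t)]) ->
  forall C, path_sigma C -> H (F @^-1` C).
Proof.
move=> sH HF; apply: sigma_algebra_preimage_sub => // C [t [B [t0 bB ->]]].
apply: (@sigma_algebra_preimage_sub _ _ (fun u => F u t) _ _ sH _ _ (borel_opc bB)).
by move=> _ [Q oQ <-]; exact: HF.
Qed.

(* The image of a path under the pair (f_y, c_y) of the paper, for [g = f_y] and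
   [a = c_y]. *)
Definition act (g : M -> M) (a : R) w : R -> E := fun t => omap g (w (a * t)).

Lemma path_sigma_act (g : M -> M) (a : R) C : continuous g -> 0 < a ->
  path_sigma C -> path_sigma (act g a @^-1` C).
Proof.
move=> cg a0; apply: path_sigma_live_preimage; first exact: g_sigma.
move=> t O t0 oO; rewrite /act.
rewrite (_ : [set u | _] = [set u : R -> E | live (g @^-1` O) (u (a * t))]); last first.
  by apply/seteqP; split => u /=; rewrite live_omap.
apply: path_sigma_live; first by rewrite mulr_ge0// ltW.
by move/continuousP: cg; apply.
Qed.

Context (d : measure_display) (T : measurableType d) (P : probability T R).

Lemma measurable_process_act (g : M -> M) (a : R) (Y : T -> R -> E) :
  continuous g -> 0 < a -> measurable_process Y ->
  measurable_process (fun om => act g a (Y om)).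
Proof.
move=> cg a0 mY t B t0 bB.
by apply: measurable_process_path mY (path_sigma_act cg a0 (path_sigma_coord t0 bB)).
Qed.

Lemma eq_law_act (g : M -> M) (a : R) (Y Z : T -> R -> E) :
  continuous g -> 0 < a -> eq_law P Y Z ->
  eq_law P (fun om => act g a (Y om)) (fun om => act g a (Z om)).
Proof.
move=> cg a0 YZ C pC.
exact: (YZ _ (path_sigma_act cg a0 pC)).
Qed.

(** At the cemetery, continuity means that preimages of compact sets are compact, which is
    continuity of the inverse. *)
Lemma continuous_omap (g ginv : M -> M) : continuous g -> continuous ginv ->
  cancel g ginv -> cancel ginv g -> continuous (omap g : E -> E).
Proof.
move=> cg cgi gK gVK [x|] U.
  by move=> h; exact: (cg x _ h).
case=> K [cK clK] KU; exists (ginv @` K).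
  have cgK : compact (ginv @` K).
    by apply: continuous_compact => //; exact: continuous_subspaceT.
  by split => //; apply: compact_closed => //; exact: metric_hausdorff.
move=> x [[y nKy <-]|->]; apply: KU; last by right.
left; exists (g y) => // Kgy; apply: nKy; exists (g y) => //.
Qed.

Definition right_cont w := forall t : R, 0 <= t -> w s @[s --> t^'+] --> w t.

Lemma right_cont_act (g ginv : M -> M) (a : R) w : continuous g ->
  continuous ginv -> cancel g ginv -> cancel ginv g -> 0 < a ->
  right_cont w -> right_cont (act g a w).
Proof.
move=> cg cgi gK gVK a0 rw t t0.
apply: (@cvg_comp _ _ _ (fun s => w (a * s)) (omap g) _ (nbhs (w (a * t)))).
  have h : a * s @[s --> t^'+] --> (a * t)^'+.
    move=> U /=; rewrite /at_right /= => -[e /= e0 eU].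
    exists (e / a); first by rewrite /= divr_gt0.
    move=> s /= ts tls; apply: eU; last by rewrite ltr_pM2l.
    rewrite /= -mulrBr normrM gtr0_norm// -ltr_pdivlMl//.
    by rewrite mulrC.
  apply: (cvg_comp _ _ h); apply: rw; by rewrite mulr_ge0// ltW.
exact: (continuous_omap cg cgi gK gVK).
Qed.

End cemetery_paths.

(** * Laws along moving homeomorphisms *)

Lemma near_all_seq (I : eqType) (U : Type) (F : set_system U) (s : seq I)
    (Q : I -> U -> Prop) : Filter F ->
  (forall i, i \in s -> \forall u \near F, Q i u) ->
  \forall u \near F, forall i, i \in s -> Q i u.
Proof.
move=> FF; elim: s => [_|i s IH h]; first by apply: nearW => u i; rewrite in_nil.
have h1 : \forall u \near F, Q i u by apply: h; rewrite mem_head.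
have h2 : \forall u \near F, forall j, j \in s -> Q j u.
  by apply: IH => j js; apply: h; rewrite in_cons js orbT.
apply: filterS2 h1 h2 => u Qi Qs j.
by rewrite in_cons => /orP[/eqP->//|]; exact: Qs.
Qed.

Section moving.
Variables (R : realType) (M : metricType R).
Local Notation E := (cemetery_ext M).
Implicit Types (v : R -> E) (O K : set M).

(** A continuous family of homeomorphisms with time scales. It abstracts from the components because
    two families derived from them are compared: w |-> f_(g w), and w |-> g o f_w with scale c_w
    a. *)
Definition moving (H Hi : M -> M -> M) (b : M -> R) : Prop :=
  [/\ forall w, cancel (H w) (Hi w), forall w, cancel (Hi w) (H w),
      continuous (fun p : M * M => H p.1 p.2),
      continuous (fun p : M * M => Hi p.1 p.2) &
      (forall w, 0 < b w) /\ continuous b].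

Lemma continuous_slice (N : topologicalType) (H : M -> M -> N) w :
  continuous (fun p : M * M => H p.1 p.2) -> continuous (H w).
Proof.
move=> cH x.
apply: (@cvg_comp _ _ _ (fun x => (w, x)) (fun p => H p.1 p.2) _ (nbhs (w, x))).
  by apply: cvg_pair => //=; exact: cvg_cst.
exact: (cH (w, x)).
Qed.

(** The tube lemma. *)
Lemma near_compact_image (H : M -> M -> M) z K O :
  continuous (fun p : M * M => H p.1 p.2) -> compact K -> open O ->
  (forall x, K x -> O (H z x)) -> \forall w \near z, forall x, K x -> O (H w x).
Proof.
move=> cH /compact_near_coveringP cK oO KO.
apply: (cK M (nbhs z) (fun w x => O (H w x))) => x Kx.
have : nbhs (z, x) [set p : M * M | O (H p.1 p.2)].
  by apply: (cH (z, x)); apply: open_nbhs_nbhs; split => //=; exact: KO.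
case=> -[A B] /= [zA xB] AB; exists (B, A) => // -[x' w'] [/= Bx Aw].
exact: (AB (w', x')).
Qed.

Lemma near_confined_image (H Hi : M -> M -> M) (b : M -> R) z K O :
  moving H Hi b -> compact K -> open O -> K `<=` O ->
  \forall w \near z, forall x, (K (H z x) -> O (H w x)) /\ (K (H w x) -> O (H z x)).
Proof.
move=> [HK HiK cH cHi _] cK oO KO.
have h1 : \forall w \near z, forall x, (Hi z @` K) x -> O (H w x).
  apply: near_compact_image => //.
    apply: continuous_compact => //; apply: continuous_subspaceT.
    exact: continuous_slice.
  by move=> _ [k Kk <-]; rewrite HiK; exact: KO.
have h2 : \forall w \near z, forall k, K k -> O (H z (Hi w k)).
  apply: (@near_compact_image (fun w k => H z (Hi w k))) => //.
    move=> p; apply: (@cvg_comp _ _ _ (fun p : M * M => Hi p.1 p.2) (H z) _ _ _ (cHi p)).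
    exact: continuous_slice.
  by move=> k Kk; rewrite HiK; exact: KO.
apply: filterS2 h1 h2 => w k1 k2 x; split => Kx.
  by apply: k1; exists (H z x); rewrite ?HK.
by rewrite -[x](HK w); exact: k2.
Qed.

Lemma near_time (b : M -> R) z (t e : R) : (forall w, 0 < b w) -> continuous b ->
  0 < e ->
  \forall w \near z, forall u, 0 <= u <= t ->
    (`|b w / b z * u - u| < e) /\ (`|b z / b w * u - u| < e).
Proof.
move=> b0 cb e0.
pose t' := Num.max 1 t.
have t'0 : 0 < t' by rewrite lt_max ltr01.
have c1 : \forall w \near z, `|b w / b z - 1| < e / t'.
  have : (fun w => b w / b z) w @[w --> z] --> b z / b z.
    by apply: cvgM; [exact: cb|exact: cvg_cst].
  rewrite divff ?gt_eqF// => /cvgrPdist_lt /(_ _ (divr_gt0 e0 t'0)).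
  by apply: filterS => w; rewrite distrC.
have c2 : \forall w \near z, `|b z / b w - 1| < e / t'.
  have : (fun w => b z / b w) w @[w --> z] --> b z / b z.
    apply: cvgM; first exact: cvg_cst.
    by apply: cvgV; [rewrite gt_eqF|exact: cb].
  rewrite divff ?gt_eqF// => /cvgrPdist_lt /(_ _ (divr_gt0 e0 t'0)).
  by apply: filterS => w; rewrite distrC.
have bnd (r u : R) : `|r - 1| < e / t' -> 0 <= u <= t -> `|r * u - u| < e.
  move=> hr /andP[u0 ut].
  rewrite -{2}(mul1r u) -mulrBl normrM (ger0_norm u0).
  have ut' : u <= t' by rewrite le_max ut orbT.
  apply: (@le_lt_trans _ _ (`|r - 1| * t')); first by rewrite ler_wpM2l.
  by rewrite -ltr_pdivlMr.
by apply: filterS2 c1 c2 => w h1 h2 u hu; split; exact: bnd.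
Qed.

Variables (S : nat -> set M).
Hypotheses (cS : forall m, compact (S m))
  (mS : forall m n, (m <= n)%N -> S m `<=` S n)
  (iS : forall K, compact K -> exists m, K `<=` interior (S m)).

(** Compact sets increasing to the open set [O]. *)
Definition inner n O : set M := [set x | n.+1%:R^-1 <= dist_out O x] `&` S n.

Lemma inner_compact n O : compact (inner n O).
Proof.
rewrite /inner setIC; apply: compact_closedI => //; exact: closed_dist_out.
Qed.

Lemma inner_sub n O : open O -> inner n O `<=` O.
Proof.
move=> oO x [h _]; apply: set_mem; rewrite -dist_out_gt0//.
by apply: lt_le_trans h; rewrite invr_gt0.
Qed.

Lemma inv_natS_le m n : (m <= n)%N -> n.+1%:R^-1 <= m.+1%:R^-1 :> R.
Proof. by move=> mn; rewrite lef_pV2 ?posrE// ler_nat. Qed.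

Lemma inner_mono m n O : (m <= n)%N -> inner m O `<=` inner n O.
Proof.
move=> mn x [/= h1 h2]; split; last exact: mS h2.
exact: le_trans (inv_natS_le mn) h1.
Qed.

(** An open set fits between the two compact sets, which leaves room for a small perturbation of the
    homeomorphism. The index [m] does not depend on [O], so that it serves all the constraints of a
    cylinder at once. *)
Lemma inner_next n : exists2 m, (n <= m)%N &
  forall O, exists2 O', open O' & inner n O `<=` O' /\ O' `<=` inner m O.
Proof.
have [m0 hm0] := iS (@cS n).
exists (maxn m0 n.+1); first by rewrite leq_max leqnSn orbT.
move=> O; exists ([set x | n.+2%:R^-1 < dist_out O x] `&` interior (S m0)).
  by apply: openI; [exact: open_dist_out|exact: open_interior].
split => x [/= h1 h2]; split.
- by apply: lt_le_trans h1; rewrite ltf_pV2 ?posrE// ltr_nat.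
- exact: hm0.
- by rewrite /= (le_trans _ (ltW h1))// inv_natS_le// leq_max leqnn orbT.
- by apply: (mS (leq_maxl _ _)); exact: interior_subset.
Qed.

Lemma open_inner x O : open O -> O x ->
  exists2 n, nbhs x (inner n O) & True.
Proof.
move=> oO Ox.
have dx : 0 < dist_out O x by rewrite dist_out_gt0//; exact: mem_set.
have [m hm] := iS (@compact_set1 _ x).
pose n := maxn m (Num.truncn (dist_out O x)^-1).
exists n => //.
have n1 : n.+1%:R^-1 < dist_out O x.
  rewrite -[ltRHS]invrK ltf_pV2 ?posrE ?invr_gt0//.
  by rewrite (lt_le_trans (truncnS_gt _))// ler_nat ltnS leq_maxr.
apply: filterI.
  have : nbhs x [set y | n.+1%:R^-1 < dist_out O y].
    by apply: open_nbhs_nbhs; split => //; exact: open_dist_out.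
  by apply: filterS => y /ltW.
apply: filterS (hm x erefl); apply: mS; exact: leq_maxl.
Qed.

(** Each constraint of a cylinder, an open set at a time [p.1], is replaced by a compact set during
    an interval right after [p.1]. Right-continuity makes the two comparable, and unlike the
    original constraint this one is stable under a small change of time scale. *)
Definition confined n (s : seq (R * set M)) (a b : R) v :=
  forall p, p \in s -> forall u, p.1 + a < u < p.1 + b -> live (inner n p.2) (v u).

(** Replacing the parameter [z] by a close [w], or conversely, moves positions from [inner n] to
    [inner m] at worst, and displaces times by less than [e]; hence the interval loses [e] at both
    ends. *)
Lemma moving_confined (H Hi : M -> M -> M) (b : M -> R) z s n m (a c e : R) :
  moving H Hi b ->
  (forall p, p \in s -> 0 <= p.1) -> 0 <= a -> 0 < e ->
  (forall O, exists2 O', open O' & inner n O `<=` O' /\ O' `<=` inner m O) ->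
  \forall w \near z, forall v,
    (confined n s a c (act (H z) (b z) v) ->
     confined m s (a + e) (c - e) (act (H w) (b w) v)) /\
    (confined n s a c (act (H w) (b w) v) ->
     confined m s (a + e) (c - e) (act (H z) (b z) v)).
Proof.
move=> mov s0 a0 e0 nm; have [HK HiK cH cHi [b0 cb]] := mov.
have h : \forall w \near z, forall p, p \in s ->
    (forall x, (inner n p.2 (H z x) -> inner m p.2 (H w x)) /\
      (inner n p.2 (H w x) -> inner m p.2 (H z x))) /\
    (forall u, 0 <= u <= p.1 + c ->
      (`|b w / b z * u - u| < e) /\ (`|b z / b w * u - u| < e)).
  apply: near_all_seq => p ps.
  have [Q oQ [h1 h2]] := nm p.2.
  have c1 := near_confined_image z mov (@inner_compact n p.2) oQ h1.
  have c2 := near_time z (p.1 + c) b0 cb e0.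
  apply: filterS2 c1 c2 => w k1 k2; split => // x.
  by have [l1 l2] := k1 x; split => [/l1|/l2]; exact: h2.
have key (x y : R) (B : M -> M -> Prop) p u v (gx gy : M -> M) : 0 < x -> 0 < y ->
   p \in s ->
   (forall x, inner n p.2 (gx x) -> inner m p.2 (gy x)) ->
   (forall u, 0 <= u <= p.1 + c -> `|y / x * u - u| < e) ->
   (forall u, p.1 + a < u < p.1 + c -> live (inner n p.2) (act gx x v u)) ->
   p.1 + (a + e) < u < p.1 + (c - e) ->
   live (inner m p.2) (act gy y v u).
  move=> x0 y0 ps hg ht hc /andP[u1 u2].
  have p0 := s0 p ps.
  have u0 : 0 <= u <= p.1 + c by apply/andP; split; lra.
  have := ht u u0; rewrite ltr_norml => /andP[t1 t2].
  (* With scale [x], the position [v (y * u)] is read at time [y / x * u]. *)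
  have := hc (y / x * u); rewrite /act.
  have -> : x * (y / x * u) = y * u by field; rewrite gt_eqF.
  have hr : p.1 + a < y / x * u < p.1 + c by apply/andP; split; lra.
  move=> /(_ hr).
  by case: (v (y * u)) => //= k; exact: hg.
apply: filterS h => w hw v; split => hc p ps u hu; have [h1 h2] := hw p ps.
  apply: (key (b z) (b w) (fun _ _ => True) p u v (H z)) => //.
  - by move=> x; case: (h1 x).
  - by move=> u' /h2[].
  - by move=> u'; exact: hc.
apply: (key (b w) (b z) (fun _ _ => True) p u v (H w)) => //.
- by move=> x; case: (h1 x).
- by move=> u' /h2[].
- by move=> u'; exact: hc.
Qed.

Lemma open_dead K : compact K -> open (~` live K : set E).
Proof.
move=> cK; rewrite openE => -[x|] /= hx; rewrite /interior.
  apply: (filterS (P := live (~` K))).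
    by case.
  rewrite -liveE; apply: one_point_compactification_some_nbhs.
  apply: open_nbhs_nbhs; split => //; apply: closed_openC.
  by apply: compact_closed => //; exact: metric_hausdorff.
exists K; first by split => //; apply: compact_closed => //; exact: metric_hausdorff.
by move=> y [[x nKx <-]|->].
Qed.

(** Being outside a compact set, cemetery included, is an open condition, hence it persists to the
    right of [u] and is seen at some rational time. *)
Lemma right_cont_rat K v (a b : R) : compact K -> right_cont v -> 0 <= a ->
  (forall q : rat, a < ratr q < b -> live K (v (ratr q))) ->
  forall u, a < u < b -> live K (v u).
Proof.
move=> cK rv a0 h u /andP[au ub]; apply: contrapT => nK.
have u0 : 0 <= u by rewrite (le_trans a0)// ltW.
have : \forall s \near u^'+, ~ live K (v s).
  by apply: (rv u u0 (~` live K)); apply: open_nbhs_nbhs; split => //; exact: open_dead.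
case=> e /= e0 he.
have [q] : exists q : rat, ratr q \in `]u, Num.min b (u + e)[.
  have uu : u < Num.min b (u + e) by rewrite lt_min ub ltrDl.
  by have [q hq] := rat_in_itvoo uu; exists q.
rewrite in_itv /= lt_min => /andP[uq /andP[qb qe]].
apply: (he (ratr q)) => //=.
  by rewrite ltr0_norm ?subr_lt0// opprB ltrBlDl.
by apply: h; rewrite qb andbT (lt_trans au).
Qed.

(** Rational times make this an event of [path_sigma]; on right-continuous paths it coincides with
    [confined]. *)
Definition confinedq n (s : seq (R * set M)) (a b : R) : set (R -> E) :=
  [set v | forall p, p \in s -> forall q : rat, p.1 + a < ratr q < p.1 + b ->
     live (inner n p.2) (v (ratr q))].

Lemma confinedqP n s (a b : R) v : right_cont v -> 0 <= a ->
  (forall p, p \in s -> 0 <= p.1) ->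
  confinedq n s a b v <-> confined n s a b v.
Proof.
move=> rv a0 s0; split=> h p ps; last by move=> q; exact: h.
apply: right_cont_rat => //; first exact: inner_compact.
  by rewrite addr_ge0// s0.
exact: h.
Qed.

Lemma path_sigma_dead K (t : R) : compact K -> 0 <= t ->
  path_sigma [set v : R -> E | live K (v t)].
Proof.
move=> cK t0; rewrite -(setCK [set v | _]); apply: path_sigmaC.
apply: (@path_sigma_coord _ E t (~` live K)) => //.
by apply: sub_sigma_algebra; exact: open_dead.
Qed.

Lemma path_sigma_confinedq n s (a b : R) : 0 <= a ->
  (forall p, p \in s -> 0 <= p.1) -> path_sigma (confinedq n s a b).
Proof.
move=> a0 s0.
apply: (@path_sigma_finI _ _ _ (fun p => [set v : R -> E | forall q : rat,
  p.1 + a < ratr q < p.1 + b -> live (inner n p.2) (v (ratr q))])) => p ps.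
rewrite (_ : [set v | _] = \bigcap_i [set v : R -> E |
  forall q : rat, unpickle i = Some q -> p.1 + a < ratr q < p.1 + b ->
    live (inner n p.2) (v (ratr q))]); last first.
  apply/seteqP; split => v /= h; first by move=> i _ q _; exact: h.
  by move=> q; apply: (h (pickle q) I); rewrite pickleK.
apply: path_sigma_bigcap => i.
case: (unpickle i) => [q|]; last first.
  by rewrite (_ : [set v | _] = setT); [exact: path_sigmaT|apply/seteqP; split].
have [hq|hq] := pselect (p.1 + a < ratr q < p.1 + b); last first.
  rewrite (_ : [set v | _] = setT); first exact: path_sigmaT.
  by apply/seteqP; split => // v _ q' [<-].
rewrite (_ : [set v | _] = [set v : R -> E | live (inner n p.2) (v (ratr q))]).
  apply: path_sigma_dead; first exact: inner_compact.
  by case/andP: hq => /ltW hq _; rewrite (le_trans _ hq)// addr_ge0// s0.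
by apply/seteqP; split => v /= h; [exact: h|move=> q' [<-]].
Qed.

Context (d : measure_display) (T : measurableType d) (P : probability T R).

(* Both laws vary with the parameter, but a path confined in a compact set during a
   closed time interval is, for all nearby parameters, confined in a slightly larger
   one during a slightly smaller interval: equality at a nearby [w] squeezes the
   law at [z]. *)
Lemma law_moving_le (Y : T -> R -> E) (H1 H1i H2 H2i : M -> M -> M)
    (b1 b2 : M -> R) z (C : set (R -> E)) :
  moving H1 H1i b1 -> moving H2 H2i b2 -> measurable_process Y ->
  (forall om, right_cont (Y om)) ->
  (forall C N, path_sigma C -> nbhs z N -> exists2 w, N w &
    law P (fun om => act (H1 w) (b1 w) (Y om)) C =
    law P (fun om => act (H2 w) (b2 w) (Y om)) C) ->
  open_cylinders C ->
  (law P (fun om => act (H1 z) (b1 z) (Y om)) C <=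
   law P (fun om => act (H2 z) (b2 z) (Y om)) C)%E.
Proof.
move=> mov1 mov2 mY rY hw [s hs ->].
have s0 p : p \in s -> 0 <= p.1 by move=> /hs[].
have so p : p \in s -> open p.2 by move=> /hs[].
have act_proc H Hi b w : moving H Hi b ->
   measurable_process (fun om => act (H w) (b w) (Y om)) /\
   (forall om, right_cont (act (H w) (b w) (Y om))).
  move=> [HK HiK cH cHi [b0 cb]]; split.
    by apply: measurable_process_act => //; exact: continuous_slice.
  move=> om; apply: (@right_cont_act _ _ _ (Hi w)) => //; exact: continuous_slice.
have [mZ1 rZ1] := act_proc _ _ _ z mov1.
have [mZ2 rZ2] := act_proc _ _ _ z mov2.
set Z1 := (fun om => act (H1 z) (b1 z) (Y om)) in mZ1 rZ1 *.
set Z2 := (fun om => act (H2 z) (b2 z) (Y om)) in mZ2 rZ2 *.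
rewrite -/Z1 in rZ1; have {}rZ1 om : right_cont (Z1 om) := rZ1 om.
have {}rZ2 om : right_cont (Z2 om) := rZ2 om.
pose dl n : R := n.+1%:R^-1.
have dl0 n : 0 < dl n by rewrite invr_gt0.
pose A n := Z1 @^-1` confinedq n s 0 (dl n).
have mA n : measurable (A n).
  by apply: measurable_process_path => //; exact: path_sigma_confinedq.
have ndA : {homo A : n m / (n <= m)%N >-> (n <= m)%O}.
  move=> n m nm; apply/subsetPset => om h p ps q /andP[q1 q2].
  have := h p ps q.
  rewrite q1 (lt_le_trans q2) ?lerD2l ?inv_natS_le// => /(_ isT).
  by case: (Z1 om (ratr q)) => //= x; exact: inner_mono.
have cyl_sub : Z1 @^-1` [set w | forall p, p \in s -> live p.2 (w p.1)] `<=`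
    \bigcup_n A n.
  move=> om /= hom.
  have : \forall n \near \oo, forall p, p \in s -> forall q : rat,
      p.1 + 0 < ratr q < p.1 + dl n -> live (inner n p.2) (Z1 om (ratr q)).
    apply: near_all_seq => p ps.
    have := hom p ps; case Zx : (Z1 om p.1) => [x|//] /= px.
    have [n hn _] := open_inner (so p ps) px.
    have : \forall u \near p.1^'+, live (inner n p.2) (Z1 om u).
      have := rZ1 om p.1 (s0 p ps); rewrite Zx; apply; rewrite -liveE.
      exact: one_point_compactification_some_nbhs.
    case=> e /= e0 he.
    near=> k => q; rewrite addr0 => /andP[q1 q2].
    have := he (ratr q); rewrite /= ltr0_norm ?subr_lt0// opprB ltrBlDl => /(_ _ q1).
    have dk : dl k < e.
      rewrite /dl -[ltRHS]invrK ltf_pV2 ?posrE ?invr_gt0//.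
      apply: (lt_trans (truncnS_gt _)); rewrite ltr_nat ltnS.
      near: k; exists (Num.truncn e^-1).+1 => // k; exact.
    have -> : ratr q < p.1 + e by rewrite (lt_trans q2)// ltrD2l.
    move=> /(_ isT); case: (Z1 om (ratr q)) => //= y; apply: inner_mono.
    by near: k; exists n.
  by case=> n _ /(_ n (leqnn n)) h; exists n.
have le_n n : (P (A n) <= law P Z2 [set w | forall p, p \in s -> live p.2 (w p.1)])%E.
  (* Two enlargements are spent: from [n] to [m1] when passing from [z] to [w] in the first family,
     from [m1] to [m2] when coming back from [w] to [z] in the second one. Each also costs [dl k] at
     both ends of the interval. *)
  have [m1 nm1 hm1] := inner_next n.
  have [m2 nm2 hm2] := inner_next m1.
  pose B k := Z2 @^-1` confinedq m2 s (dl k + dl k) (dl n - dl k - dl k).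
  have mB k : measurable (B k).
    apply: measurable_process_path => //; apply: path_sigma_confinedq => //.
    by rewrite addr_ge0// ltW.
  have AB k : (P (A n) <= P (B k))%E.
    have n1 := moving_confined z (dl n) mov1 s0 (lexx 0) (dl0 k) hm1.
    have n2 := moving_confined z (dl n - dl k) mov2 s0 (ltW (dl0 k)) (dl0 k) hm2.
    pose C' := confinedq m1 s (dl k) (dl n - dl k).
    have pC' : path_sigma C' by apply: path_sigma_confinedq => //; rewrite ltW.
    have [w [w1 w2] ew] := hw C' _ pC' (filterI n1 n2).
    have [mW1 rW1] := act_proc _ _ _ w mov1.
    have [mW2 rW2] := act_proc _ _ _ w mov2.
    apply: (@le_trans _ _ (law P (fun om => act (H1 w) (b1 w) (Y om)) C')).
      apply: le_measure; rewrite ?inE//; first exact: (measurable_process_path mW1).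
      move=> om /(confinedqP n (dl n) (rZ1 om) (lexx 0) s0) h.
      apply/(confinedqP m1 (dl n - dl k) (rW1 om) (ltW (dl0 k)) s0).
      by have [h' _] := w1 (Y om); have := h' h; rewrite add0r.
    rewrite ew; apply: le_measure; rewrite ?inE//.
      exact: (measurable_process_path mW2).
    move=> om /(confinedqP m1 (dl n - dl k) (rW2 om) (ltW (dl0 k)) s0) h.
    apply/(confinedqP m2 _ (rZ2 om) (addr_ge0 (ltW (dl0 k)) (ltW (dl0 k))) s0).
    by have [_ h'] := w2 (Y om); exact: h'.
  have niB : {homo B : n m / (n <= m)%N >-> (m <= n)%O}.
    move=> k l kl; apply/subsetPset => om h p ps q /andP[q1 q2].
    have lk : dl l <= dl k by exact: inv_natS_le.
    by apply: h => //; apply/andP; split; lra.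
  (* As [k] grows the loss of time vanishes, while the compact sets stay fixed at level [m2]: in the
     limit the path is confined during the whole open interval after [p.1], and right-continuity
     carries this to [p.1] itself. *)
  apply: (@le_trans _ _ (P (\bigcap_k B k))).

    have cv : (P \o B) k @[k --> \oo] --> P (\bigcap_k B k).
      apply: nonincreasing_cvg_mu => //.
        by rewrite (le_lt_trans (probability_le1 _ _)) ?ltry.
      by apply: bigcap_measurable.
    rewrite -(cvg_lim _ cv)//; apply: lime_ge; first exact: cvgP cv.
    by apply: nearW => k; exact: AB.
  apply: le_measure; rewrite ?inE.
  - by apply: bigcap_measurable.
  - apply: measurable_process_path => //; apply: open_cylinders_path.
    by exists s.
  move=> om hB p ps.
  apply: contrapT => nO.
  have nK : ~ live (inner m2 p.2) (Z2 om p.1).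
    by move: nO; case: (Z2 om p.1) => //= x nO /(inner_sub (so p ps)).
  have : \forall u \near p.1^'+, ~ live (inner m2 p.2) (Z2 om u).
    apply: (rZ2 om p.1 (s0 p ps) (~` live (inner m2 p.2))).
    by apply: open_nbhs_nbhs; split => //; apply: open_dead; exact: inner_compact.
  case=> e /= e0 he.
  pose r := Num.min e (dl n).
  have r0 : 0 < r by rewrite lt_min e0 dl0.
  have [q] : exists q : rat, ratr q \in `]p.1, p.1 + r / 2[.
    have uu : p.1 < p.1 + r / 2 by rewrite ltrDl divr_gt0.
    by have [q hq] := rat_in_itvoo uu; exists q.
  rewrite in_itv /= => /andP[uq qe].
  have re : r <= e by rewrite ge_min lexx.
  have rd : r <= dl n by rewrite ge_min lexx orbT.
  have := he (ratr q); rewrite /= ltr0_norm ?subr_lt0// opprB ltrBlDl.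
  have -> : ratr q < p.1 + e by lra.
  move=> /(_ isT uq); apply.
  (* The index [k] must be so large that [ratr q] is at distance more than [2 * dl k] from both ends
     of the interval. *)
  pose g := Num.min (ratr q - p.1) (r / 2).
  have g0 : 0 < g by rewrite lt_min subr_gt0 uq divr_gt0.
  pose k := Num.truncn (4 / g).
  have dk : 4 * dl k < g.
    by rewrite /dl ltr_pdivrMr// mulrC -ltr_pdivrMr// truncnS_gt.
  have g1 : g <= ratr q - p.1 by rewrite ge_min lexx.
  have g2 : g <= r / 2 by rewrite ge_min lexx orbT.
  have dk0 := dl0 k.
  by apply: (hB k I p ps); apply/andP; split; lra.
apply: (@le_trans _ _ (P (\bigcup_n A n))).
  apply: le_measure; rewrite ?inE//.
  - apply: measurable_process_path => //; apply: open_cylinders_path.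
    by exists s.
  - by apply: bigcup_measurable.
have cv : (P \o A) k @[k --> \oo] --> P (\bigcup_k A k).
  apply: nondecreasing_cvg_mu => //.
  by apply: bigcup_measurable.
rewrite -(cvg_lim _ cv)//; apply: lime_le; first exact: cvgP cv.
by apply: nearW => k; exact: le_n.
Unshelve. all: by end_near. Qed.

Lemma eq_law_moving (Y : T -> R -> E) (H1 H1i H2 H2i : M -> M -> M)
    (b1 b2 : M -> R) z :
  moving H1 H1i b1 -> moving H2 H2i b2 -> measurable_process Y ->
  (forall om, right_cont (Y om)) ->
  (forall C N, path_sigma C -> nbhs z N -> exists2 w, N w &
    law P (fun om => act (H1 w) (b1 w) (Y om)) C =
    law P (fun om => act (H2 w) (b2 w) (Y om)) C) ->
  eq_law P (fun om => act (H1 z) (b1 z) (Y om))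
           (fun om => act (H2 z) (b2 z) (Y om)).
Proof.
move=> mov1 mov2 mY rY h; apply: (@eq_law_pi _ _ _ _ _ _ _ (@open_cylinders R M)).
- have [_ _ cH _ [b0 _]] := mov1.
  by apply: measurable_process_act => //; exact: continuous_slice.
- have [_ _ cH _ [b0 _]] := mov2.
  by apply: measurable_process_act => //; exact: continuous_slice.
- exact: open_cylinders_setI.
- exact: open_cylinders_path.
- exact: path_open_cylinders.
move=> C oC; apply/eqP; rewrite eq_le; apply/andP; split.
  exact: (law_moving_le mov1 mov2).
apply: (law_moving_le mov2 mov1) => // C' N pC' zN.
by have [w Nw ew] := h C' N pC' zN; exists w.
Qed.

End moving.

(** * Transfer of the law to all starting points *)

Lemma emeasurable_fun_ge (R : realType) (d : measure_display)
    (T : measurableType d) (f : T -> \bar R) :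
  (forall x : R, measurable [set om | (x%:E <= f om)%E]) -> measurable_fun setT f.
Proof.
move=> h; apply: (measurability _ (ErealGenCInfty.measurableE R)).
move=> _ [_ [x ->] <-]; rewrite setTI.
rewrite (_ : _ @^-1` _ = [set om | (x%:E <= f om)%E])//.
by apply/seteqP; split => om /=; rewrite in_itv/= ?andbT.
Qed.

Lemma bigcup_gt0 (R : realType) (d : measure_display) (T : measurableType d)
    (P : probability T R) (F : nat -> set T) :
  (forall n, measurable (F n)) -> (0 < P (\bigcup_n F n))%E ->
  exists n, (0 < P (F n))%E.
Proof.
move=> mF h; apply: contrapT => /forallNP hn; move: h.
rewrite (@measure_negligible _ _ _ P) ?ltxx//; first exact: bigcup_measurable.
apply: negligible_bigcup => k; exists (F k); split => //.
by apply/eqP; rewrite eq_le measure_ge0 andbT leNgt; apply/negP; exact: hn.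
Qed.

Section markov.
Variables (R : realType) (M : metricType R).
Local Notation E := (cemetery_ext M).
Context (d : measure_display) (T : measurableType d) (P : probability T R).
Variable X : M -> T -> R -> E.
Hypothesis XM : strong_markov_process P X.

Lemma cadlag_right_cont (w : R -> E) : cadlag w -> right_cont w.
Proof. by case. Qed.

Lemma process_right_cont y om : right_cont (X y om).
Proof. exact/cadlag_right_cont/(process_cadlag XM). Qed.

Lemma borel_live (B : set M) : borel B -> @borel E (live B).
Proof.
move=> bB; pose H := [set B : set M | @borel E (live B)].
have [b0 bC bU] := g_sigma (@open E).
suff : H B by [].
apply: (@smallest_sub _ _ _ H _ _ B bB); last by move=> Q oQ; exact: open_opc_live.
split.
- rewrite /H /= (_ : live set0 = set0)//.
  by apply/seteqP; split => // -[].
- move=> A HA; rewrite /H /=.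
  rewrite (_ : live _ = setT `\` (live A `|` (setT `\` live setT))); last first.
    apply/seteqP; split => -[x|] //=; first by move=> [_ nA]; split => // -[//|[_]]; exact.
      by move=> [_ nA]; split => // Ax; apply: nA; left.
    by move=> [_]; apply; right; split.
  apply: (bC); rewrite -bigcup2E; apply: (bU) => -[|[|n]] //=; apply: (bC).
  exact: (open_opc_live openT).
- move=> F HF; rewrite /H /= (_ : live _ = \bigcup_k live (F k)).
    by apply: (bU) => k; exact: HF.
  apply/seteqP; split => -[x|] //=.
  by case.
Qed.

Lemma law_fin (Y : T -> R -> E) C : measurable_process Y -> path_sigma C ->
  law P Y C \is a fin_num.
Proof. by move=> mY pC; apply: fin_num_measure; exact: measurable_process_path. Qed.

Lemma borel_law_ge C (x : R) : path_sigma C ->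
  borel [set w | (x%:E <= law P (X w) C)%E].
Proof.
move=> pC; have := @process_kernel _ _ _ _ _ _ XM C pC [set z : \bar R | (x%:E <= z)%E].
apply; rewrite -(setCK [set z | _]) -setTD.
have [_ h _] := g_sigma (@open (\bar R)); apply: h; apply: sub_sigma_algebra.
by apply: closed_openC; exact: closed_ereal_le_ereal.
Qed.

Lemma borel_law_le C (x : R) : path_sigma C ->
  borel [set w | (law P (X w) C <= x%:E)%E].
Proof.
move=> pC; have := @process_kernel _ _ _ _ _ _ XM C pC [set z : \bar R | (z <= x%:E)%E].
apply; rewrite -(setCK [set z | _]) -setTD.
have [_ h _] := g_sigma (@open (\bar R)); apply: h; apply: sub_sigma_algebra.
by apply: closed_openC; exact: closed_ereal_ge_ereal.
Qed.

Lemma process_live y (t : R) (B : set M) : 0 <= t -> borel B ->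
  measurable [set om | live B (X y om t)].
Proof.
by move=> t0 bB; apply: (process_measurable XM) => //; exact: borel_live.
Qed.

Lemma past_algebra (S : topologicalType) (Y : T -> R -> S) (t : R) :
  sigma_algebra setT (past Y t).
Proof. exact: g_sigma. Qed.

Lemma pastT (S : topologicalType) (Y : T -> R -> S) (t : R) : past Y t setT.
Proof.
by have [h0 hC _] := past_algebra Y t; rewrite -(setD0 setT); exact: hC.
Qed.

Lemma past0 (S : topologicalType) (Y : T -> R -> S) (t : R) : past Y t set0.
Proof. by have [] := past_algebra Y t. Qed.

Lemma simple_markov y (t : R) (B : set M) C : 0 <= t -> borel B -> path_sigma C ->
  P ([set om | live B (X y om t)] `&` [set om | C (fun s => X y om (t + s))]) =
  (\int[P]_(om in [set om | live B (X y om t)]) law P (started X (X y om t)) C)%E.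
Proof.
move=> t0 bB pC.
have := @process_strong_markov _ _ _ _ _ _ XM y (fun _ => t%:E)
   [set om | live B (X y om t)] C.
rewrite (_ : [set om | (t%:E < +oo)%E] = setT) ?setIT; last first.
  by apply/seteqP; split => // om _ /=; rewrite ltry.
apply => //.
  split; first by move=> om; rewrite lee_fin.
  move=> s s0; have [ts|ts] := boolP (t <= s).
    rewrite (_ : [set om | _] = setT); first exact: pastT.
    by apply/seteqP; split => // om _ /=; rewrite lee_fin.
  rewrite (_ : [set om | _] = set0); first exact: past0.
  by apply/seteqP; split => // om /=; rewrite lee_fin (negbTE ts).
split; first exact: process_live.
move=> s s0; have [ts|ts] := boolP (t <= s).
  rewrite (_ : [set om : T | (t%:E <= s%:E)%E] = setT) ?setIT.
    apply: sub_sigma_algebra; exists t, (live B); split => //.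
      by rewrite t0.
    exact: borel_live.
  by apply/seteqP; split => // om _ /=; rewrite lee_fin.
rewrite (_ : [set om : T | (t%:E <= s%:E)%E] = set0) ?setI0; first exact: past0.
by apply/seteqP; split => // om /=; rewrite lee_fin (negbTE ts).
Qed.

Let kernel_meas y (t : R) (B : set M) C : 0 <= t -> path_sigma C ->
  measurable_fun setT (fun om => law P (started X (X y om t)) C).
Proof.
move=> t0 pC; apply: emeasurable_fun_ge => x.
rewrite (_ : [set om | _] =
  [set om | live [set w | (x%:E <= law P (X w) C)%E] (X y om t)] `|`
  ([set om | (x%:E <= law P (fun _ _ => None : E) C)%E] `&`
    ~` [set om | live setT (X y om t)])); last first.
  apply/seteqP; split => om /=; case: (X y om t) => [z|] /=; first by left.
  - by right; split.
  - by case=> // -[].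
  - by case=> // -[].
apply: measurableU; first by apply: process_live => //; exact: borel_law_ge.
apply: measurableI.
  have [h|h] := pselect (x%:E <= law P (fun _ _ => None : E) C)%E.
    by rewrite (_ : [set om | _] = setT)//; apply/seteqP; split.
  by rewrite (_ : [set om | _] = set0)//; apply/seteqP; split.
apply: measurableC; apply: process_live => //.
by apply: sub_sigma_algebra; exact: openT.
Qed.

(** One-sided bounds on the transition kernel are enough below: two kernels will be compared on sets
    where a pair of rational numbers separates them, which avoids transporting the integral of the
    Markov property. *)
Lemma simple_markov_le y (t k : R) (B : set M) C : 0 <= t -> borel B ->
  path_sigma C -> (forall w, B w -> (law P (X w) C <= k%:E)%E) ->
  (P ([set om | live B (X y om t)] `&` [set om | C (fun s => X y om (t + s))]) <=
   k%:E * P [set om | live B (X y om t)])%E.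
Proof.
move=> t0 bB pC hk; rewrite simple_markov//.
have mB := process_live y t0 bB.
rewrite -(integral_cst P mB); apply: ge0_le_integral => //.
- by apply: measurable_funTS; exact: kernel_meas.
- by move=> om /=; case: (X y om t) => //= w; exact: hk.
Qed.

Lemma simple_markov_ge y (t k : R) (B : set M) C : 0 <= t -> borel B -> 0 <= k ->
  path_sigma C -> (forall w, B w -> (k%:E <= law P (X w) C)%E) ->
  (k%:E * P [set om | live B (X y om t)] <=
   P ([set om | live B (X y om t)] `&` [set om | C (fun s => X y om (t + s))]))%E.
Proof.
move=> t0 bB k0 pC hk; rewrite simple_markov//.
have mB := process_live y t0 bB.
rewrite -(integral_cst P mB); apply: ge0_le_integral => //.
- by apply: measurable_funTS; exact: kernel_meas.
- by move=> om /=; case: (X y om t) => //= w; exact: hk.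
Qed.

Definition transfers (g : M -> M) (a : R) y :=
  eq_law P (X (g y)) (fun om => act g a (X y om)).

Lemma borel_open (B : set M) : open B -> borel B.
Proof. exact: sub_sigma_algebra. Qed.

Lemma borelI (A B : set M) : borel A -> borel B -> borel (A `&` B).
Proof.
move=> bA bB; have [h0 hC hU] := g_sigma (@open M).
rewrite -(setCK (A `&` B)) setCI -setTD; apply: (hC).
by rewrite -bigcup2E; apply: (hU) => -[|[|n]] //=; rewrite -setTD; exact: hC.
Qed.

Lemma borel_preimage (g : M -> M) (B : set M) : continuous g -> borel B ->
  borel (g @^-1` B).
Proof.
move=> cg; apply: sigma_algebra_preimage_sub; first exact: g_sigma.
move=> Q oQ; apply: borel_open; by move/continuousP: cg; apply.
Qed.

Lemma path_sigma_shift (t : R) C : 0 <= t -> path_sigma C ->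
  path_sigma [set w : R -> E | C (fun s => w (t + s))].
Proof.
move=> t0; apply: path_sigma_preimage; first exact: g_sigma.
move=> s O s0 oO; apply: (@path_sigma_coord _ E (t + s) O); first exact: addr_ge0.
exact: sub_sigma_algebra.
Qed.

(** The position at time [t] from [y] is matched with the position at time [t / a] from [g y], and
    the futures of the two paths correspond to each other by the same action. *)
Lemma transfers_markov g ginv a y (t : R) (B : set M) C :
  continuous g -> continuous ginv -> cancel g ginv -> 0 < a ->
  transfers g a y -> 0 <= t -> borel B -> path_sigma C ->
  P [set om | live (ginv @^-1` B) (X (g y) om (t / a))] =
    P [set om | live B (X y om t)] /\
  P ([set om | live (ginv @^-1` B) (X (g y) om (t / a))] `&`
       [set om | C (fun s => X (g y) om (t / a + s))]) =
  P ([set om | live B (X y om t)] `&`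
      [set om | (act g a @^-1` C) (fun s => X y om (t + s))]).
Proof.
move=> cg cgi gK a0 tr t0 bB pC.
have ta : 0 <= t / a by rewrite divr_ge0// ltW.
have p1 : path_sigma [set w : R -> E | live (ginv @^-1` B) (w (t / a))].
  by apply: path_sigma_coord => //; apply: borel_live; exact: borel_preimage.
have p2 := path_sigmaI p1 (path_sigma_shift ta pC).
have e1 om : live (ginv @^-1` B) (act g a (X y om) (t / a)) = live B (X y om t).
  rewrite /act live_omap mulrC divfK ?gt_eqF//; congr (live _ _).
  by apply/funext => x /=; rewrite gK.
split.
  have := tr _ p1; rewrite /law /preimage /= => ->.
  by congr (P _); apply/seteqP; split => om /=; rewrite e1.
have := tr _ p2; rewrite /law /preimage /= => h.
rewrite [LHS]h; congr (P _).
have e2 om : (fun s => act g a (X y om) (t / a + s)) =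
   act g a (fun s => X y om (t + s)).
  by apply/funext => s; rewrite /act mulrDr mulrCA divff ?mulr1 ?gt_eqF.
by apply/seteqP; split => om /= []; rewrite e1 e2.
Qed.

Lemma open_ball_metric (x : M) (e : R) : open (ball x e).
Proof.
rewrite openE => y; rewrite ballEmdist /= => xy.
have : nbhs y (ball y (e - mdist x y)) by apply: nbhsx_ballx; rewrite subr_gt0.
apply: filterS => z; rewrite !ballEmdist /= => h.
by rewrite (le_lt_trans (metric_triangle x y z))// -ltrBrDl.
Qed.

(** If the two laws differed on [C] at every point of a ball around [z], countably many pairs of
    rational numbers would separate them. On each set of points separated by q1 < q2, the Markov
    property bounds the same joint probability above by q1 and below by q2 times the probability of
    being there at time [t], which is thus zero. The ball would have probability zero at time [t],
    against the choice of [t] by the support. *)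
Lemma transfers_near_support g ginv a y z C (N : set M) :
  continuous g -> continuous ginv -> cancel g ginv -> cancel ginv g -> 0 < a ->
  transfers g a y -> process_support P (X y) z -> path_sigma C -> nbhs z N ->
  exists2 w, N w & law P (X (g w)) C = law P (fun om => act g a (X w om)) C.
Proof.
move=> cg cgi gK gVK a0 tr sz pC; rewrite -nbhs_ballE => -[e /= e0 zeN].
have [t t0] := sz e e0; rewrite liveE => Pt.
apply: contrapT => /forall2NP hN.
pose Q1 w := law P (X (g w)) C.
pose Q2 w := law P (X w) (act g a @^-1` C).
have pC2 : path_sigma (act g a @^-1` C) by exact: path_sigma_act.
have q1f w : Q1 w \is a fin_num by apply: law_fin => //; exact: (process_measurable XM).
have q2f w : Q2 w \is a fin_num by apply: law_fin => //; exact: (process_measurable XM).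
have Qneq w : ball z e w -> Q1 w <> Q2 w.
  by move=> zw; have [/(_ (zeN _ zw))//|h] := hN w; exact: h.
pose B1 (q : rat * rat) := ball z e `&`
  ([set w | (Q1 w <= (ratr q.1)%:E)%E] `&` [set w | ((ratr q.2)%:E <= Q2 w)%E]).
pose B2 (q : rat * rat) := ball z e `&`
  ([set w | ((ratr q.2)%:E <= Q1 w)%E] `&` [set w | (Q2 w <= (ratr q.1)%:E)%E]).
have bball : borel (ball z e) by apply: borel_open; exact: open_ball_metric.
have bQ1le x : borel [set w | (Q1 w <= x%:E)%E].
  exact: (@borel_preimage g [set w | (law P (X w) C <= x%:E)%E] cg (borel_law_le x pC)).
have bQ1ge x : borel [set w | (x%:E <= Q1 w)%E].
  exact: (@borel_preimage g [set w | (x%:E <= law P (X w) C)%E] cg (borel_law_ge x pC)).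
have bB1 q : borel (B1 q).
  by apply: borelI => //; apply: borelI => //; exact: borel_law_ge.
have bB2 q : borel (B2 q).
  by apply: borelI => //; apply: borelI => //; exact: borel_law_le.
have ta : 0 <= t / a by rewrite divr_ge0// ltW.
have absurd_lt (q : rat * rat) (p : \bar R) (I : \bar R) : q.1 < q.2 ->
   (0 < p)%E -> p \is a fin_num ->
   ((ratr q.2)%:E * p <= I)%E -> (I <= (ratr q.1)%:E * p)%E -> False.
  move=> q12 p0 pf h1 h2; have := le_trans h1 h2; apply/negP; rewrite -ltNge.
  by rewrite lte_pmul2r// lte_fin ltr_rat.
have Pfin (B : set M) : borel B -> P [set om | live B (X y om t)] \is a fin_num.
  by move=> bB; apply: fin_num_measure; exact: process_live.
have zero1 q : q.1 < q.2 -> (P [set om | live (B1 q) (X y om t)] <= 0)%E.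
  move=> q12; rewrite leNgt; apply/negP => p0.
  have [f1 f2] := transfers_markov cg cgi gK a0 tr t0 (bB1 q) pC.
  (* The lower bound of the Markov property needs a nonnegative constant; below 0 the separated set
     is empty since [Q1] is a probability. *)
  have [q20|q20] := leP 0 (ratr q.2 : R); last first.
    have : B1 q = set0.
      apply/seteqP; split => // w [_ [/= h _]].
      have : (Q1 w < 0)%E.
        by rewrite (le_lt_trans h)// lte_fin (lt_trans _ q20)// ltr_rat.
      by rewrite ltNge measure_ge0.
    move=> B0; move: p0; rewrite B0 (_ : [set om | _] = set0) ?measure0 ?ltxx//.
    by apply/seteqP; split => // om /=; case: (X y om t).
  apply: (absurd_lt q _ _ q12 p0 (Pfin _ (bB1 q))).
    apply: (simple_markov_ge y t0 (bB1 q) q20 pC2).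
    by move=> w [_ []].
  rewrite -f1 -f2; apply: simple_markov_le => //; first exact: borel_preimage.
  by move=> w [_ [/= + _]]; rewrite /Q1 gVK.
have zero2 q : q.1 < q.2 -> (P [set om | live (B2 q) (X y om t)] <= 0)%E.
  move=> q12; rewrite leNgt; apply/negP => p0.
  have [f1 f2] := transfers_markov cg cgi gK a0 tr t0 (bB2 q) pC.
  have [q20|q20] := leP 0 (ratr q.2 : R); last first.
    have : B2 q = set0.
      apply/seteqP; split => // w [_ [_ /= h]].
      have : (Q2 w < 0)%E.
        by rewrite (le_lt_trans h)// lte_fin (lt_trans _ q20)// ltr_rat.
      by rewrite ltNge measure_ge0.
    move=> B0; move: p0; rewrite B0 (_ : [set om | _] = set0) ?measure0 ?ltxx//.
    by apply/seteqP; split => // om /=; case: (X y om t).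
  apply: (absurd_lt q _ _ q12 p0 (Pfin _ (bB2 q))); last first.
    apply: (simple_markov_le y t0 (bB2 q) pC2).
    by move=> w [_ []].
  rewrite -f1 -f2; apply: simple_markov_ge => //; first exact: borel_preimage.
  by move=> w [_ [/= + _]]; rewrite /Q1 gVK.
pose F n := if unpickle n is Some q then
    if (q.1 < q.2 :> rat) then [set om | live (B1 q) (X y om t)] `|`
      [set om | live (B2 q) (X y om t)] else set0
  else set0.
have mF n : measurable (F n).
  rewrite /F; case: (unpickle n) => // q; case: ifP => // _.
  by apply: measurableU; exact: process_live.
have [] := bigcup_gt0 (P := P) mF.
  apply: lt_le_trans Pt _; apply: le_measure; rewrite ?inE.
  - exact: process_live.
  - exact: bigcup_measurable.
  move=> om /=; case Xw : (X y om t) => [w|//] /= zw.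
  have mid (u v : R) : u < v -> exists q : rat * rat,
      [/\ q.1 < q.2, u <= ratr q.1 & ratr q.2 <= v].
    move=> uv; have [q1 /itvP h1] := rat_in_itvoo uv.
    have q1v : ratr q1 < v by rewrite h1.
    have [q2 /itvP h2] := rat_in_itvoo q1v.
    exists (q1, q2); split => /=; last 2 first.
    - by rewrite h1.
    - by rewrite h2.
    by rewrite -(ltr_rat R) h2.
  have := Qneq w zw; rewrite -(fineK (q1f w)) -(fineK (q2f w)) => neq.
  have : fine (Q1 w) != fine (Q2 w) by apply/eqP => e12; apply: neq; rewrite e12.
  rewrite neq_lt => /orP[] /mid[q [q12 h1 h2]]; (exists (pickle q); first exact: I);
    rewrite /F pickleK q12; [left|right]; rewrite /= Xw;
    (split; first exact: zw); split => /=.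
  - by rewrite -(fineK (q1f w)) lee_fin.
  - by rewrite -(fineK (q2f w)) lee_fin.
  - by rewrite -(fineK (q1f w)) lee_fin.
  - by rewrite -(fineK (q2f w)) lee_fin.
move=> n; rewrite /F; case: (unpickle n) => [q|]; last by rewrite measure0 ltxx.
case: ifP => q12; last by rewrite measure0 ltxx.
apply/negP; rewrite -leNgt.
apply: le_trans (measureU2 _ _ _) _; [exact: process_live|exact: process_live|].
by rewrite -(adde0 0%E); apply: leeD; [exact: zero1|exact: zero2].
Qed.

End markov.

Section transfer_everywhere.
Variables (R : realType) (M : metricType R).
Local Notation E := (cemetery_ext M).
Context (d : measure_display) (T : measurableType d) (P : probability T R).
Variable X : M -> T -> R -> E.
Hypothesis XM : strong_markov_process P X.
Hypotheses (lc : locally_cpt M) (sep : separable M).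
Variables (y0 : M) (f finv : M -> M -> M) (c : M -> R).
Hypothesis ic : invariance_components P X y0 f finv c.

Let fK := component_fK ic.
Let fVK := component_fVK ic.

Lemma component_moving : moving f finv c.
Proof.
split; [exact: fK|exact: fVK|exact: (component_f_continuous ic)|
  exact: (component_fV_continuous ic)|split].
  exact: (component_c_gt0 ic).
exact: (component_c_continuous ic).
Qed.

Lemma component_eq_law y : eq_law P (X y) (fun om => act (f y) (c y) (X y0 om)).
Proof. exact: (component_law ic). Qed.

(** Read at time 0: otherwise the event of not being at [y] would have probability 0 for one process
    and 1 for the other. *)
Lemma component_start y : f y y0 = y.
Proof.
apply: contrapT => neq.
have oO : open (~` [set y]).
  apply: closed_openC; apply: compact_closed; last exact: compact_set1.
  exact: metric_hausdorff.
have := component_eq_law y (path_sigma_live (lexx (0 : R)) oO).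
rewrite /law /preimage /=.
rewrite (_ : [set t | _] = set0); last first.
  by apply/seteqP; split => // om /=; rewrite (process_start XM) /=; exact.
rewrite (_ : [set t | _] = setT); last first.
  by apply/seteqP; split => // om _ /=; rewrite /act mulr0 (process_start XM).
by rewrite measure0 probability_setT => /eqP; rewrite eq_sym onee_eq0.
Qed.

Lemma act_comp (g g' : M -> M) (a b : R) (w : R -> E) :
  act g a (act g' b w) = act (g \o g') (b * a) w.
Proof. by apply/funext => t; rewrite /act mulrA; case: (w _). Qed.

Lemma continuous_comp2 (g1 g2 : M -> M) : continuous g1 -> continuous g2 ->
  continuous (g1 \o g2).
Proof. by move=> c1 c2 x; apply: continuous_comp; [exact: c2|exact: c1]. Qed.

(* By the Markov property the relation holds for almost all positions of the process
   started from [y], hence at points arbitrarily close to each point of the support;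
   [eq_law_moving] passes to the limit. *)
Lemma transfers_support g ginv a y z :
  continuous g -> continuous ginv -> cancel g ginv -> cancel ginv g -> 0 < a ->
  transfers P X g a y -> process_support P (X y) z -> transfers P X g a z.
Proof.
move=> cg cgi gK gVK a0 tr sz.
have [HK HiK cH cHi [c0 cc]] := component_moving.
have [S [cS mS iS]] := compact_exhaustion lc sep y0.
have e1 w : eq_law P (X (g w)) (fun om => act (f (g w)) (c (g w)) (X y0 om)).
  exact: component_eq_law.
have e2 w : eq_law P (fun om => act g a (X w om))
    (fun om => act (g \o f w) (c w * a) (X y0 om)).
  rewrite (_ : (fun om => act (g \o f w) _ _) =
      (fun om => act g a (act (f w) (c w) (X y0 om)))); last first.
    by apply/funext => om; rewrite act_comp.
  exact: eq_law_act (component_eq_law w).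
have pairg (N : topologicalType) (h : M -> M -> N) :
    continuous (fun p : M * M => h p.1 p.2) ->
    continuous (fun p : M * M => h (g p.1) p.2).
  move=> ch p; apply: (@cvg_comp _ _ _ (fun p : M * M => (g p.1, p.2))
    (fun p => h p.1 p.2) _ (nbhs (g p.1, p.2)) _ _ (ch (g p.1, p.2))).
  apply: cvg_pair => //=; last exact: cvg_snd.
  by apply: (@cvg_comp _ _ _ fst g _ (nbhs p.1)); [exact: cvg_fst|exact: cg].
have mov1 : moving (fun w => f (g w)) (fun w => finv (g w)) (fun w => c (g w)).
  split=> //; [exact: pairg|exact: pairg|split => // w].
  by apply: continuous_comp; [exact: cg|exact: cc].
have mov2 : moving (fun w => g \o f w) (fun w => finv w \o ginv) (fun w => c w * a).
  split.
  - by move=> w x /=; rewrite gK HK.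
  - by move=> w x /=; rewrite HiK gVK.
  - by move=> p; apply: (@continuous_comp _ _ _ (fun p : M * M => f p.1 p.2) g);
      [exact: cH|exact: cg].
  - move=> p; apply: (@cvg_comp _ _ _ (fun p : M * M => (p.1, ginv p.2))
      (fun p => finv p.1 p.2) _ (nbhs (p.1, ginv p.2)) _ _ (cHi (p.1, ginv p.2))).
    apply: cvg_pair => //=; first exact: cvg_fst.
    by apply: (@cvg_comp _ _ _ snd ginv _ (nbhs p.2)); [exact: cvg_snd|exact: cgi].
  - split; first by move=> w; rewrite mulr_gt0.
    by move=> w; apply: cvgM; [exact: cc|exact: cvg_cst].
apply: eq_law_trans (e1 z) _; apply: eq_law_trans (eq_law_sym (e2 z)).
apply: (eq_law_moving cS mS iS mov1 mov2 (process_measurable XM y0)).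
  exact: (process_right_cont XM).
move=> C N pC zN.
have [w Nw ew] := transfers_near_support XM cg cgi gK gVK a0 tr sz pC zN.
by exists w => //; rewrite -(e1 w C pC) -(e2 w C pC).
Qed.

(** Both processes are images of the one started from [y0]. The time [t] from [y] corresponds to
    [c y * t / c w] from [w], and the position is moved by f_w o f_y^-1. *)
Lemma support_translate y w u : process_support P (X y) u ->
  process_support P (X w) (f w (finv y u)).
Proof.
have [HK HiK cH cHi [c0 cc]] := component_moving.
move=> su e e0.
pose g := f w \o finv y.
have cg : continuous g by apply: continuous_comp2; exact: continuous_slice.
have : nbhs u (g @^-1` ball (g u) e) by apply: cg; exact: nbhsx_ballx.
rewrite -nbhs_ballE => -[r /= r0 ur].
have [t t0] := su r r0; rewrite liveE => Pt.
have ct : 0 <= c y * t / c w by rewrite divr_ge0 ?mulr_ge0// ltW.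
suff h : (0 < P [set om | live (ball (g u) e) (X w om (c y * t / c w))])%E.
  by exists (c y * t / c w) => //; rewrite -liveE in h.
have bb := open_ball_metric (g u) e.
have := component_eq_law w (path_sigma_live ct bb); rewrite /law /preimage /= => ->.
have mp v s B : 0 <= s -> open B ->
    measurable [set om | live B (act (f v) (c v) (X y0 om) s)].
  move=> s0 oB; have mY := process_measurable XM y0.
  have cf : continuous (f v) by exact: continuous_slice.
  exact: (measurable_process_path (measurable_process_act cf (c0 v) mY)
    (path_sigma_live s0 oB)).
apply: lt_le_trans Pt _.
have := component_eq_law y (path_sigma_live t0 (open_ball_metric u r)).
rewrite /law /preimage /= => ->; apply: le_measure; rewrite ?inE.
- by apply: mp => //; exact: open_ball_metric.
- by apply: mp => //; exact: open_ball_metric.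
move=> om /=; rewrite /act (_ : c w * _ = c y * t); last first.
  by rewrite mulrC divfK ?gt_eqF.
case: (X y0 om _) => //= x /ur; rewrite /g /= HK; exact.
Qed.

Hypothesis cM : connected [set: M].
Hypothesis hsupp : exists y, interior (process_support P (X y)) y.

(* The set of the points where [g] transfers the law contains, around each of its
   points, a translate of a fixed neighborhood in the support: it is open and closed. *)
Lemma transfers_all g ginv a y z :
  continuous g -> continuous ginv -> cancel g ginv -> cancel ginv g -> 0 < a ->
  transfers P X g a y -> transfers P X g a z.
Proof.
move=> cg cgi gK gVK a0 tr.
have [HK HiK cH cHi [c0 cc]] := component_moving.
have [y1 iy1] := hsupp.
pose D := [set w | transfers P X g a w].
have fy w : finv w w = y0 by rewrite -{2}(component_start w) HK.
(* The condition says that [u] is in the support of [X v], moved to the process started from [y1].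
   It holds when [u] and [v] are close, as f_(y1) o f_v^-1 then sends [u] close to [y1]; fixing [v]
   gives that [D] is open, fixing [u] that its complement is. *)
have step v u : process_support P (X y1) (f y1 (finv v u)) -> D v -> D u.
  move=> h Dv; apply: (transfers_support cg cgi gK gVK a0 Dv).
  by rewrite -(HiK v u) -{1}(HK y1 (finv v u)); exact: support_translate.
have oD : open D.
  rewrite openE => v Dv; rewrite /interior.
  have : nbhs v [set u | process_support P (X y1) (f y1 (finv v u))].
    have cv : continuous (f y1 \o finv v).
      by apply: continuous_comp2; exact: continuous_slice.
    by apply: (cv v); rewrite /= fy component_start.
  by apply: filterS => u /step; exact.
have oC : open (~` D).
  rewrite openE => u nDu; rewrite /interior.
  have : nbhs u [set v | process_support P (X y1) (f y1 (finv v u))].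
    have cv : (fun v => f y1 (finv v u)) v @[v --> u] --> f y1 (finv u u).
      apply: (@cvg_comp _ _ _ (fun v => finv v u) (f y1) _ (nbhs (finv u u))).
        apply: (@cvg_comp _ _ _ (fun v => (v, u)) (fun p : M * M => finv p.1 p.2) _
          (nbhs (u, u)) _ _ (cHi (u, u))).
        by apply: cvg_pair => //=; exact: cvg_cst.
      exact: continuous_slice.
    by apply: cv; rewrite /= fy component_start.
  by apply: filterS => v h Dv; apply: nDu; exact: step h Dv.
suff : D = setT by move=> DT; have : D z by rewrite DT.
apply: cM; first by exists y.
  by exists D => //; rewrite setTI.
by exists D; rewrite ?setTI// -(setCK D); exact: open_closedC.
Qed.

End transfer_everywhere.

(** * Calculus of C^k maps *)

Section Ck.
Variable R : realType.
Implicit Types (V W Z : normedModType R).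

Lemma near_eq_differentiable V W (f g : V -> W) x :
  (\forall y \near x, f y = g y) -> differentiable f x -> differentiable g x.
Proof.
move=> fg /[dup] df /diff_locallyP[cd /eqaddoP fo].
have fx : f x = g x by exact: nbhs_singleton fg.
have go : g \o shift x = cst (g x) + 'd f x +o_ (0 : V) id.
  apply/eqaddoP => e e0; have := fo e e0.
  have : \forall h \near (0 : V), f (h + x) = g (h + x).
    by move: fg; rewrite (near_shift 0 x) subr0.
  by apply: filterS2 => h /= fgh; rewrite !fctE /= fgh fx.
by apply/diff_locallyP; rewrite (diff_unique cd go).
Qed.

(** Derivatives at a point are those of the germ in the whole space, so regularity on a set is
    regularity at each of its points. Restriction, gluing and replacement of germs are reduced to
    singletons this way. *)
Lemma Ck_on_pointwise V W k (f : V -> W) (U : set V) :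
  Ck_on k f U <-> forall x, U x -> Ck_on k f [set x].
Proof.
elim: k f => [|k IH] f /=.
  by split => [h x Ux _ ->|h x Ux]; [exact: h|exact: (h x Ux x)].
split=> [[h1 h2] x Ux|h].
  by split => [_ ->|v]; [exact: h1|exact: (IH _).1 (h2 v) x Ux].
split => [x Ux|v]; first by have [h1 _] := h x Ux; exact: h1.
by apply/IH => x Ux; have [_ h2] := h x Ux; exact: h2.
Qed.

Lemma Ck_on_sub V W k (f : V -> W) (U U' : set V) : U' `<=` U ->
  Ck_on k f U -> Ck_on k f U'.
Proof.
move=> sU /Ck_on_pointwise h; apply/Ck_on_pointwise => x /sU; exact: h.
Qed.

Lemma Ck_at_germ V W k (f g : V -> W) x : (\forall y \near x, f y = g y) ->
  Ck_on k f [set x] -> Ck_on k g [set x].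
Proof.
elim: k f g => [|k IH] f g fg /=.
  move=> h _ ->; have hf : f y @[y --> x] --> f x := h x erefl.
  have fx : f x = g x by exact: nbhs_singleton fg.
  have : g y @[y --> x] --> f x by apply: cvg_trans hf; exact: near_eq_cvg.
  by rewrite fx.
move=> [h1 h2]; split => [_ ->|v].
  by apply: near_eq_differentiable fg _; exact: h1.
apply: IH (h2 v).
by have := near_join fg; apply: filterS => y; exact: near_eq_derive.
Qed.

Lemma Ck_on_germ V W k (f g : V -> W) (U : set V) :
  (forall x, U x -> \forall y \near x, f y = g y) ->
  Ck_on k f U -> Ck_on k g U.
Proof.
move=> fg /Ck_on_pointwise h; apply/Ck_on_pointwise => x Ux.
exact: Ck_at_germ (fg x Ux) (h x Ux).
Qed.

Lemma Ck_on_eq V W k (f g : V -> W) (U : set V) : open U ->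
  (forall x, U x -> f x = g x) -> Ck_on k f U -> Ck_on k g U.
Proof.
move=> oU fg; apply: Ck_on_germ => x Ux.
have : nbhs x U by exact: open_nbhs_nbhs.
exact: filterS.
Qed.

Lemma Ck_on_continuous V W k (f : V -> W) (U : set V) : Ck_on k f U ->
  forall x, U x -> {for x, continuous f}.
Proof.
case: k => [//|k [h _]] x Ux; exact: differentiable_continuous (h x Ux).
Qed.

Lemma Ck_onW V W k (f : V -> W) (U : set V) : Ck_on k.+1 f U -> Ck_on k f U.
Proof.
elim: k f => [|k IH] f h; first exact: Ck_on_continuous h.
have [h1 h2] := h; split => // v; exact: IH (h2 v).
Qed.

Lemma Ck_on_cst V W k (a : W) (U : set V) : Ck_on k (cst a) U.
Proof.
elim: k a => [|k IH] a /=; first by move=> x _; exact: cvg_cst.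
split => [x _|v]; first exact: differentiable_cst.
by rewrite (_ : (fun x => _) = cst 0)//; apply/funext => x; rewrite derive_cst.
Qed.

Lemma Ck_on_linear V W k (l : {linear V -> W}) (U : set V) : continuous l ->
  Ck_on k l U.
Proof.
move=> cl; case: k => [|k] /=; first by move=> x _; exact: cl.
split => [x _|v]; first exact: linear_differentiable.
rewrite (_ : (fun x => _) = cst (l v)); first exact: Ck_on_cst.
apply/funext => x; rewrite deriveE; last exact: linear_differentiable.
by rewrite diff_lin.
Qed.

Lemma Ck_on_add V W k (f g : V -> W) (U : set V) : open U ->
  Ck_on k f U -> Ck_on k g U -> Ck_on k (fun x => f x + g x) U.
Proof.
move=> oU; elim: k f g => [|k IH] f g /=.
  by move=> h1 h2 x Ux; apply: cvgD; [exact: h1|exact: h2].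
move=> [f1 f2] [g1 g2]; split => [x Ux|v].
  by apply: differentiableD; [exact: f1|exact: g1].
apply: (Ck_on_eq oU _ (IH _ _ (f2 v) (g2 v))) => x Ux.
by rewrite -deriveD//; apply: diff_derivable; [exact: f1|exact: g1].
Qed.

Lemma Ck_on_sum V W k (I : Type) (s : seq I) (F : I -> V -> W) (U : set V) :
  open U -> (forall i, Ck_on k (F i) U) ->
  Ck_on k (fun x => \sum_(i <- s) F i x) U.
Proof.
move=> oU h; elim: s => [|i s IH].
  by under eq_fun do rewrite big_nil; exact: Ck_on_cst.
by under eq_fun do rewrite big_cons; exact: Ck_on_add.
Qed.

Lemma scale_is_bilinear W :
  bilinear_for (GRing.Scale.Law.clone _ _ *:%R _) (GRing.Scale.Law.clone _ _ *:%R _)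
    (@GRing.scale R W : R^o -> W -> W).
Proof.
split=> [u'|u] a x y /=.
- by rewrite scalerDl scalerA.
- by rewrite scalerDr !scalerA mulrC.
Qed.

Lemma differentiable_scale_pair V W (a : V -> R^o) (g : V -> W) x :
  differentiable a x -> differentiable g x ->
  differentiable (fun y => a y *: g y) x /\
  forall v, 'D_v (fun y => a y *: g y) x = a x *: 'D_v g x + 'D_v a x *: g x.
Proof.
move=> da dg.
pose m := bilinear_isBilinear.Build R R^o W W _ _ _ (scale_is_bilinear W).
pose b : {bilinear R^o -> W -> W} := HB.pack (@GRing.scale R W : R^o -> W -> W) m.
have cb : continuous (fun p : R^o * W => b p.1 p.2) by exact: scale_continuous.
have dp := differentiable_pair da dg.
have db : differentiable (fun p : R^o * W => b p.1 p.2) (a x, g x).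
  exact: differentiable_bilin.
have dc : differentiable (fun y => a y *: g y) x.
  exact: (differentiable_comp dp db).
split => // v; rewrite !deriveE//.
have -> : (fun y => a y *: g y) = (fun p : R^o * W => b p.1 p.2) \o (fun y => (a y, g y)) by [].
by rewrite diff_comp// diff_bilin// diff_pair.
Qed.

Lemma Ck_on_scale V W k (a : V -> R^o) (g : V -> W) (U : set V) : open U ->
  Ck_on k a U -> Ck_on k g U -> Ck_on k (fun x => a x *: g x) U.
Proof.
move=> oU; elim: k a g => [|k IH] a g.
  by move=> h1 h2 x Ux; apply: cvgZ; [exact: h1|exact: h2].
move=> ha hg; have [a1 a2] := ha; have [g1 g2] := hg; split => [x Ux|v].
  by have [] := differentiable_scale_pair (a1 x Ux) (g1 x Ux).
have h : Ck_on k (fun x => a x *: 'D_v g x + 'D_v a x *: g x) U.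
  apply: Ck_on_add => //; first exact: (IH a _ (Ck_onW ha) (g2 v)).
  exact: (IH ('D_v a) _ (a2 v) (Ck_onW hg)).
apply: (Ck_on_eq oU _ h) => x Ux.
by have [_ ->] := differentiable_scale_pair (a1 x Ux) (g1 x Ux).
Qed.

Lemma Ck_on_lin_comp V W Z k (l : {linear W -> Z}) (f : V -> W) (U : set V) :
  open U -> continuous l -> Ck_on k f U -> Ck_on k (l \o f) U.
Proof.
move=> oU cl; elim: k f => [|k IH] f /=.
  by move=> h x Ux; apply: continuous_comp; [exact: h|exact: cl].
move=> [f1 f2]; split => [x Ux|v].
  by apply: differentiable_comp; [exact: f1|exact: linear_differentiable].
apply: (Ck_on_eq oU _ (IH _ (f2 v))) => x Ux.
have dl : differentiable l (f x) by exact: linear_differentiable.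
have df := f1 x Ux.
rewrite /= (deriveE v df) (deriveE v (differentiable_comp df dl)).
by rewrite (diff_comp df dl) /= diff_lin.
Qed.

Lemma Ck_on_pair V W Z k (f : V -> W) (g : V -> Z) (U : set V) : open U ->
  Ck_on k f U -> Ck_on k g U -> Ck_on k (fun x => (f x, g x)) U.
Proof.
move=> oU; elim: k f g => [|k IH] f g /=.
  by move=> h1 h2 x Ux; apply: cvg_pair; [exact: h1|exact: h2].
move=> [f1 f2] [g1 g2]; split => [x Ux|v].
  by apply: differentiable_pair; [exact: f1|exact: g1].
apply: (Ck_on_eq oU _ (IH _ _ (f2 v) (g2 v))) => x Ux.
have df := f1 x Ux; have dg := g1 x Ux.
by rewrite !deriveE//; [rewrite diff_pair|exact: differentiable_pair].
Qed.

(* Finite dimension, in the form used by the chain rule. *)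
Definition fin_coords W : Prop := exists (m : nat) (e : 'I_m -> W)
  (l : 'I_m -> {linear W -> R^o}),
  (forall i, continuous (l i)) /\ forall w, w = \sum_i l i w *: e i.

Lemma fin_coords_real : fin_coords R^o.
Proof.
exists 1%N, (fun _ => 1), (fun _ => idfun); split => [i x|w].
  exact: cvg_id.
by rewrite big_ord_recl big_ord0 addr0 /= [RHS]mulr1.
Qed.

Lemma fin_coords_rV n : fin_coords 'rV[R]_n.
Proof.
have lin (i : 'I_n) : linear (fun v : 'rV[R]_n => v 0 i : R^o).
  by move=> a u v; rewrite !mxE.
pose l i : {linear 'rV[R]_n -> R^o} := HB.pack (fun v : 'rV[R]_n => v 0 i : R^o)
  (GRing.isLinear.Build _ _ _ _ _ (lin i)).
exists n, (fun i => delta_mx 0 i), l; split => [i|w].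
  exact: coord_continuous.
exact: row_sum_delta.
Qed.

Lemma fin_coords_prod W Z : fin_coords W -> fin_coords Z ->
  fin_coords (W * Z)%type.
Proof.
move=> [m [e [l [cl hl]]]] [m' [e' [l' [cl' hl']]]].
pose E (i : 'I_(m + m')) : (W * Z)%type :=
  match fintype.split i with inl j => (e j, 0) | inr j => (0, e' j) end.
pose Lf (i : 'I_(m + m')) : (W * Z)%type -> R^o := fun p =>
    match fintype.split i with inl j => l j p.1 | inr j => l' j p.2 end.
have lin (i : 'I_(m + m')) : linear (Lf i).
  by move=> a u v; rewrite /Lf /=; case: (fintype.split i) => j; rewrite linearP.
pose L i : {linear (W * Z)%type -> R^o} := HB.pack (Lf i)
  (GRing.isLinear.Build _ _ _ _ _ (lin i)).
exists (m + m')%N, E, L; split => [i|[w z]].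
  move=> p; rewrite /L /= /Lf; case: (fintype.split i) => j.
    by apply: continuous_comp; [exact: cvg_fst|exact: cl].
  by apply: continuous_comp; [exact: cvg_snd|exact: cl'].
rewrite big_split_ord /= (eq_bigr (fun i => (l i w *: e i, 0))); last first.
  move=> i _; rewrite /L /E /= /Lf.
  have -> : fintype.split (lshift m' i) = inl i by exact: (unsplitK (inl i)).
  by rewrite /GRing.scale /= /scale_pair/= scaler0.
rewrite [X in _ + X](eq_bigr (fun i => (0, l' i z *: e' i))); last first.
  move=> i _; rewrite /L /E /= /Lf.
  have -> : fintype.split (rshift m i) = inr i by exact: (unsplitK (inr i)).
  by rewrite /GRing.scale /= /scale_pair/= scaler0.
have padd (a b : W) (a' b' : Z) : (a, a') + (b, b') = (a + b, a' + b') by [].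
have h1 : \sum_(i < m) (l i w *: e i, 0 : Z) = (w, 0).
  rewrite {2}(hl w); apply: (big_ind2 (fun (p : W * Z) q => p = (q, 0))) => //.
  by move=> _ q1 _ q2 -> ->; rewrite padd /= addr0.
have h2 : \sum_(i < m') (0 : W, l' i z *: e' i) = (0, z).
  rewrite {2}(hl' z); apply: (big_ind2 (fun (p : W * Z) q => p = (0, q))) => //.
  by move=> _ q1 _ q2 -> ->; rewrite padd /= addr0.
by rewrite h1 h2 padd /= addr0 add0r.
Qed.

(** The chain rule differentiates [g] in the moving direction ['D_v f x], whereas [Ck_on] speaks of
    fixed directions. Coordinates resolve this: the derivative is the sum over [i] of
    [l i ('D_v f x)] times the derivative of [g] along [e i], to which the induction applies. *)
Lemma Ck_on_comp V W Z k (f : V -> W) (g : W -> Z) (U : set V) (O : set W) :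
  fin_coords W -> open U -> open O -> (forall x, U x -> O (f x)) ->
  Ck_on k f U -> Ck_on k g O -> Ck_on k (g \o f) U.
Proof.
move=> [m [e [l [cl hl]]]] oU oO UO; elim: k g => [|k IH] g.
  by move=> h1 h2 x Ux; apply: continuous_comp; [exact: h1|exact/h2/UO].
move=> hf hg; have [f1 f2] := hf; have [g1 g2] := hg; split => [x Ux|v].
  by apply: differentiable_comp; [exact: f1|exact/g1/UO].
have h : Ck_on k (fun x => \sum_i l i ('D_v f x) *: 'D_(e i) g (f x)) U.
  apply: Ck_on_sum => // i; apply: Ck_on_scale => //.
    exact: (Ck_on_lin_comp oU (cl i) (f2 v)).
  by apply: (IH (fun w => 'D_(e i) g w)); [exact: Ck_onW|exact: g2].
apply: (Ck_on_eq oU _ h) => x Ux.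
have df := f1 x Ux; have dg := g1 _ (UO x Ux).
rewrite [RHS]deriveE; last exact: differentiable_comp.
rewrite diff_comp//= -(deriveE v df) [in RHS](hl ('D_v f x)) linear_sum.
by apply: eq_bigr => i _; rewrite (deriveE _ dg) linearZ.
Qed.

End Ck.

(** * C^k maps between manifolds *)

Section Ck_maps.
Variable R : realType.

Lemma open_chart_preimage (M : topologicalType) (V : normedModType R)
    (a : chart M V) (O : set M) : is_chart a -> open O ->
  open [set v | chart_cod a v /\ O (chart_inv a v)].
Proof.
move=> [[_ oc] _ _ _ [_ ci]] oO; rewrite openE => v [cv Ov]; rewrite /interior.
apply: filterI; first by apply: open_nbhs_nbhs.
by apply: (ci v cv); apply: open_nbhs_nbhs.
Qed.

(* [Ck_map] localised on the set [U], which is meant to be open. *)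
Definition Ck_map_on (M N : topologicalType) (V W : normedModType R) (k : nat)
    (A : set (chart M V)) (B : set (chart N W)) (f : M -> N) (U : set M) : Prop :=
  (forall x, U x -> {for x, continuous f}) /\
  forall a b, A a -> B b -> Ck_on k (chart_map b \o f \o chart_inv a)
    [set v | chart_cod a v /\ (U `&` f @^-1` chart_dom b) (chart_inv a v)].

Lemma Ck_map_onT (M N : topologicalType) (V W : normedModType R) (k : nat)
    (A : set (chart M V)) (B : set (chart N W)) (f : M -> N) :
  Ck_map_on k A B f setT <-> Ck_map k A B f.
Proof.
split => -[cf h]; split.
- by move=> x; exact: cf.
- by move=> a b Aa Bb; have := h a b Aa Bb; rewrite setTI.
- by move=> x _; exact: cf.
- by move=> a b Aa Bb; rewrite setTI; exact: h.
Qed.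

Definition is_atlas (M : topologicalType) (V : normedModType R)
    (A : set (chart M V)) : Prop :=
  (forall a, A a -> is_chart a) /\ (forall x, exists2 a, A a & chart_dom a x).

Lemma Ck_atlas_is (M : topologicalType) (V : normedModType R) k
    (A : set (chart M V)) : Ck_atlas k A -> is_atlas A.
Proof. by case. Qed.

Section two.
Variables (M N : topologicalType) (V W : normedModType R) (k : nat).
Variables (A : set (chart M V)) (B : set (chart N W)).
Hypotheses (hA : is_atlas A) (hB : is_atlas B).

(** Meant for maps given by a formula that changes from place to place, such as an iterate whose
    number of factors depends on the point. *)
Lemma Ck_map_on_nbhs (f : M -> N) (U : set M) :
  (forall x, U x -> exists g U', [/\ open U', U' x, Ck_map_on k A B g U' &
     forall y, U' y -> f y = g y]) -> Ck_map_on k A B f U.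
Proof.
move=> h; split => [x /h[g [U' [oU' U'x [cg _] fg]]]|a b Aa Bb].
  have gf : \forall y \near x, g y = f y.
    by apply: filterS (open_nbhs_nbhs (conj oU' U'x)) => y /fg.
  have : f y @[y --> x] --> g x.
    by apply: cvg_trans (cg x U'x); exact: near_eq_cvg.
  by rewrite -fg.
apply/Ck_on_pointwise => v [cv [Uv bv]].
have [g [U' [oU' U'x [_ hg] fg]]] := h _ Uv.
have [isA _] := hA.
apply: (@Ck_at_germ _ _ _ k (chart_map b \o g \o chart_inv a)).
  have := open_nbhs_nbhs (conj (open_chart_preimage (isA a Aa) oU') (conj cv U'x)).
  by apply: filterS => w [_ /fg] /= ->.
by apply: Ck_on_sub (hg a b Aa Bb) => _ ->; split => //; split => //=; rewrite -fg.
Qed.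

Lemma Ck_map_on_sub (f : M -> N) (U U' : set M) : U' `<=` U ->
  Ck_map_on k A B f U -> Ck_map_on k A B f U'.
Proof.
move=> sU [h1 h2]; split => [x /sU|a b Aa Bb]; first exact: h1.
by apply: Ck_on_sub (h2 a b Aa Bb) => v [? [/sU ? ?]].
Qed.

Lemma Ck_map_on_continuous (f : M -> N) : Ck_map_on k A B f setT -> continuous f.
Proof. by move=> [h _] x; exact: h. Qed.

Lemma Ck_map_on_cst (y : N) (U : set M) : Ck_map_on k A B (fun _ => y) U.
Proof.
split => [x _|a b _ _]; first exact: cvg_cst.
exact: Ck_on_cst.
Qed.

End two.

Lemma Ck_map_on_id (M : topologicalType) (V : normedModType R) (k : nat)
   (A : set (chart M V)) (U : set M) : Ck_atlas k A -> Ck_map_on k A A id U.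
Proof.
move=> [isA _ h]; split => [x _|a b Aa Ab]; first exact: cvg_id.
by apply: Ck_on_sub (h a b Aa Ab) => v [? [_ ?]].
Qed.

Lemma open_preimage_on (M N : topologicalType) (f : M -> N) (U : set M)
    (O : set N) : open U -> open O -> (forall x, U x -> {for x, continuous f}) ->
  open (U `&` f @^-1` O).
Proof.
move=> oU oO cf; rewrite openE => x [Ux Ox]; rewrite /interior.
apply: filterI; first exact: open_nbhs_nbhs.
by apply: (cf x Ux); exact: open_nbhs_nbhs.
Qed.

Section three.
Variables (M N Q : topologicalType) (V W Z : normedModType R) (k : nat).
Variables (A : set (chart M V)) (B : set (chart N W)) (C : set (chart Q Z)).
Hypotheses (hA : is_atlas A) (hB : is_atlas B) (hC : is_atlas C).

(** No chart of [N] need contain the image of [U]. At each point a chart [b] around the image is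
    inserted, and [U1] is the open set where the factorisation through [b] is valid. *)
Lemma Ck_map_on_comp (f : M -> N) (g : N -> Q) (U : set M) (U' : set N) :
  fin_coords W -> open U -> open U' -> (forall x, U x -> U' (f x)) ->
  Ck_map_on k A B f U -> Ck_map_on k B C g U' -> Ck_map_on k A C (g \o f) U.
Proof.
move=> fW oU oU' UU' [cf hf] [cg hg]; split => [x Ux|a c Aa Cc].
  by apply: continuous_comp; [exact: cf|exact/cg/UU'].
apply/Ck_on_pointwise => v [cv [Uv dv]].
have [isA _] := hA; have [isB covB] := hB; have [isC _] := hC.
have [b Bb bv] := covB (f (chart_inv a v)).
have [[ob obc] bm bi [bK bVK] [bmc bic]] := isB b Bb.
have [[oc _] _ _ _ _] := isC c Cc.
have oUc : open (U' `&` g @^-1` chart_dom c) by exact: open_preimage_on.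
pose U1 := U `&` f @^-1` (chart_dom b `&` (U' `&` g @^-1` chart_dom c)).
have oU1 : open U1 by apply: open_preimage_on => //; exact: openI.
have h : Ck_on k ((chart_map c \o g \o chart_inv b) \o (chart_map b \o f \o chart_inv a))
   [set v | chart_cod a v /\ U1 (chart_inv a v)].
  apply: (@Ck_on_comp _ _ _ _ _ _ _ _ [set w | chart_cod b w /\
      (U' `&` g @^-1` chart_dom c) (chart_inv b w)] fW).
  - exact: open_chart_preimage (isA a Aa) oU1.
  - exact: open_chart_preimage (isB b Bb) oUc.
  - move=> w [cw [Uw [bw [U'w dw]]]]; split; first exact: bm.
    by rewrite /= bK.
  - by apply: Ck_on_sub (hf a b Aa Bb) => w [? [? [? _]]]; split.
  - exact: (hg b c Bb Cc).
have : Ck_on k (chart_map c \o (g \o f) \o chart_inv a)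
    [set v | chart_cod a v /\ U1 (chart_inv a v)].
  apply: (Ck_on_eq (open_chart_preimage (isA a Aa) oU1) _ h).
  by move=> w [cw [Uw [bw _]]] /=; rewrite bK.
by apply: Ck_on_sub => _ ->; split => //; split => //; split => //; split => //; exact: UU'.
Qed.

Lemma Ck_map_on_pair (f : M -> N) (g : M -> Q) (U : set M) : open U ->
  Ck_map_on k A B f U -> Ck_map_on k A C g U ->
  Ck_map_on k A (prod_atlas B C) (fun x => (f x, g x)) U.
Proof.
move=> oU [cf hf] [cg hg]; split => [x Ux|a bc Aa].
  by apply: cvg_pair; [exact: cf|exact: cg].
have [isA _] := hA; have [isB covB] := hB; have [isC _] := hC.
move=> [b Bb [c Cc <-]] /=.
have [[ob _] _ _ _ _] := isB b Bb.
have [[oc _] _ _ _ _] := isC c Cc.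
pose U1 := (U `&` f @^-1` chart_dom b) `&` (U `&` g @^-1` chart_dom c).
have oU1 : open U1 by apply: openI; exact: open_preimage_on.
have : Ck_on k (fun v => ((chart_map b \o f \o chart_inv a) v,
     (chart_map c \o g \o chart_inv a) v)) [set v | chart_cod a v /\ U1 (chart_inv a v)].
  apply: Ck_on_pair; first exact: open_chart_preimage (isA a Aa) oU1.
    by apply: Ck_on_sub (hf a b Aa Bb) => w [? [? ?]]; split.
  by apply: Ck_on_sub (hg a c Aa Cc) => w [? [? ?]]; split.
by apply: Ck_on_sub => v [? [? [? ?]]]; split.
Qed.

End three.

Section product.
Variables (M N : topologicalType) (V W : normedModType R) (k : nat).
Variables (A : set (chart M V)) (B : set (chart N W)).
Hypotheses (hA : Ck_atlas k A) (hB : Ck_atlas k B).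

Lemma is_atlas_prod : is_atlas (prod_atlas A B).
Proof.
have [isA covA _] := hA; have [isB covB _] := hB; split; last first.
  move=> [x y]; have [a Aa ax] := covA x; have [b Bb bx] := covB y.
  exists (Chart (chart_dom a `*` chart_dom b) (chart_cod a `*` chart_cod b)
         (fun p => (chart_map a p.1, chart_map b p.2))
         (fun q => (chart_inv a q.1, chart_inv b q.2))) => //.
  by exists a => //; exists b.
move=> _ [a Aa [b Bb <-]].
have [[oa oac] am ai [aK aVK] [amc aic]] := isA a Aa.
have [[ob obc] bm bi [bK bVK] [bmc bic]] := isB b Bb.
split => /=.
- split.
    rewrite openE => -[x y] [/= ax byy]; exists (chart_dom a, chart_dom b) => //.
    by split; exact: open_nbhs_nbhs.
  rewrite openE => -[x y] [/= ax byy]; exists (chart_cod a, chart_cod b) => //.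
  by split; exact: open_nbhs_nbhs.
- by move=> p [? ?]; split; [exact: am|exact: bm].
- by move=> p [? ?]; split; [exact: ai|exact: bi].
- split=> [[x y] [/= ax byy]|[x y] [/= ax byy]]; first by rewrite aK// bK.
  by rewrite aVK// bVK.
- split=> [[x y] [/= ax byy]|[x y] [/= ax byy]].
    apply: cvg_pair => /=.
      exact: (@cvg_comp _ _ _ fst (chart_map a) _ (nbhs x) _ cvg_fst (amc x ax)).
    exact: (@cvg_comp _ _ _ snd (chart_map b) _ (nbhs y) _ cvg_snd (bmc y byy)).
  apply: cvg_pair => /=.
    exact: (@cvg_comp _ _ _ fst (chart_inv a) _ (nbhs x) _ cvg_fst (aic x ax)).
  exact: (@cvg_comp _ _ _ snd (chart_inv b) _ (nbhs y) _ cvg_snd (bic y byy)).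
Qed.

Lemma fst_lin_continuous : continuous (fst : V * W -> V).
Proof. by move=> x; exact: cvg_fst. Qed.

Lemma snd_lin_continuous : continuous (snd : V * W -> W).
Proof. by move=> x; exact: cvg_snd. Qed.

Lemma Ck_map_on_fst (U : set (M * N)) : fin_coords V ->
  Ck_map_on k (prod_atlas A B) A fst U.
Proof.
move=> fV; have [isA covA compA] := hA; have [isB _ _] := hB.
split=> [x _|_ a' [a Aa [b Bb <-]] Aa']; first exact: cvg_fst.
have [[oa' _] _ _ _ _] := isA a' Aa'.
have [[_ obc] _ _ _ _] := isB b Bb.
have oS := open_chart_preimage (isA a Aa) oa'.
pose S := [set p : V * W | chart_cod a p.1 /\ chart_dom a' (chart_inv a p.1)].
have oSS : open S.
  rewrite (_ : S = fst @^-1` [set v | chart_cod a v /\ chart_dom a' (chart_inv a v)])//.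
  by apply: open_comp => // x _; exact: cvg_fst.
have : Ck_on k ((chart_map a' \o chart_inv a) \o (fst : V * W -> V)) S.
  apply: (Ck_on_comp fV oSS oS _ _ (compA a a' Aa Aa')) => //.
  have lin : linear (fst : V * W -> V) by [].
  pose l : {linear (V * W)%type -> V} := HB.pack (fst : V * W -> V)
    (GRing.isLinear.Build _ _ _ _ _ lin).
  exact: (@Ck_on_linear _ _ _ k l S fst_lin_continuous).
by apply: Ck_on_sub => -[v w] [/= [? ?] [_ ?]].
Qed.

Lemma Ck_map_on_snd (U : set (M * N)) : fin_coords W ->
  Ck_map_on k (prod_atlas A B) B snd U.
Proof.
move=> fW; have [isA _ _] := hA; have [isB covB compB] := hB.
split=> [x _|_ b' [a Aa [b Bb <-]] Bb']; first exact: cvg_snd.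
have [[ob' _] _ _ _ _] := isB b' Bb'.
have oS := open_chart_preimage (isB b Bb) ob'.
pose S := [set p : V * W | chart_cod b p.2 /\ chart_dom b' (chart_inv b p.2)].
have oSS : open S.
  rewrite (_ : S = snd @^-1` [set v | chart_cod b v /\ chart_dom b' (chart_inv b v)])//.
  by apply: open_comp => // x _; exact: cvg_snd.
have : Ck_on k ((chart_map b' \o chart_inv b) \o (snd : V * W -> W)) S.
  apply: (Ck_on_comp fW oSS oS _ _ (compB b b' Bb Bb')) => //.
  have lin : linear (snd : V * W -> W) by [].
  pose l : {linear (V * W)%type -> W} := HB.pack (snd : V * W -> W)
    (GRing.isLinear.Build _ _ _ _ _ lin).
  exact: (@Ck_on_linear _ _ _ k l S snd_lin_continuous).
by apply: Ck_on_sub => -[v w] [/= [? ?] [_ ?]].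
Qed.

End product.

Lemma is_chart_id (V : normedModType R) : is_chart (Chart setT setT (@id V) id).
Proof.
split => //=; first by split; exact: openT.
by split => v _; exact: cvg_id.
Qed.

Lemma Ck_atlas_id (V : normedModType R) k : Ck_atlas k (@id_atlas R V).
Proof.
split; first by move=> _ ->; exact: is_chart_id.
  by move=> x; exists (Chart setT setT id id).
move=> _ _ -> -> /=.
exact: (@Ck_on_linear _ _ _ k (idfun : {linear V -> V}) _ (fun x => @cvg_id _ (nbhs x))).
Qed.

Lemma Ck_map_on_idP (V W : normedModType R) k (f : V -> W) (U : set V) :
  Ck_map_on k (@id_atlas R V) (@id_atlas R W) f U <-> Ck_on k f U.
Proof.
split=> [[cf h]|h].
  have := h _ _ erefl erefl; apply: Ck_on_sub => v Uv; split => //; split => //.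
split => [x Ux|_ _ -> ->]; first exact: Ck_on_continuous h _ Ux.
by apply: Ck_on_sub h => v [_ []].
Qed.

Lemma Ck_map_on_chart_inv (M : topologicalType) (V : normedModType R) k
    (A : set (chart M V)) (a : chart M V) : Ck_atlas k A -> A a ->
  Ck_map_on k (@id_atlas R V) A (chart_inv a) (chart_cod a).
Proof.
move=> [isA _ h] Aa; have [_ _ _ _ [_ ci]] := isA a Aa.
split => [x ax|_ b -> Ab]; first exact: ci.
by apply: Ck_on_sub (h a b Aa Ab) => v [_ [? ?]].
Qed.

Lemma Ck_on_chart_inv (M : topologicalType) (V W : normedModType R) k
    (A : set (chart M V)) (a : chart M V) (f : M -> W) (U : set M) : A a ->
  Ck_map_on k A (@id_atlas R W) f U ->
  Ck_on k (f \o chart_inv a) [set v | chart_cod a v /\ U (chart_inv a v)].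
Proof.
move=> Aa [_ h]; have := h a _ Aa erefl.
by apply: Ck_on_sub => v [? ?]; split => //; split.
Qed.

End Ck_maps.

(** * Regularity of real functions and local inverses *)

Section Ck_real.
Variable R : realType.
Implicit Types (V : normedModType R).

Lemma Ck_on_inv V k (f : V -> R^o) (U : set V) : open U ->
  (forall x, U x -> f x != 0) -> Ck_on k f U ->
  Ck_on k (fun x => (f x)^-1 : R^o) U.
Proof.
move=> oU f0; elim: k => [|k IH] hf.
  by move=> x Ux; apply: cvgV; [exact: f0|exact: hf].
have [f1 f2] := hf; split => [x Ux|v]; first by apply: differentiableV; [exact: f1|exact: f0].
have hi := IH (Ck_onW hf).
have h : Ck_on k (fun x => (-1 : R^o) *: ((f x)^-1 *: ((f x)^-1 *: 'D_v f x)) : R^o) U.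
  apply: Ck_on_scale => //; first exact: Ck_on_cst.
  by apply: Ck_on_scale => //; apply: Ck_on_scale => //; exact: f2.
apply: (Ck_on_eq oU _ h) => x Ux.
rewrite deriveV; [|exact: f0|exact: diff_derivable (f1 x Ux)].
by rewrite /GRing.scale /= -exprVn; ring.
Qed.

Lemma Ck_on_real (k : nat) (f df : R^o -> R^o) (U : set R^o) : open U ->
  (forall x, U x -> is_derive (x : R^o) (1 : R^o) f (df x)) ->
  Ck_on k df U -> Ck_on k.+1 f U.
Proof.
move=> oU hf hdf.
have d1 x : U x -> differentiable f x.
  by move=> Ux; apply/derivable1_diffP; have [] := hf x Ux.
split => // v.
have h : Ck_on k (fun x => (v : R^o) *: df x : R^o) U.
  by apply: Ck_on_scale => //; exact: Ck_on_cst.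
apply: (Ck_on_eq oU _ h) => x Ux.
rewrite deriveE; last exact: d1.
have -> : v = v *: (1 : R^o) by rewrite /GRing.scale /= mulr1.
rewrite linearZ -deriveE; last exact: d1.
by have [_ ->] := hf x Ux; rewrite /GRing.scale /= mulr1.
Qed.

Lemma Ck_on_ln k : Ck_on k (@ln R : R^o -> R^o) [set x : R^o | 0 < x].
Proof.
case: k => [x /= x0|k]; first exact: continuous_ln.
apply: (@Ck_on_real k _ (fun x => x^-1)).
- exact: open_gt.
- apply: (@Ck_on_inv _ k (fun x : R^o => x)); first exact: open_gt.
    by move=> x /= /gt_eqF ->.
  have := @Ck_map_on_id R R^o R^o k _ [set x : R^o | 0 < x] (Ck_atlas_id R^o k).
  by move/Ck_map_on_idP.
Qed.

(** The inverse function theorem on the line. The derivative does not vanish near 0, so the mean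
    value theorem gives injectivity there, and the local inverse has derivative [(db (g u))^-1]. *)
Lemma Ck_inverse (k : nat) (b : R^o -> R^o) (e : R) : 0 < e ->
  Ck_on k.+1 b (ball (0 : R^o) e) -> 'D_1 b 0 != 0 ->
  exists (g : R -> R) (r : R), [/\ 0 < r, g (b 0) = 0,
    (forall u, ball (b 0) r u -> ball (0 : R) e (g u) /\ b (g u) = u) &
    Ck_on k.+1 (g : R^o -> R^o) (ball (b 0 : R^o) r)].
Proof.
move=> e0 hb nz; have [b1 b2] := hb.
have cb := Ck_on_continuous hb.
pose db := (fun x : R^o => 'D_1 b x).
have cdb : {for (0 : R^o), continuous db}.
  by apply: (Ck_on_continuous (b2 1)); exact: ballxx.
have /nbhs_ballP[n1 /= n10 hn1] : nbhs (0 : R^o) [set x : R^o | db x != 0].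
  apply: (cdb [set y : R^o | y != 0]).
  by apply: open_nbhs_nbhs; split => //; exact: open_neq.

pose n := Num.min n1 e.
have n0 : 0 < n by rewrite lt_min n10 e0.
have nn1 x : ball (0 : R^o) n x -> db x != 0.
  by move=> h; apply: hn1; apply: le_ball h; rewrite ge_min lexx.
have ne x : ball (0 : R^o) n x -> ball (0 : R^o) e x.
  by apply: le_ball; rewrite ge_min lexx orbT.
have der x : ball (0 : R^o) n x -> is_derive x 1 b (db x).
  by move=> /ne xe; apply: DeriveDef => //; apply: diff_derivable; exact: b1.
have inj s t : ball (0 : R^o) n s -> ball (0 : R^o) n t -> s < t -> b s <> b t.
  move=> sn tn st bst.
  have inb x : s <= x <= t -> ball (0 : R^o) n x.
    move: sn tn; rewrite -!ball_normE /= !sub0r !normrN !ltr_norml.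
    by move=> /andP[? ?] /andP[? ?] /andP[? ?]; apply/andP; split; lra.
  have h1 x : x \in `]s, t[ -> is_derive (x : R) (1 : R) b (db x).
    move=> xst.
    by apply: der; apply: inb; move: xst; rewrite in_itv /= => /andP[/ltW -> /ltW ->].
  have h2 : {within `[s, t], continuous b}.
    apply: continuous_in_subspaceT => x /set_mem /= xst.
    by apply: cb; apply: ne; apply: inb; move: xst; rewrite in_itv.
  have [x] := MVT_segment (ltW st) h1 h2.
  rewrite in_itv /= => /inb /nn1; rewrite bst subrr => h /esym/eqP.
  by rewrite mulf_eq0 (negbTE h) /= subr_eq0 gt_eqF.
pose g u := xget 0 [set s : R | ball (0 : R^o) n s /\ b s = u].
have gb s : ball (0 : R^o) n s -> g (b s) = s.
  move=> sn; rewrite /g; case: xgetP => [t _ [tn bts]|/(_ s)]; last by case.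
  have [//|] := eqVneq t s; rewrite neq_lt => /orP[] h.
    by case: (inj t s tn sn h).
  by case: (inj s t sn tn h).
have near_b (P : R -> Prop) s : (forall x, ball (0 : R^o) n x -> P x) ->
    ball (0 : R^o) n s -> \forall x \near s, P x.
  move=> h sn; have : nbhs s (ball (0 : R^o) n).
    by apply: open_nbhs_nbhs; split => //; exact: ball_open.
  exact: filterS.
have bK s : ball (0 : R^o) n s -> {near s, cancel b g}.
  by move=> sn; apply: near_b sn => x; exact: gb.
have bC s : ball (0 : R^o) n s -> \near s, continuous_at s b.
  by move=> sn; apply: near_b sn => x /ne; exact: cb.
have b00 : ball (0 : R^o) n 0 by exact: ballxx.
have [gC gK] := near_can_continuousAcan_sym (bK _ b00) (bC _ b00).
have g0 : g (b 0) = 0 by exact: gb.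
have gn : \forall u \near b 0, ball (0 : R^o) n (g u).
  have cg : g u @[u --> b 0] --> g (b 0) := nbhs_singleton gC.
  by apply: cg; rewrite g0; apply: nbhsx_ballx.
have /nbhs_ballP[r /= r0 hr] : nbhs (b 0 : R^o)
    [set u : R^o | [/\ continuous_at u g, b (g u) = u & ball (0 : R^o) n (g u)]].
  by apply: filterS3 gC gK gn => u ? ? ?; split.
have gder u : ball (b 0 : R^o) r u -> is_derive (u : R^o) 1 g (db (g u))^-1.
  move=> /hr[_ bgu gun].
  have := is_derive_inverse (bK _ gun) (bC _ gun) (der _ gun) (nn1 _ gun).
  by rewrite bgu.
exists g, r; split => //.
  by move=> u /hr[_ ? h]; split => //; exact: ne h.
have oball : open (ball (b 0 : R^o) r) by exact: ball_open.
(* Bootstrapping: once [g] has class [j], so has its derivative, the inverse of [db \o g], and [g]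
   has class [j.+1]. *)
suff: forall j, (j <= k.+1)%N -> Ck_on j (g : R^o -> R^o) (ball (b 0 : R^o) r).
  by move=> h; exact: (h k.+1 (leqnn _)).
elim => [_ u /hr[]//|j IH jk].
apply: (Ck_on_real oball gder).
apply: Ck_on_inv => //; first by move=> u /hr[_ _ /nn1].
apply: (@Ck_on_comp _ _ _ _ j g db _ (ball (0 : R^o) e)) => //.
- exact: fin_coords_real.
- exact: ball_open.
- by move=> u /hr[_ _ /ne].
- by apply: IH; exact: ltnW.
have := b2 1; rewrite -/db; move: jk; rewrite ltnS => jk.
(* The class of [db] is lowered from [k] to [j] one unit at a time. *)
elim: (k - j)%N {-2}k (erefl (k - j)%N) jk => [|m IHm] k' hk' jk'.
  by have -> : j = k' by apply/eqP; rewrite eqn_leq jk' -subn_eq0 hk' eqxx.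
case: k' hk' jk' => [//|k'] hk' jk' /Ck_onW; apply: IHm; lia.
Qed.

End Ck_real.

(** * Similarities and symmetries *)

Section sim.
Variables (R : realType) (M : metricType R).
Local Notation E := (cemetery_ext M).
Context (d : measure_display) (T : measurableType d) (P : probability T R).
Variable X : M -> T -> R -> E.

(** The transfer of the law is required at every starting point, which makes these maps stable under
    composition and inversion, with multiplicative ratios [a]. Those of ratio 1 fixing the reference
    point are symmetries. *)
Definition sim (g ginv : M -> M) (a : R) : Prop :=
  [/\ continuous g /\ continuous ginv, cancel g ginv, cancel ginv g, 0 < a &
      forall y, transfers P X g a y].

Lemma act_id (w : R -> E) : act id 1 w = w.
Proof. by apply/funext => t; rewrite /act mul1r; case: (w t). Qed.

Lemma sim_comp g gi a h hi b : sim g gi a -> sim h hi b ->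
  sim (g \o h) (hi \o gi) (b * a).
Proof.
move=> [[cg cgi] gK gVK a0 tg] [[ch chi] hK hVK b0 th]; split.
- by split; exact: continuous_comp2.
- exact: can_comp.
- exact: can_comp.
- exact: mulr_gt0.
move=> y; apply: eq_law_trans (tg (h y)) _.
rewrite (_ : (fun om => act (g \o h) _ _) = (fun om => act g a (act h b (X y om)))).
  exact: (eq_law_act cg a0 (th y)).
by apply/funext => om; rewrite act_comp.
Qed.

Lemma sim_inv g gi a : sim g gi a -> sim gi g a^-1.
Proof.
move=> [[cg cgi] gK gVK a0 tg]; split => //; first by rewrite invr_gt0.
move=> y; have ai0 : 0 < a^-1 by rewrite invr_gt0.
have := eq_law_act cgi ai0 (tg (gi y)); rewrite gVK => h.
apply: eq_law_sym; apply: eq_law_trans h _.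
rewrite (_ : (fun om => _) = X (gi y)) => [C//|].
apply/funext => om; rewrite act_comp divff ?gt_eqF//.
rewrite (_ : gi \o g = id) ?act_id//.
by apply/funext => x /=; rewrite gK.
Qed.

Lemma sim_id : sim id id 1.
Proof.
split => //; first by split => x; exact: cvg_id.
by move=> y C _; congr (P _); apply/seteqP; split => om /=; rewrite act_id.
Qed.

Lemma sim_iter g gi a m : sim g gi a -> sim (iter m g) (iter m gi) (a ^+ m).
Proof.
move=> sg; elim: m => [|m IH]; first exact: sim_id.
rewrite exprSr (_ : iter m.+1 g = iter m g \o g); last first.
  by apply/funext => x /=; rewrite -iterS iterSr.
rewrite mulrC; exact: sim_comp.
Qed.

Lemma sim_symmetry y0 g gi : sim g gi 1 -> g y0 = y0 -> symmetries P (X y0) g.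
Proof.
move=> [[cg cgi] gK gVK _ tg] gy; split; first by split => //; exists gi.
have := tg y0; rewrite /transfers gy.
rewrite (_ : (fun om => act g 1 _) = (fun om t => omap g (X y0 om t)))//.
by apply/funext => om; apply/funext => t; rewrite /act mul1r.
Qed.

(** Joint continuity gives continuity into the topology of uniform convergence on compact sets; the
    family is then locally constant by discreteness, and constant by connectedness of the
    parameters. *)
Lemma discrete_family (H : set (M -> M)) (S : topologicalType) (G : S -> M -> M) :
  discrete_homs H -> connected [set: S] ->
  continuous (fun p : S * M => G p.1 p.2) -> (forall s, H (G s)) ->
  forall s s', G s = G s'.
Proof.
move=> dH cS cG HG s s'.
have near_eq t : \forall t' \near t, G t' = G t.
  have cvgG : (G t' : {family compact, M -> M}) @[t' --> t] -->
      (G t : {family compact, M -> M}).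
    apply/fam_cvgP => K /compact_near_coveringP cK W.
    move=> /uniform_nbhs[Q [eQ QW]].
    (* Near a fixed [x], both values are compared with [G t x] through half of the entourage [Q];
       compactness of [K] makes the neighborhood of [t] uniform. *)
    have : \forall t' \near t, forall x, K x -> Q (G t x, G t' x).
      apply: (cK S (nbhs t) (fun t' x => Q (G t x, G t' x))) => x Kx.
      have eQ2 := entourage_split_ent eQ.
      have c1 : nbhs (t, x) [set p : S * M | split_ent Q (G t x, G p.1 p.2)].
        apply: (cG (t, x) [set z | split_ent Q (G t x, z)]).
        rewrite /= -nbhs_entourageE; exists (split_ent Q) => //.
        by move=> z /= /xsectionP.
      have c2 : nbhs x [set x' | split_ent Q (G t x', G t x)].
        have cGt : {for x, continuous (G t)}.
          apply: (@cvg_comp _ _ _ (fun x => (t, x)) (fun p => G p.1 p.2) _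
            (nbhs (t, x)) _ _ (cG (t, x))).
          by apply: cvg_pair => //=; exact: cvg_cst.
        apply: (cGt [set z | split_ent Q (z, G t x)]).
        rewrite /= -nbhs_entourageE.
        exists ((split_ent Q)^-1)%relation; first exact: entourage_inv.
        by move=> z /= /xsectionP.
      case: c1 => -[U V] /= [Ut Vx] UV.
      exists (V `&` [set x' | split_ent Q (G t x', G t x)], U).
        by split => //; exact: filterI.
      move=> [x' t'] [/= [Vx' Qx'] Ut'].
      apply: (subset_split_ent eQ); exists (G t x) => //.
      exact: (UV (t', x')).
    by apply: filterS => t' h; apply: QW.
  have h : nbhs t [set t' | H (G t') -> G t' = G t] := cvgG _ (dH (G t) (HG t)).
  by apply: filterS h => t'; apply; exact: HG.
pose D := [set t | G t = G s].
suff : D = setT by move=> DT; have : D s' by rewrite DT.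
apply: cS; first by exists s.
  exists D; rewrite ?setTI// openE => t Dt; rewrite /interior.
  by have := near_eq t; apply: filterS => t' /=; rewrite /D /= => ->.
exists D; rewrite ?setTI// -(setCK D); apply: open_closedC.
rewrite openE => t Dt; rewrite /interior.
by have := near_eq t; apply: filterS => t' /= h; rewrite /D /= h.
Qed.

End sim.

(** * A nonconstant function on a connected manifold has a nonzero derivative *)

Section derivative_nonzero.
Variables (R : realType) (M : metricType R) (n k : nat).
Variable A : set (chart M 'rV[R]_n).
Hypothesis hA : Ck_atlas k.+1 A.
Hypothesis cM : connected [set: M].

Lemma zero_derivative_ball (V : normedModType R) (f : V -> R^o) (v : V) (e : R) :
  (forall x, ball v e x -> differentiable f x /\ forall u, 'D_u f x = 0) ->
  forall x, ball v e x -> f x = f v.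
Proof.
move=> h x vx.
pose l (t : R^o) := v + t *: (x - v).
have lball (t : R^o) : 0 <= t <= 1 -> ball v e (l t).
  move=> /andP[t0 t1]; rewrite -ball_normE /= /l opprD addrA subrr sub0r normrN.
  rewrite normrZ ger0_norm//; move: vx; rewrite -ball_normE /= distrC => vx.
  by apply: le_lt_trans vx; rewrite ler_piMl.
have dl t : differentiable l t.
  apply: differentiableD; first exact: differentiable_cst.
  apply: differentiableZl.
  by have [] := @is_diff_id R R^o t.
have dfl (t : R^o) : 0 <= t <= 1 -> differentiable (f \o l) t.
  by move=> /lball /h[dfx _]; exact: differentiable_comp.
have der (t : R^o) : 0 <= t <= 1 -> is_derive (t : R) (1 : R) (f \o l) 0.
  move=> t01; have [dfx D0] := h _ (lball t t01).
  apply: DeriveDef; first exact: diff_derivable (dfl t t01).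
  by rewrite deriveE; [rewrite diff_comp//= -(deriveE _ dfx) D0|exact: dfl].
have der' (t : R) : t \in `](0 : R), 1[ -> is_derive (t : R) (1 : R) (f \o l : R -> R) 0.
  by rewrite in_itv /= => /andP[/ltW t0 /ltW t1]; apply: der; rewrite t0.
have cfl : {within `[(0 : R), 1], continuous (f \o l : R -> R)}.
  apply: continuous_in_subspaceT => t /set_mem /=; rewrite in_itv /= => t01.
  exact: (differentiable_continuous (dfl t t01)).
have [c _] := MVT_segment (df := fun=> 0) ler01 der' cfl.
rewrite mul0r /l /= scale1r scale0r addr0 [v + _]addrC subrK => /eqP.
by rewrite subr_eq0 => /eqP.
Qed.

(** Otherwise [al] is constant along segments in every chart, hence locally constant, hence constant
    by connectedness. *)
Lemma nonconstant_derivative (al : M -> R) y y' :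
  Ck_map_on k.+1 A (@id_atlas R R^o) al setT -> al y <> al y' ->
  exists a v e, [/\ A a, chart_cod a v & 'D_e (al \o chart_inv a : _ -> R^o) v != 0].
Proof.
move=> cal neq; apply: contrapT => hno.
have [isA covA _] := hA.
have loc x : \forall z \near x, al z = al x.
  have [a Aa ax] := covA x.
  have [[oa oc] am ai [aK aVK] [amc aic]] := isA a Aa.
  have hC : Ck_on k.+1 (al \o chart_inv a : _ -> R^o) (chart_cod a).
    by apply: Ck_on_sub (Ck_on_chart_inv Aa cal) => v.
  have [dC _] := hC.
  have := open_nbhs_nbhs (conj oc (am x ax)).
  move=> /nbhs_ballP[e /= e0 he].
  have z0 : forall v, ball (chart_map a x) e v ->
      (al \o chart_inv a) v = (al \o chart_inv a) (chart_map a x).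
    apply: zero_derivative_ball => v /he cv; split; first exact: dC.
    move=> u; apply/eqP; apply: contrapT => /negP nz; apply: hno.
    by exists a, v, u.
  have nb : \forall z \near x, ball (chart_map a x) e (chart_map a z).
    by apply: (amc x ax); exact: nbhsx_ballx.
  have nd : \forall z \near x, chart_dom a z by exact: open_nbhs_nbhs.
  apply: filterS2 nb nd => z zb zd.
  by have := z0 _ zb; rewrite /= !aK.
pose D := [set t | al t = al y].
suff : D = setT by move=> DT; apply: neq; have : D y' by rewrite DT.
apply: cM; first by exists y.
  exists D; rewrite ?setTI// openE => t Dt; rewrite /interior.
  by have := loc t; apply: filterS => t' /=; rewrite /D /= => ->.
exists D; rewrite ?setTI// -(setCK D); apply: open_closedC.
rewrite openE => t Dt; rewrite /interior.
by have := loc t; apply: filterS => t' /= h; rewrite /D /= h.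
Qed.

End derivative_nonzero.

(** * From a local curve of similarities to a flow on the whole line *)

Section extension.
Variables (R : realType) (M : metricType R) (n k : nat).
Local Notation E := (cemetery_ext M).
Variable A : set (chart M 'rV[R]_n).
Hypothesis hA : Ck_atlas k A.
Context (d : measure_display) (T : measurableType d) (P : probability T R).
Variable X : M -> T -> R -> E.
Variable y0 : M.
Hypothesis dX : discrete_homs (symmetries P (X y0)).

Let RA := prod_atlas (@id_atlas R R^o) A.
Let fR : fin_coords R^o := fin_coords_real R.
Let fV : fin_coords 'rV[R]_n := fin_coords_rV R n.
Let hR : Ck_atlas k (@id_atlas R R^o) := Ck_atlas_id R^o k.
Let iR := Ck_atlas_is hR.
Let iA := Ck_atlas_is hA.
Let iRA : is_atlas RA := is_atlas_prod hR hA.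
Let fRV := fin_coords_prod fR fV.

Lemma fin_coords_chart2 (Q : topologicalType) (V : normedModType R)
    (B : set (chart Q V)) (g : R^o * M -> M) (D : set (R^o * M)) (U : set Q)
    (a : Q -> R^o) (b : Q -> M) : is_atlas B -> open U -> open D ->
  (forall q, U q -> D (a q, b q)) ->
  Ck_map_on k RA A g D -> Ck_map_on k B (@id_atlas R R^o) a U ->
  Ck_map_on k B A b U -> Ck_map_on k B A (fun q => g (a q, b q)) U.
Proof.
move=> iB oU oD UD hg ha hb.
apply: (@Ck_map_on_comp _ _ _ _ _ _ _ _ _ _ _ iB iRA iA (fun q => (a q, b q)) g U D fRV) => //.
exact: Ck_map_on_pair.
Qed.

Variables (g gi : R -> M -> M) (r : R).
Hypotheses (r0 : 0 < r) (gsim : forall u, `|u| < r -> sim P X (g u) (gi u) (expR u))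
  (g0 : g 0 = id) (gy0 : forall u, `|u| < r -> g u y0 = y0).
Let D : set (R^o * M) := ball (0 : R^o) r `*` setT.
Hypotheses (hg : Ck_map_on k RA A (fun p => g p.1 p.2) D)
  (hgi : Ck_map_on k RA A (fun p => gi p.1 p.2) D).

Let ballE (u : R) : ball (0 : R^o) r u = (`|u| < r).
Proof. by rewrite -ball_normE /= sub0r normrN. Qed.

Let oD : open D.
Proof.
rewrite openE => -[u x] [/= ur _]; exists (ball (0 : R^o) r, setT) => //.
split; last exact: filterT.
by apply: open_nbhs_nbhs; split => //; exact: ball_open.
Qed.

(** A time [u] out of reach of [g] is covered by [m] equal steps. The curve [g] is not assumed to be
    additive in [u]; [ext_one] is the substitute. *)
Let ext (g : R -> M -> M) (m : nat) (u : R) := iter m (g (u / m%:R)).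

Let norm_div (u : R) (m : nat) : `|u / m%:R| = `|u| / m%:R.
Proof. by rewrite normrM normfV normr_nat. Qed.

Let ext_sim m u : (0 < m)%N -> `|u| / m%:R < r ->
  sim P X (ext g m u) (ext gi m u) (expR u).
Proof.
move=> m0 ur; have := sim_iter m (gsim _).
rewrite -/(ext g m u) => /(_ (u / m%:R)); rewrite norm_div => /(_ ur).
have -> : expR (u / m%:R) ^+ m = expR u; last by [].
by rewrite -expRM_natl mulrC divfK// pnatr_eq0 -lt0n.
Qed.

Let gcont (u : R) (x : M) : `|u| < r ->
  {for (u : R^o, x), continuous (fun p : R^o * M => g p.1 p.2)}.
Proof. by move=> ur; have [h _] := hg; apply: h; split => //=; rewrite ballE. Qed.

Let gicont (u : R) (x : M) : `|u| < r ->
  {for (u : R^o, x), continuous (fun p : R^o * M => gi p.1 p.2)}.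
Proof. by move=> ur; have [h _] := hgi; apply: h; split => //=; rewrite ballE. Qed.

Let iter_y0 m u : `|u| < r -> iter m (g u) y0 = y0.
Proof. by move=> ur; elim: m => //= m ->; exact: gy0. Qed.

(** Both sides have ratio [expR w] and fix [y0]. Along the times [s] from 0 to [w] their quotient is
    a continuous family of symmetries, equal to the identity at [s = 0], hence everywhere. *)
Let ext_one w m : (0 < m)%N -> `|w| < r -> ext g m w = g w.
Proof.
move=> m0 wr.
(* Clamping [s] defines the family on the whole line, which is connected, while staying in the
   domain of [g]. *)
pose rho (s : R^o) : R^o := Num.max (- `|w|) (Num.min `|w| s).
have rhow s : `|rho s| <= `|w|.
  rewrite ler_norml /rho le_max lexx /= ge_max; apply/andP; split.
    by apply: (@le_trans _ _ 0); rewrite ?oppr_le0 ?normr_ge0.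
  by rewrite ge_min lexx.
have crho : continuous rho.
  move=> s; apply: (@continuous_max _ _ (fun _ : R^o => - `|w| : R^o)
    (fun s : R^o => Num.min `|w| s : R^o)); first exact: cvg_cst.
  apply: (@continuous_min _ _ (fun _ : R^o => `|w| : R^o) (fun s : R^o => s)).
    exact: cvg_cst.
  exact: cvg_id.
have rhor s : `|rho s| < r by exact: le_lt_trans (rhow s) wr.
have m1 : 1 <= m%:R :> R by rewrite ler1n.
have rhom s : `|rho s| / m%:R < r.
  by apply: le_lt_trans (rhor s); rewrite ler_pdivrMr ?ltr0n// ler_peMr.
pose G (s : R^o) := gi (rho s) \o ext g m (rho s).
have Gsym s : symmetries P (X y0) (G s).
  have h := sim_comp (sim_inv (gsim (rhor s))) (ext_sim m0 (rhom s)).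
  apply: (@sim_symmetry _ _ _ _ _ _ _ _ (ext gi m (rho s) \o g (rho s))).
    by have := h; rewrite divff// gt_eqF// expR_gt0.
  rewrite /G /= /ext iter_y0 ?norm_div//.
  by have [_ gK _ _ _] := gsim (rhor s); rewrite -{1}(gy0 (rhor s)) gK.
have cG : continuous (fun p : R^o * M => G p.1 p.2).
  have cit j : continuous (fun p : R^o * M => iter j (g (rho p.1 / m%:R)) p.2).
    elim: j => [|j IH] [s x]; first exact: cvg_snd.
    have hs : `|rho s / m%:R| < r by rewrite norm_div.
    have h1 : (rho p.1 / m%:R : R^o, iter j (g (rho p.1 / m%:R)) p.2) @[p --> (s, x)]
        --> (rho s / m%:R : R^o, iter j (g (rho s / m%:R)) x).
      have k1 : (rho p.1 / m%:R : R^o) @[p --> (s, x)] --> (rho s / m%:R : R^o).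
        apply: cvgM; last exact: cvg_cst.
        by apply: (@cvg_comp _ _ _ fst rho _ (nbhs s)); [exact: cvg_fst|exact: crho].
      exact: (cvg_pair k1 (IH (s, x))).
    have h2 := @gcont _ (iter j (g (rho s / m%:R)) x) hs.
    have h3 := cvg_comp _ _ h1 h2.
    exact: h3.
  move=> [s x].
  have h1 : (rho p.1 : R^o, iter m (g (rho p.1 / m%:R)) p.2) @[p --> (s, x)]
      --> (rho s : R^o, iter m (g (rho s / m%:R)) x).
    have k1 : (rho p.1 : R^o) @[p --> (s, x)] --> (rho s : R^o).
      by apply: (@cvg_comp _ _ _ fst rho _ (nbhs s)); [exact: cvg_fst|exact: crho].
    exact: (cvg_pair k1 (cit m (s, x))).
  have h2 := @gicont _ (iter m (g (rho s / m%:R)) x) (rhor s).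
  have h3 := cvg_comp _ _ h1 h2.
  exact: h3.
have cR : connected [set: R^o] by exact: ((@connected_intervalP R setT).2 (fun _ _ _ _ _ _ => I)).
have := discrete_family dX cR cG Gsym w 0.
have -> : G 0 = id.
  have r0' : rho 0 = 0.
    rewrite /rho; have -> : Num.min `|w| 0 = 0 by apply/min_idPr.
    by apply/max_idPr; rewrite oppr_le0.
  have i0 j : iter j (id : M -> M) = id by elim: j => // j /= ->.
  rewrite /G r0' /ext mul0r g0 i0; apply/funext => x /=.
  have := gsim (u := 0); rewrite normr0 => /(_ r0)[_ gK _ _ _].
  by have := gK x; rewrite g0.
have rw : rho w = w.
  by rewrite /rho min_r ?ler_norm// max_r// lerNl -normrN ler_norm.
rewrite /G rw => h; apply/funext => x.
have [_ _ gVK _ _] := gsim wr.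
by have := congr1 (fun f => g w (f x)) h; rewrite /= gVK.
Qed.

(** Both are compared with [m * m'] steps, each step of size [u / m] being cut into [m'] by
    [ext_one]. *)
Let ext_indep m m' u : (0 < m)%N -> (0 < m')%N -> `|u| / m%:R < r ->
  `|u| / m'%:R < r -> ext g m u = ext g m' u.
Proof.
have half a b : (0 < a)%N -> (0 < b)%N -> `|u| / a%:R < r ->
    ext g a u = ext g (a * b) u.
  move=> a0 b0 ua; rewrite {1}/ext.
  have <- : ext g b (u / a%:R) = g (u / a%:R).
    by apply: ext_one => //; rewrite norm_div.
  apply/funext => x; rewrite /ext natrM invfM mulrA.
  by rewrite (iterM a b).
move=> m0 m0' um um'.
by rewrite (half m m')// (half m' m)// mulnC.
Qed.

Let N (u : R) := (Num.truncn (`|u| / r)).+1.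

Let NP u : `|u| / (N u)%:R < r.
Proof.
by rewrite ltr_pdivrMr ?ltr0n// mulrC -ltr_pdivrMr// truncnS_gt.
Qed.

Let Ck_ext (G : R -> M -> M) m (m0 : (0 < m)%N) :
  Ck_map_on k RA A (fun p => G p.1 p.2) D ->
  Ck_map_on k RA A (fun p => ext G m p.1 p.2)
    ([set u : R^o | `|u| / m%:R < r] `*` setT).
Proof.
move=> hG; rewrite /ext; set U := _ `*` _.
have oU : open U.
  rewrite (_ : U = (fun p : R^o * M => `|p.1| / m%:R) @^-1` [set s | s < r]).
    apply: open_comp; last exact: open_lt.
    move=> p _; apply: cvgM; last exact: cvg_cst.
    by apply: cvg_norm; exact: cvg_fst.
  by apply/seteqP; split => [[u x] []//|[u x] /= h]; split.
elim: {1}m => [|j IH] /=.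
  exact: (Ck_map_on_snd hR hA U fV).
apply: (@fin_coords_chart2 _ _ RA (fun p => G p.1 p.2) D U
  (fun p : R^o * M => p.1 / m%:R : R^o)) => //.
  by move=> [u x] [/= ur _]; split => //=; rewrite ballE norm_div.
have h1 := Ck_map_on_fst hR hA U fR.
have h2 : Ck_map_on k (@id_atlas R R^o) (@id_atlas R R^o)
    (fun u : R^o => u / m%:R : R^o) setT.
  apply/Ck_map_on_idP.
  have h : Ck_on k (fun u : R^o => (m%:R^-1 : R^o) *: (u : R^o)) setT.
    apply: Ck_on_scale; [exact: openT|exact: Ck_on_cst|].
    by apply/Ck_map_on_idP; exact: Ck_map_on_id.
  by apply: (Ck_on_eq openT _ h) => u _; rewrite /GRing.scale /= mulrC.
exact: (Ck_map_on_comp iRA iR iR fR oU openT (fun _ _ => I) h1 h2).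
Qed.

(* The extension sends [u] to the [N]-th iterate of [gi (u / N)], for any large [N]:
   two values of [N] give similarities of the same ratio whose quotient is a
   continuous family of symmetries, hence constant. *)
Lemma flow_extension : exists G Gi : R -> M -> M,
  [/\ forall u, sim P X (G u) (Gi u) (expR u), G 0 = id, forall u, G u y0 = y0,
     Ck_map_on k RA A (fun p => G p.1 p.2) setT &
     Ck_map_on k RA A (fun p => Gi p.1 p.2) setT].
Proof.
(* For the inverses the independence of the number of steps is inherited: they are inverses of one
   and the same map. *)
have ext_i m u : (0 < m)%N -> `|u| / m%:R < r -> ext gi m u = ext gi (N u) u.
  move=> m0 um.
  have [_ gK _ _ _] := ext_sim m0 um.
  have [_ _ gVK _ _] := ext_sim (ltn0Sn _ : 0 < N u)%N (NP u).
  apply/funext => x; rewrite -{1}(gVK x).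
  by rewrite -(ext_indep m0 _ um (NP u)).
have oU m : open ([set u : R^o | `|u| / m%:R < r] `*` [set: M]).
  rewrite (_ : _ `*` _ = (fun p : R^o * M => `|p.1| / m%:R) @^-1` [set s | s < r]).
    apply: open_comp; last exact: open_lt.
    move=> p _; apply: cvgM; last exact: cvg_cst.
    by apply: cvg_norm; exact: cvg_fst.
  by apply/seteqP; split => [[u x] []//|[u x] /= h]; split.
exists (fun u => ext g (N u) u), (fun u => ext gi (N u) u); split.
- by move=> u; apply: ext_sim.
- have i0 j : iter j (id : M -> M) = id by elim: j => // j /= ->.
  by rewrite /ext mul0r g0 i0.
- by move=> u; rewrite /ext iter_y0 ?norm_div.
(* The number of steps jumps with the time, but close to [u] it may be frozen at [N u] by
   [ext_indep]. *)
- apply: (Ck_map_on_nbhs iRA) => -[u x] _.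
  exists (fun p => ext g (N u) p.1 p.2), ([set u' : R^o | `|u'| / (N u)%:R < r] `*` setT).
  split; [exact: oU|by split => //=; exact: NP|exact: Ck_ext|].
  by move=> [u' x'] [/= h _]; rewrite (ext_indep _ _ h (NP u')).
- apply: (Ck_map_on_nbhs iRA) => -[u x] _.
  exists (fun p => ext gi (N u) p.1 p.2), ([set u' : R^o | `|u'| / (N u)%:R < r] `*` setT).
  split; [exact: oU|by split => //=; exact: NP|exact: Ck_ext|].
  by move=> [u' x'] [/= h _]; rewrite (ext_i _ _ _ h).
Qed.

End extension.

(** * The group structure *)

Section group_components.
Variables (R : realType) (k n : nat) (M : metricType R).
Local Notation E := (cemetery_ext M).
Local Notation V := 'rV[R]_n.
Variable A : set (chart M V).
Context (d : measure_display) (T : measurableType d) (P : probability T R).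
Variables (X : M -> T -> R -> E) (y0 : M).
Hypothesis hA : Ck_atlas k.+1 A.
Hypothesis XM : strong_markov_process P X.
Hypotheses (lc : locally_cpt M) (sep : separable M).
Hypothesis cM : connected [set: M].

Let iA := Ck_atlas_is hA.
Let fV : fin_coords V := fin_coords_rV R n.
Let AA := prod_atlas A A.
Let iAA : is_atlas AA := is_atlas_prod hA hA.
Let fVV := fin_coords_prod fV fV.
Let RA := @id_atlas R R^o.
Let hR : Ck_atlas k.+1 RA := Ck_atlas_id R^o k.+1.
Let iR := Ck_atlas_is hR.
Let fR : fin_coords R^o := fin_coords_real R.
Local Notation CkA := (Ck_map_on k.+1).

Lemma Ck_op (Q : topologicalType) (W : normedModType R) (B : set (chart Q W))
    (f : M -> M -> M) (F G : Q -> M) (U : set Q) : is_atlas B -> open U ->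
  CkA AA A (fun p => f p.1 p.2) setT -> CkA B A F U -> CkA B A G U ->
  CkA B A (fun q => f (F q) (G q)) U.
Proof.
move=> iB oU hf hF hG.
exact: (Ck_map_on_comp iB iAA iA fVV oU openT (fun _ _ => I)
  (Ck_map_on_pair iB iA iA oU hF hG) hf).
Qed.

Lemma Ck_compose (Q : topologicalType) (W : normedModType R) (B : set (chart Q W))
    (Z : normedModType R) (N : topologicalType) (C : set (chart N Z))
    (g : M -> N) (F : Q -> M) (U : set Q) : is_atlas B -> is_atlas C -> open U ->
  CkA A C g setT -> CkA B A F U -> CkA B C (fun q => g (F q)) U.
Proof.
move=> iB iC oU hg hF.
exact: (Ck_map_on_comp iB iA iC fV oU openT (fun _ _ => I) hF hg).
Qed.

Let ck1 : CkA AA A fst setT := Ck_map_on_fst hA hA _ fV.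
Let ck2 : CkA AA A snd setT := Ck_map_on_snd hA hA _ fV.
Let ckid : CkA A A id setT := Ck_map_on_id _ hA.

Lemma Ck_real_mulr (Q : topologicalType) (W : normedModType R)
    (B : set (chart Q W)) (a b : Q -> R) (U : set Q) : is_atlas B -> open U ->
  CkA B RA a U -> CkA B RA b U -> CkA B RA (fun q => a q * b q : R^o) U.
Proof.
move=> iB oU [ca ha] [cb hb]; split=> [x Ux|c _ Bc ->].
  by apply: cvgM; [exact: ca|exact: cb].
have [isB _] := iB; have oc := open_chart_preimage (isB c Bc) oU.
have h (g : Q -> R) : (forall c b', B c -> RA b' -> Ck_on k.+1
    (chart_map b' \o g \o chart_inv c)
      [set v | chart_cod c v /\ (U `&` g @^-1` chart_dom b') (chart_inv c v)]) ->
   Ck_on k.+1 (g \o chart_inv c : _ -> R^o) [set v | chart_cod c v /\ U (chart_inv c v)].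
  move=> hg; apply: Ck_on_sub (hg c _ Bc erefl) => v [? ?]; split => //; split => //.
have h1 := Ck_on_scale oc (h a ha) (h b hb).
by apply: Ck_on_sub h1 => v [? []].
Qed.

Lemma Ck_real_comp (Q : topologicalType) (W : normedModType R)
    (B : set (chart Q W)) (a : Q -> R) (g : R -> R) (U : set Q) (O : set R^o) :
  is_atlas B -> open U -> open O -> (forall q, U q -> O (a q)) ->
  CkA B RA a U -> Ck_on k.+1 (g : R^o -> R^o) O -> CkA B RA (fun q => g (a q)) U.
Proof.
move=> iB oU oO UO ha hg.
by apply: (Ck_map_on_comp iB iR iR fR oU oO UO ha); exact/Ck_map_on_idP.
Qed.

Lemma Ck_of_map (Q N : topologicalType) (W Z : normedModType R)
    (B : set (chart Q W)) (C : set (chart N Z)) (f : Q -> N) :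
  Ck_map k.+1 B C f -> CkA B C f setT.
Proof. by move/Ck_map_onT. Qed.

Lemma components_change_reference y1 f finv c :
  Ck_invariance_components k.+1 A P X y1 f finv c ->
  exists f' finv' c', [/\ Ck_invariance_components k.+1 A P X y0 f' finv' c',
    f' y0 = id & c' y0 = 1].
Proof.
move=> [ic /Ck_of_map hf /Ck_of_map hfi /Ck_of_map hc].
have [HK HiK cH cHi [c0 cc]] := component_moving ic.
exists (fun y x => f y (finv y0 x)), (fun y x => f y0 (finv y x)), (fun y => c y / c y0).
have k1 : CkA AA A (fun p => f p.1 (finv y0 p.2)) setT.
  apply: Ck_op => //; first exact: openT.
  by apply: Ck_op => //; [exact: openT|exact: Ck_map_on_cst].
have k2 : CkA AA A (fun p => f y0 (finv p.1 p.2)) setT.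
  by apply: Ck_op => //; [exact: openT|exact: Ck_map_on_cst].
have k3 : CkA A RA (fun y => c y / c y0) setT.
  apply: (Ck_real_mulr iA openT hc); exact: (@Ck_map_on_cst _ _ R^o _ _ _ A RA).
split; last by rewrite divff ?gt_eqF.
  split; [split|exact/Ck_map_onT|exact/Ck_map_onT|exact/Ck_map_onT].
  - by move=> y x /=; rewrite HK HiK.
  - by move=> y x /=; rewrite HK HiK.
  - exact: (Ck_map_on_continuous k1).
  - exact: (Ck_map_on_continuous k2).
  - by move=> y; rewrite divr_gt0.
  - exact: (Ck_map_on_continuous k3).
  - move=> y; have ey := component_eq_law ic.
    have ci : 0 < (c y0)^-1 by rewrite invr_gt0.
    (* The relation between [X y0] and the old reference process is inverted, so that the latter can
       be eliminated. *)
    have h1 : eq_law P (fun om => act (finv y0) (c y0)^-1 (X y0 om)) (X y1).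
      have := eq_law_act (@continuous_slice _ _ _ _ y0 cHi) ci (ey y0).
      move=> h; apply: eq_law_trans h _.
      rewrite (_ : (fun om => _) = X y1) => [C//|].
      apply/funext => om; rewrite act_comp divff ?gt_eqF//.
      rewrite (_ : finv y0 \o f y0 = id) ?act_id//.
      by apply/funext => x /=; rewrite HK.
    apply: eq_law_trans (ey y) _.
    have := eq_law_act (@continuous_slice _ _ _ _ y cH) (c0 y) (eq_law_sym h1).
    move=> h; apply: eq_law_trans h _.
    rewrite (_ : (fun om => _) = (fun om t => omap (fun x => f y (finv y0 x))
       (X y0 om (c y / c y0 * t)))) => [C//|].
    by apply/funext => om; rewrite act_comp mulrC.
by apply/funext => x; rewrite HiK.
Qed.

Hypothesis hsupp : exists y, interior (process_support P (X y)) y.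
Hypothesis dX : discrete_homs (symmetries P (X y0)).

Section fixed_components.
Variables (f finv : M -> M -> M) (c : M -> R).
Hypothesis ic : Ck_invariance_components k.+1 A P X y0 f finv c.

Let ii := Ck_component_inv ic.
Let hf := Ck_of_map (Ck_component_f ic).
Let hfi := Ck_of_map (Ck_component_fV ic).
Let hc := Ck_of_map (Ck_component_c ic).

(** Self-similarity is the transfer from the single point [y0]; [transfers_all] extends it to the
    other points. *)
Lemma sim_component y : sim P X (f y) (finv y) (c y).
Proof.
have [HK HiK cH cHi [c0 cc]] := component_moving ii.
have cf : continuous (f y) := @continuous_slice _ _ _ _ y cH.
have cfi : continuous (finv y) := @continuous_slice _ _ _ _ y cHi.
split => // z.
apply: (@transfers_all _ _ _ _ _ X XM lc sep y0 f finv c ii cM hsupp _ (finv y) _ y0) => //.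
rewrite /transfers (component_start XM ii); exact: (component_eq_law ii y).
Qed.

Let fy0 y : f y y0 = y := component_start XM ii y.

Let fiy y : finv y y = y0.
Proof.
have [HK _ _ _ _] := component_moving ii.
by rewrite -{2}(fy0 y) HK.
Qed.

(** The defect of the identity f_x o f_y = f_(f_x y); its ratio is the defect of multiplicativity of
    [c]. *)
Let G x y : M -> M := finv (f x y) \o (f x \o f y).
Let Gi x y : M -> M := (finv y \o finv x) \o f (f x y).

Let G_sim x y : sim P X (G x y) (Gi x y) (c x * c y / c (f x y)).
Proof.
have h1 := sim_inv (sim_component (f x y)).
have h2 := sim_comp (sim_component x) (sim_component y).
by rewrite [c x * _]mulrC; exact: sim_comp h1 h2.
Qed.

Let G_y0 x y : G x y y0 = y0.
Proof. by rewrite /G /= fy0 fiy. Qed.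

(** For fixed [x], the defects [G x y] have ratio 1 and form a family of symmetries parametrised by
    the connected space [M]. At [y = y0] the defect is f_x^-1 o f_x, so it is the identity for all
    [y]. *)
Lemma component_assoc : f y0 = id -> (forall x y, c (f x y) = c x * c y) ->
  forall x y z, f x (f y z) = f (f x y) z.
Proof.
move=> f0 cmul x y z.
have [HK HiK cH cHi [c0 cc]] := component_moving ii.
have Gsym y' : symmetries P (X y0) (G x y').
  apply: (@sim_symmetry _ _ _ _ _ _ _ _ (Gi x y')) => //.
  by have := G_sim x y'; rewrite cmul divff// gt_eqF// mulr_gt0.
have hG : CkA AA A (fun p : M * M => G x p.1 p.2) setT.
  have e1 : CkA AA A (fun p : M * M => f x p.1) setT.
    by apply: Ck_op => //; [exact: openT|exact: Ck_map_on_cst].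
  have e2 : CkA AA A (fun p : M * M => f x (f p.1 p.2)) setT.
    by apply: Ck_op => //; [exact: openT|exact: Ck_map_on_cst].
  exact: (Ck_op iAA openT hfi e1 e2).
have cG := Ck_map_on_continuous hG.
have := discrete_family dX cM cG Gsym y y0.
have -> : G x y0 = id.
  by apply/funext => w; rewrite /G /= f0 fy0 HK.
by move=> /(congr1 (fun g => f (f x y) (g z))); rewrite /G /= HiK.
Qed.

Hypothesis c1 : c y0 = 1.

(* The ratio [c x * c y / c (f x y)] is the time scale of the similarity
   f_(f_x y)^-1 o f_x o f_y, which fixes the reference point. When it is not
   constant, a curve along which its logarithm has a nonzero derivative gives
   similarities of all the ratios close to 1. *)
Lemma component_flow x y1 : c x * c y1 != c (f x y1) ->
  exists G Gi : R -> M -> M,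
  [/\ forall u, sim P X (G u) (Gi u) (expR u), G 0 = id, forall u, G u y0 = y0,
     CkA (prod_atlas RA A) A (fun p => G p.1 p.2) setT &
     CkA (prod_atlas RA A) A (fun p => Gi p.1 p.2) setT].
Proof.
move=> neq.
have [HK HiK cH cHi [c0 cc]] := component_moving ii.
pose q y := c x * c y / c (f x y).
have q0 y : 0 < q y by rewrite divr_gt0 ?mulr_gt0.
pose al y := ln (q y).
have hfx : CkA A A (f x) setT.
  by apply: (Ck_op iA openT hf) => //; exact: Ck_map_on_cst.
have hal : CkA A RA al setT.
  apply: (@Ck_real_comp _ _ A q (@ln R) setT [set s : R^o | 0 < s] iA openT).
  - exact: open_gt.
  - by move=> y _; exact: q0.
  - apply: (Ck_real_mulr iA openT).
      apply: (Ck_real_mulr iA openT) hc.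
      exact: (@Ck_map_on_cst _ _ R^o _ _ _ A RA).
    apply: (@Ck_real_comp _ _ A (fun y => c (f x y)) GRing.inv setT [set s : R^o | 0 < s] iA openT).
    + exact: open_gt.
    + by move=> y _; exact: c0.
    + exact: (Ck_compose iA iR openT hc hfx).
    apply: (@Ck_on_inv _ _ _ (fun y : R^o => y)); first exact: open_gt.
      by move=> s /= /gt_eqF ->.
    by apply/Ck_map_on_idP; exact: Ck_map_on_id.
  - exact: Ck_on_ln.
(* The normalisation c(y0) = 1 and f_x y0 = x give [q y0 = 1], that is [al y0 = 0]. *)
have al_neq : al y1 <> al y0.
  rewrite /al /q fy0 c1 mulr1 divff ?gt_eqF// => /ln_inj; rewrite !posrE.
  rewrite divr_gt0 ?mulr_gt0// => /(_ isT ltr01) e1.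
  move/negP: neq; apply; apply/eqP.
  by rewrite -[RHS]mul1r -e1 divfK ?gt_eqF.
have [a [v [e [Aa av De]]]] := nonconstant_derivative hA cM hal al_neq.
have [isA _] := iA.
have [[oa oc] am ai [aK aVK] [amc aic]] := isA a Aa.
(* A line in the chart along which [al] has a nonzero derivative at 0. *)
pose l (s : R^o) := v + s *: e.
have hl : CkA RA (@id_atlas R V) l setT.
  apply/Ck_map_on_idP; apply: Ck_on_add; [exact: openT|exact: Ck_on_cst|].
  apply: Ck_on_scale; [exact: openT| |exact: Ck_on_cst].
  by apply/Ck_map_on_idP; exact: Ck_map_on_id.
have cl := Ck_map_on_continuous hl.
have /nbhs_ballP[r1 /= r10 hr1] : nbhs (0 : R^o) (l @^-1` chart_cod a).
  by apply: (cl 0); apply: open_nbhs_nbhs; split => //; rewrite /l scale0r addr0.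
have oB (r : R) : open (ball (0 : R^o) r) by exact: ball_open.
have hV := Ck_atlas_id V k.+1.
have hp0 : CkA RA A (chart_inv a \o l) (ball (0 : R^o) r1).
  apply: (@Ck_map_on_comp _ _ _ _ _ _ _ _ _ _ _ iR (Ck_atlas_is hV) iA l (chart_inv a) _ (chart_cod a)) => //.
  - exact: Ck_map_on_sub hl.
  - exact: Ck_map_on_chart_inv.
pose b := al \o (chart_inv a \o l).
have hb : Ck_on k.+1 (b : R^o -> R^o) (ball (0 : R^o) r1).
  by apply/Ck_map_on_idP; exact: (Ck_compose iR iR (oB r1) hal hp0).
have hal' : Ck_on k.+1 (al \o chart_inv a : _ -> R^o) (chart_cod a).
  by apply: Ck_on_sub (Ck_on_chart_inv Aa hal) => w.
have nzb : 'D_1 (b : R^o -> R^o) 0 != 0.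
  have [d1 _] := hal'.
  have l0 : l 0 = v by rewrite /l scale0r addr0.
  have dl : differentiable l 0.
    apply: differentiableD; first exact: differentiable_cst.
    by apply: differentiableZl; have [] := @is_diff_id R R^o 0.
  have da : differentiable (al \o chart_inv a : _ -> R^o) (l 0) by rewrite l0; exact: d1.
  have Dl : 'D_1 l 0 = e.
    rewrite /derive; apply: cvg_lim => //; apply: cvg_near_cst.
    near=> h.
    have h0 : h != 0 by near: h; exact: nbhs_dnbhs_neq.
    rewrite /l /= addr0 scale0r addr0 addrC addKr [_%:A]mulr1 scalerA.
    by rewrite mulVf// scale1r.
  rewrite deriveE; last exact: (differentiable_comp dl da).
  by rewrite (diff_comp dl da) /= -(deriveE _ dl) Dl -(deriveE _ da) l0.
have [sg [r [r0 sg0 hsg Csg]]] := Ck_inverse r10 hb nzb.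
(* The curve is reparametrised by the local inverse of [b], so that [al (p u)] is exactly
   [b 0 + u]. *)
pose p (u : R^o) := chart_inv a (l (sg (b 0 + u))).
have bshift (u : R^o) : ball (0 : R^o) r u -> ball (b 0 : R^o) r (b 0 + u).
  by rewrite -!ball_normE /= sub0r opprD addrA subrr sub0r.
have hp : CkA RA A p (ball (0 : R^o) r).
  apply: (@Ck_map_on_comp _ _ _ _ _ _ _ _ _ _ _ iR iR iA
    (fun u : R^o => sg (b 0 + u) : R^o) (chart_inv a \o l) _ (ball (0 : R^o) r1) fR (oB r) (oB r1)) => //.
    by move=> u /bshift /hsg[].
  apply/Ck_map_on_idP.
  apply: (@Ck_on_comp _ R^o R^o R^o k.+1 (fun u : R^o => b 0 + u : R^o) (sg : R^o -> R^o)
     _ (ball (b 0 : R^o) r) fR (oB r)) => //; first exact: ball_open.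
  apply: Ck_on_add; [exact: oB|exact: Ck_on_cst|].
  by apply/Ck_map_on_idP; exact: Ck_map_on_id.
have alp (u : R) : `|u| < r -> al (p u) = b 0 + u.
  move=> ur; have : ball (0 : R^o) r u by rewrite -ball_normE /= sub0r normrN.
  by move=> /bshift /hsg[_].
have p0 : p 0 = chart_inv a (l 0) by rewrite /p addr0 sg0.
have Gsim' y : sim P X (G x y) (Gi x y) (expR (al y)).
  by rewrite lnK ?posrE//; exact: G_sim.
(* Dividing by the value at 0 gives a curve through the identity whose ratio at [u] is [expR u]. *)
pose g (u : R) := Gi x (p 0) \o G x (p u).
pose gi (u : R) := Gi x (p u) \o G x (p 0).
pose D : set (R^o * M) := ball (0 : R^o) r `*` setT.
have oD : open D.
  rewrite openE => -[u z] [/= ur _]; exists (ball (0 : R^o) r, setT) => //.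
  split; last exact: filterT.
  by apply: open_nbhs_nbhs; split => //; exact: oB.
have iRA : is_atlas (prod_atlas RA A) := is_atlas_prod hR hA.
have hpu : CkA (prod_atlas RA A) A (fun q : R^o * M => p q.1) D.
  have h1 := Ck_map_on_fst hR hA D fR.
  have UD q1 : D q1 -> (ball (0 : R^o) r) q1.1 by case.
  exact: (Ck_map_on_comp iRA iR iA fR oD (oB r) UD h1 hp).
have hz : CkA (prod_atlas RA A) A snd D := Ck_map_on_snd hR hA D fV.
have hcst z : CkA (prod_atlas RA A) A (fun _ => z) D := Ck_map_on_cst _ _ _ _ _.
have op1 := @Ck_op _ _ (prod_atlas RA A) f _ _ D iRA oD hf.
have op2 := @Ck_op _ _ (prod_atlas RA A) finv _ _ D iRA oD hfi.
apply: (@flow_extension _ _ _ _ _ hA _ _ P X y0 dX g gi r r0).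
- move=> u ur.
  have h := sim_comp (sim_inv (Gsim' (p 0))) (Gsim' (p u)).
  suff <- : expR (al (p u)) / expR (al (p 0)) = expR u by exact: h.
  by rewrite -expRN -expRD alp// alp ?normr0// addr0 addrC addKr.
- have [_ GK _ _ _] := G_sim x (p 0).
  by apply/funext => z; rewrite /g /= GK.
- move=> u ur; rewrite /g /= G_y0.
  by have [_ GK _ _ _] := G_sim x (p 0); rewrite -{1}(G_y0 x (p 0)) GK.
- have e1 : CkA (prod_atlas RA A) A (fun q : R^o * M => G x (p q.1) q.2) D.
    by apply: (op2); [exact: op1|apply: (op1) => //; exact: op1].
  by apply: (op2) => //; apply: (op2) => //; exact: op1.
- have e1 : CkA (prod_atlas RA A) A (fun q : R^o * M => G x (p 0) q.2) D.
    by apply: (op2) => //; apply: (op1) => //; exact: op1.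
  apply: (op2) => //; apply: (op2) => //; apply: (op1) => //; exact: op1.
Unshelve. all: by end_near. Qed.

End fixed_components.

Lemma group_components y1 f1 finv1 c1 :
  Ck_invariance_components k.+1 A P X y1 f1 finv1 c1 ->
  exists f finv c, [/\ Ck_invariance_components k.+1 A P X y0 f finv c,
    forall x y z, f x (f y z) = f (f x y) z &
    forall x y, c (f x y) = c x * c y].
Proof.
move=> /components_change_reference[f [finv [c [ic f0 c10]]]].
have ii := Ck_component_inv ic.
have [HK HiK cH cHi [c0 cc]] := component_moving ii.
have [cmul|] := pselect (forall x y, c (f x y) = c x * c y).
  by exists f, finv, c; split => //; exact: (component_assoc ic f0 cmul).
move=> /existsNP[x /existsNP[y /eqP]]; rewrite eq_sym => neq.
have [G [Gi [simG G0 Gy0 CG CGi]]] := component_flow ic c10 neq.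
pose u y := - ln (c y).
(* The flow fixes [y0], so [f' y] still sends [y0] to [y]; and [f' y0] is the identity because
   [u y0 = - ln 1 = 0]. *)
pose f' y := f y \o G (u y).
pose finv' y := Gi (u y) \o finv y.
have simf y' : sim P X (f' y') (finv' y') 1.
  have := sim_comp (sim_component ic y') (simG (u y')).
  by rewrite /u expRN lnK ?posrE// mulVf// gt_eqF.
have hc := Ck_of_map (Ck_component_c ic).
have hf := Ck_of_map (Ck_component_f ic).
have hfi := Ck_of_map (Ck_component_fV ic).
have hu : CkA AA RA (fun p : M * M => u p.1 : R^o) setT.
  have e1 : CkA AA RA (fun p : M * M => c p.1 : R^o) setT.
    exact: (Ck_compose iAA iR openT hc ck1).
  apply: (@Ck_real_comp _ _ AA (fun p : M * M => c p.1) (fun s => - ln s) setT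
     [set s : R^o | 0 < s] iAA openT _ _ e1).
  - exact: open_gt.
  - by move=> p _; exact: c0.
  have h : Ck_on k.+1 (fun s : R^o => (-1 : R^o) *: (ln s : R^o)) [set s : R^o | 0 < s].
    by apply: Ck_on_scale; [exact: open_gt|exact: Ck_on_cst|exact: Ck_on_ln].
  apply: Ck_on_eq h; first exact: open_gt.
  by move=> s _; rewrite /GRing.scale /= mulN1r.
have iRA : is_atlas (prod_atlas RA A) := is_atlas_prod hR hA.
have fRV := fin_coords_prod fR fV.
have hGop (H : R -> M -> M) (F : M * M -> M) :
    CkA (prod_atlas RA A) A (fun p => H p.1 p.2) setT -> CkA AA A F setT ->
    CkA AA A (fun p => H (u p.1) (F p)) setT.
  move=> hH hF.
  exact: (Ck_map_on_comp iAA iRA iA fRV openT openT (fun _ _ => I)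
    (Ck_map_on_pair iAA iR iA openT hu hF) hH).
have k1 : CkA AA A (fun p => f' p.1 p.2) setT.
  by apply: (Ck_op iAA openT hf) => //; exact: hGop.
have k2 : CkA AA A (fun p => finv' p.1 p.2) setT.
  by apply: hGop => //; exact: (Ck_op iAA openT hfi).
have k3 : CkA A RA (fun _ : M => 1 : R^o) setT.
  exact: (@Ck_map_on_cst _ _ R^o _ _ _ A RA).
have ic' : Ck_invariance_components k.+1 A P X y0 f' finv' (fun=> 1).
  split; [split|exact/Ck_map_onT|exact/Ck_map_onT|exact/Ck_map_onT].
  - by move=> y'; have [] := simf y'.
  - by move=> y'; have [] := simf y'.
  - exact: (Ck_map_on_continuous k1).
  - exact: (Ck_map_on_continuous k2).
  - by move=> _; exact: ltr01.
  - by move=> z; exact: cvg_cst.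
  - move=> y'; have [_ _ _ _ /(_ y0)] := simf y'.
    by rewrite /transfers {1}/f' /= Gy0 (component_start XM ii).
exists f', finv', (fun=> 1); split => //; last by move=> *; rewrite mulr1.
apply: (component_assoc ic') => //; last by move=> *; rewrite mulr1.
by rewrite /f' /u c10 ln1 oppr0 G0 f0.
Qed.

End group_components.

(** * Integral clocks *)

Section right_derivative.
Variable R : realType.
Implicit Types (F G p : R -> R) (t s b : R).

Definition right_deriv F t (l : R) := forall e : R, 0 < e ->
  exists2 r : R, 0 < r & forall s, t <= s < t + r ->
    `|F s - F t - l * (s - t)| <= e * (s - t).

(** Restricted to [s >= 0], as clocks and paths carry no information at negative times. *)
Definition left_cont F t := forall e : R, 0 < e ->
  exists2 r : R, 0 < r & forall s, 0 <= s -> t - r < s <= t -> `|F t - F s| <= e.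

Lemma lt_sup_exists (S : set R) s : has_sup S -> s < sup S ->
  exists2 t, S t & s < t.
Proof.
move=> hS sS; have e0 : 0 < sup S - s by rewrite subr_gt0.
by have [t St] := sup_adherent e0 hS; rewrite subKr; exists t.
Qed.

(** Induction along the line: the times up to which the bound holds form an interval, closed at its
    supremum by left continuity, and extended beyond it by the right derivative 0. *)
Lemma right_deriv_zero_bound H b (e : R) : 0 <= b -> 0 < e ->
  (forall t, 0 <= t < b -> right_deriv H t 0) ->
  (forall t, 0 < t <= b -> left_cont H t) -> H 0 = 0 -> `|H b| <= e * b.
Proof.
move=> b0 e0 dH lH H0.
pose S := [set t : R | 0 <= t <= b /\ forall s, 0 <= s <= t -> `|H s| <= e * s].
have S0 : S 0.
  split; first by rewrite lexx.
  move=> s /andP[s0 s1]; have -> : s = 0 by apply: le_anti; rewrite s0 s1.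
  by rewrite H0 normr0 mulr0.
have hS : has_sup S.
  by split; [exists 0|exists b => t [/andP[]]].
set c := sup S.
have c0 : 0 <= c by apply: ub_le_sup => //; case: hS.
have cb : c <= b by apply: ge_sup; [exists 0|move=> t [/andP[]]].
have Slt s : 0 <= s -> s < c -> `|H s| <= e * s.
  move=> s0 sc; have [t [t0b ht] st] := lt_sup_exists hS sc.
  by apply: ht; rewrite s0 ltW.
have Hc : `|H c| <= e * c.
  have [c00|cn0] := eqVneq c 0; first by rewrite c00 H0 normr0 mulr0.
  have cp : 0 < c by rewrite lt_neqAle eq_sym cn0 c0.
  apply/ler_addgt0Pr => eps eps0.
  have [|r r0 hr] := lH c _ eps eps0; first by rewrite cp cb.
  pose s := Num.max 0 (c - r / 2).
  have s0 : 0 <= s by rewrite le_max lexx.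
  have sc : s < c by rewrite gt_max cp /= ltrBlDr ltrDl divr_gt0.
  have sr : c - r < s.
    by rewrite lt_max; apply/orP; right; rewrite ltrD2l ltrN2 ltr_pdivrMr// ltr_pMr// ltr1n.
  have := hr s s0; rewrite sr (ltW sc) => /(_ isT) h.
  have h2 := Slt s s0 sc.
  have es : e * s <= e * c by rewrite ler_pM2l// ltW.
  rewrite -(subrK (H s) (H c)) (le_trans (ler_normD _ _))//.
  lra.
have Sc : S c.
  split; first by rewrite c0.
  move=> s /andP[s0]; rewrite le_eqVlt => /orP[/eqP->//|]; exact: Slt.
suff -> : b = c by [].
apply/eqP; rewrite eq_le cb andbT leNgt; apply/negP => cltb.
have [|r r0 hr] := dH c _ e e0; first by rewrite c0.
pose t := Num.min b (c + r / 2).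
have ct : c < t by rewrite lt_min cltb ltrDl divr_gt0.
have tb : t <= b by rewrite ge_min lexx.
have tr : t < c + r.
  by rewrite gt_min ltrD2l ltr_pdivrMr// ltr_pMr// ltr1n orbT.
suff : S t by move=> /(ub_le_sup (proj2 hS)); rewrite leNgt ct.
split; first by rewrite tb (le_trans c0)// ltW.
move=> s /andP[s0 st]; have [sc|cs] := leP s c.
  by have [_] := Sc; apply; rewrite s0.
have := hr s; rewrite (ltW cs) (le_lt_trans st tr) => /(_ isT).
rewrite mul0r subr0 => h.
rewrite -(subrK (H c) (H s)) (le_trans (ler_normD _ _))//.
by rewrite -[in leRHS](subrK c s) mulrDr lerD.
Qed.

(** The tool by which shifted, rescaled and inverted clocks are identified: the speed is only
    right-continuous, so the ordinary derivative may fail to exist. *)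
Lemma right_deriv_unique F G p b : 0 <= b ->
  (forall t, 0 <= t < b -> right_deriv F t (p t) /\ right_deriv G t (p t)) ->
  (forall t, 0 < t <= b -> left_cont F t /\ left_cont G t) ->
  F 0 = G 0 -> F b = G b.
Proof.
move=> b0 dFG lFG FG0.
pose H t := F t - G t.
suff : H b = 0 by move/eqP; rewrite subr_eq0 => /eqP.
apply/eqP; rewrite -normr_eq0 eq_le normr_ge0 andbT.
apply/ler_addgt0Pr => e e0; rewrite add0r.
(* Dividing by [b + 1] instead of [b] covers [b = 0]. *)
have e1 : 0 < e / (b + 1) by rewrite divr_gt0// ltr_wpDl.
apply: (@le_trans _ _ (e / (b + 1) * b)); last first.
  by rewrite mulrAC ler_pdivrMr ?ltr_wpDl// ler_pM2l// lerDl.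
apply: right_deriv_zero_bound => //; last by rewrite /H FG0 subrr.
- move=> t tb r r0; have r2 : 0 < r / 2 by rewrite divr_gt0.
  have [dF dG] := dFG t tb.
  have [x x0 hx] := dF _ r2; have [y y0 hy] := dG _ r2.
  exists (Num.min x y) => [|s]; first by rewrite lt_min x0.
  rewrite -ltrBlDl lt_min !ltrBlDl => /and3P[ts sx sy].
  have := hx s; rewrite ts sx => /(_ isT) h1.
  have := hy s; rewrite ts sy => /(_ isT) h2.
  rewrite mul0r subr0 /H.
  have -> : F s - G s - (F t - G t) =
      (F s - F t - p t * (s - t)) - (G s - G t - p t * (s - t)) by ring.
  rewrite (le_trans (ler_normB _ _))// [leRHS](_ : _ = r / 2 * (s - t) + r / 2 * (s - t)).
    exact: lerD.
  by rewrite -mulrDl -splitr.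
- move=> t tb r r0; have r2 : 0 < r / 2 by rewrite divr_gt0.
  have [dF dG] := lFG t tb.
  have [x x0 hx] := dF _ r2; have [y y0 hy] := dG _ r2.
  exists (Num.min x y) => [|s s0]; first by rewrite lt_min x0.
  rewrite ltrBlDl -ltrBlDr lt_min !ltrBlDr => /andP[/andP[sx sy] st].
  have := hx s s0; rewrite st andbT ltrBlDl => /(_ sx) h1.
  have := hy s s0; rewrite st andbT ltrBlDl => /(_ sy) h2.
  rewrite /H; have -> : F t - G t - (F s - G s) = (F t - F s) - (G t - G s) by ring.
  by rewrite (le_trans (ler_normB _ _))// [leRHS]splitr lerD.
Qed.

End right_derivative.

Section clock_integral.
Variable R : realType.
Local Notation mu := (@lebesgue_measure R).

(** The domain is written as in [clock], so that [clock h w] is convertible with the [Iint] of the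
    inverse speed. *)
Definition Iint (p : R -> R) (t : \bar R) : \bar R :=
  (\int[mu]_(s in [set s : R | (0 <= s)%R /\ s%:E < t]) (p s)%:E)%E.

Lemma Iset_fin (t : R) : [set s : R | 0 <= s /\ (s%:E < t%:E)%E] = `[0, t[%classic.
Proof. by apply/seteqP; split => s /=; rewrite in_itv /= lte_fin => /andP. Qed.

Lemma Iset_oo : [set s : R | 0 <= s /\ (s%:E < +oo)%E] = `[0, +oo[%classic.
Proof.
by apply/seteqP; split => s /=; rewrite in_itv /= andbT ?ltry//; case.
Qed.

Variable p : R -> R.
Hypothesis p0 : forall t, 0 <= t -> 0 <= p t.
Hypothesis mp : measurable_fun (`[(0:R), +oo[%classic : set (measurableTypeR R)) p.

Let mpe : measurable_fun (`[(0:R), +oo[%classic : set (measurableTypeR R)) (EFin \o p).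
Proof. exact/measurable_EFinP. Qed.

Let itvsub (s t : R) : 0 <= s -> `[s, t[%classic `<=` `[0, +oo[%classic.
Proof. by move=> s0 u /=; rewrite !in_itv /= andbT => /andP[su _]; exact: le_trans su. Qed.

Lemma itv_measurable (s t : R) : 0 <= s ->
  measurable_fun (`[s, t[%classic : set (measurableTypeR R)) (EFin \o p).
Proof. by move=> s0; apply: measurable_funS mpe => //; exact: itvsub. Qed.

Lemma Iint_ge0 t : (0 <= Iint p t)%E.
Proof. by apply: integral_ge0 => s [s0 _]; rewrite lee_fin p0. Qed.

Lemma Iint0 : Iint p 0%:E = 0%E.
Proof.
rewrite /Iint Iset_fin (_ : `[0, 0[%classic = set0) ?integral_set0//.
by apply/seteqP; split => s //=; rewrite in_itv /= => /andP[s0]; rewrite ltNge s0.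
Qed.

Lemma Iint_split (s t : R) : 0 <= s -> s <= t ->
  Iint p t%:E = (Iint p s%:E + \int[mu]_(u in `[s, t[) (p u)%:E)%E.
Proof.
move=> s0 st; rewrite /Iint !Iset_fin.
have -> : `[0, t[%classic = `[0, s[%classic `|` `[s, t[%classic.
  apply/seteqP; split => u /=; rewrite !in_itv /=.
    by move=> /andP[u0 ut]; have [us|us] := ltP u s; [left|right]; rewrite ?u0.
  move=> [/andP[u0 us]|/andP[su ut]].
    by rewrite u0 (lt_le_trans us).
  by rewrite ut (le_trans s0).
rewrite ge0_integral_setU//=.
- apply: measurable_funS mpe => //.
  by move=> u [|]; exact: itvsub.
- move=> u h; rewrite lee_fin; apply: p0; move: h => [|] /=; rewrite in_itv /=.
    by case/andP.
  by move=> /andP[su _]; exact: le_trans su.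
- apply/disj_setPS => u [] /=; rewrite !in_itv /= => /andP[_ us] /andP[su _].
  by move: us; rewrite ltNge su.
Qed.

Lemma Iint_mono (s t : R) : 0 <= s -> s <= t -> (Iint p s%:E <= Iint p t%:E)%E.
Proof.
move=> s0 st; rewrite (Iint_split s0 st) leeDl// integral_ge0// => u /=.
by rewrite in_itv /= => /andP[su _]; rewrite lee_fin p0// (le_trans s0).
Qed.

Lemma itv_integral_le (s t K : R) : 0 <= s -> s <= t ->
  (forall u, s <= u < t -> p u <= K) ->
  (\int[mu]_(u in `[s, t[) (p u)%:E <= (K * (t - s))%:E)%E.
Proof.
move=> s0 st pK.
have [->|nst] := eqVneq s t.
  rewrite (_ : `[t, t[%classic = set0) ?integral_set0 ?subrr ?mulr0//.
  by apply/seteqP; split => u //=; rewrite in_itv /= => /andP[tu]; rewrite ltNge tu.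
have stl : s < t by rewrite lt_neqAle nst st.
apply: (@le_trans _ _ (\int[mu]_(u in `[s, t[) (cst K%:E) u)%E).
  apply: ge0_le_integral => //=.
  - move=> u; rewrite in_itv /= => /andP[su _]; rewrite lee_fin p0//.
    exact: le_trans su.
  - exact: itv_measurable.
rewrite integral_cst//= lebesgue_measure_itv/= lte_fin stl.
by rewrite -EFinD -EFinM.
Qed.

Lemma itv_integral_ge (s t m : R) : 0 <= s -> s <= t -> 0 <= m ->
  (forall u, s <= u < t -> m <= p u) ->
  ((m * (t - s))%:E <= \int[mu]_(u in `[s, t[) (p u)%:E)%E.
Proof.
move=> s0 st m0 pK.
have [->|nst] := eqVneq s t.
  rewrite (_ : `[t, t[%classic = set0) ?integral_set0 ?subrr ?mulr0//.
  by apply/seteqP; split => u //=; rewrite in_itv /= => /andP[tu]; rewrite ltNge tu.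
have stl : s < t by rewrite lt_neqAle nst st.
apply: (@le_trans _ _ (\int[mu]_(u in `[s, t[) (cst m%:E) u)%E).
  rewrite integral_cst//= lebesgue_measure_itv/= lte_fin stl.
  by rewrite -EFinD -EFinM.
apply: ge0_le_integral => //=.
exact: itv_measurable.
Qed.

Lemma Iint_oo_gt (r : R) : (r%:E < Iint p +oo)%E ->
  exists n : nat, (r%:E < Iint p n%:R%:E)%E.
Proof.
move=> h; apply: contrapT => /forallNP hn.
have ndF : nondecreasing_seq (fun n : nat => `[0, (n%:R : R)[%classic).
  move=> m n mn; apply/subsetPset => u /=; rewrite !in_itv /= => /andP[-> um].
  by rewrite (lt_le_trans um)// ler_nat.
have cv := @ge0_nondecreasing_set_cvg_integral _ (measurableTypeR R) R
  (fun n : nat => `[0, (n%:R : R)[%classic) (EFin \o p) mu ndF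
  (fun i => measurable_itv _) (fun i => @itv_measurable 0 _ (lexx 0)).
have UF : \bigcup_i `[0, (i%:R : R)[%classic = `[0, +oo[%classic.
  apply/seteqP; split => u /=.
    by move=> [n _ /=]; rewrite !in_itv /= andbT => /andP[].
  rewrite in_itv /= andbT => u0; exists (Num.truncn u).+1 => //=.
  by rewrite in_itv /= u0 truncnS_gt.
have : (Iint p +oo <= r%:E)%E.
  rewrite /Iint Iset_oo -UF.
  have {}cv := cv _.
  rewrite -(cvg_lim _ (cv _))//; last first.
    by move=> i u /=; rewrite in_itv /= => /andP[u0 _]; rewrite lee_fin p0.
  apply: lime_le.
    apply: cvgP; apply: cv.
    by move=> i u /=; rewrite in_itv /= => /andP[u0 _]; rewrite lee_fin p0.
  apply: nearW => n; have /negP := hn n; rewrite -leNgt /Iint Iset_fin; exact.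
by rewrite leNgt h.
Qed.

Lemma Iint_le_oo (t : R) : (Iint p t%:E <= Iint p +oo)%E.
Proof.
rewrite /Iint Iset_oo Iset_fin; apply: ge0_subset_integral => //=.
- by move=> u; rewrite in_itv /= andbT => u0; rewrite lee_fin p0.
- exact: itvsub.
Qed.

End clock_integral.

(* The clock runs at speed [p] as long as [alive], and stops afterwards. *)
Record clock_speed (R : realType) (p : R -> R) (alive : R -> Prop) : Prop := {
  speed_ge0 : forall t, 0 <= t -> 0 <= p t;
  speed_measurable :
    measurable_fun (`[(0:R), +oo[%classic : set (measurableTypeR R)) p;
  speed_down : forall s t, 0 <= s -> s <= t -> alive t -> alive s;
  speed_open : forall t, 0 <= t -> alive t -> exists2 r, 0 < r & alive (t + r);
  speed_pos : forall t, 0 <= t -> alive t -> 0 < p t;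
  speed_dead : forall t, 0 <= t -> ~ alive t -> p t = 0;
  speed_bounded : forall t, 0 <= t -> alive t ->
    exists K, forall s, 0 <= s <= t -> p s <= K;
  speed_right : forall t, 0 <= t -> alive t -> forall e, 0 < e ->
    exists2 r, 0 < r & forall s, t <= s < t + r -> `|p s - p t| <= e
}.

(** * The value of a clock with positive right-continuous speed *)

Section age.
Variables (R : realType) (p : R -> R) (alive : R -> Prop).
Hypothesis cs : clock_speed p alive.
Local Notation mu := (@lebesgue_measure R).

Let p0 := speed_ge0 cs.
Let mp := speed_measurable cs.
Let alive_down := speed_down cs.
Let alive_open := speed_open cs.
Let alive_pos := speed_pos cs.
Let dead_zero := speed_dead cs.
Let alive_bounded := speed_bounded cs.
Let p_right := speed_right cs.

(** Trusted at living times only, where the integral is finite by [clock_fin]; after the death the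
    integral may be infinite and [fine] gives 0. *)
Definition age (q : R -> R) (t : R) : R := fine (Iint q t%:E).
Local Notation z := (age p).

Lemma clock_fin t : 0 <= t -> alive t -> Iint p t%:E \is a fin_num.
Proof.
move=> t0 at_; have [K hK] := alive_bounded t0 at_.
rewrite ge0_fin_numE ?Iint_ge0// /Iint Iset_fin.
apply: le_lt_trans (itv_integral_le p0 mp (lexx 0) t0 _) _; last exact: ltry.
by move=> u /andP[u0 ut]; apply: hK; rewrite u0 ltW.
Qed.

Lemma clock_incr (s t : R) : 0 <= s -> s <= t -> alive t ->
  (z t - z s)%:E = (\int[mu]_(u in `[s, t[) (p u)%:E)%E.
Proof.
move=> s0 st at_; have t0 := le_trans s0 st.
have as_ := alive_down s0 st at_.
rewrite EFinB !fineK ?clock_fin// (Iint_split p0 mp s0 st) addeAC subee ?add0e//.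
exact: clock_fin.
Qed.

Lemma clock_right_deriv t : 0 <= t -> alive t -> right_deriv z t (p t).
Proof.
move=> t0 at_ e e0.
have [r1 r10 hr1] := alive_open t0 at_.
(* The minimum with [p t] keeps the lower bound of the speed nonnegative, as [itv_integral_ge]
   requires. *)
have e1 : 0 < Num.min e (p t) by rewrite lt_min e0 alive_pos.
have [r2 r20 hr2] := p_right t0 at_ e1.
exists (Num.min r1 r2) => [|s]; first by rewrite lt_min r10.
rewrite -ltrBlDl lt_min !ltrBlDl => /and3P[ts sr1 sr2].
have as_ : alive s.
  by apply: alive_down hr1; [exact: le_trans ts|exact: ltW].
have bd u : t <= u < s -> p t - Num.min e (p t) <= p u <= p t + Num.min e (p t).
  move=> /andP[tu us]; have := hr2 u; rewrite tu (lt_trans us sr2) => /(_ isT).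
  by rewrite ler_distl.
have em : Num.min e (p t) <= e by rewrite ge_min lexx.
have mt : Num.min e (p t) <= p t by rewrite ge_min lexx orbT.
have h1 : z s - z t <= (p t + Num.min e (p t)) * (s - t).
  rewrite -lee_fin clock_incr//; apply: itv_integral_le => // u /bd /andP[]//.
have h2 : (p t - Num.min e (p t)) * (s - t) <= z s - z t.
  rewrite -lee_fin clock_incr//; apply: itv_integral_ge => //.
    by rewrite subr_ge0.
  by move=> u /bd /andP[].
have st0 : 0 <= s - t by rewrite subr_ge0.
have h3 : Num.min e (p t) * (s - t) <= e * (s - t) by rewrite ler_wpM2r.
rewrite ler_norml; apply/andP; split; lra.
Qed.

Lemma clock_lipschitz t : 0 <= t -> alive t -> exists2 K, 0 < K &
  forall u v, 0 <= u -> u <= v -> v <= t -> 0 <= z v - z u <= K * (v - u).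
Proof.
move=> t0 at_; have [K hK] := alive_bounded t0 at_.
have K1 : 0 < Num.max 1 K by rewrite lt_max ltr01.
exists (Num.max 1 K) => // u v u0 uv vt.
have av : alive v by exact: alive_down (le_trans u0 uv) vt at_.
apply/andP; split.
  rewrite -lee_fin clock_incr// integral_ge0// => w /=.
  by rewrite in_itv /= => /andP[uw _]; rewrite lee_fin p0// (le_trans u0).
rewrite -lee_fin clock_incr//; apply: itv_integral_le => // w /andP[uw wv].
by rewrite le_max hK ?orbT// (le_trans u0 uw)/= (le_trans _ vt)// ltW.
Qed.

Lemma clock_left_cont t : 0 < t -> (exists2 t', t <= t' & alive t') -> left_cont z t.
Proof.
move=> t0 [t' tt' at'] e e0.
have [K K0 hK] := clock_lipschitz (le_trans (ltW t0) tt') at'.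
exists (e / K) => [|s s0]; first by rewrite divr_gt0.
rewrite ltrBlDl -ltrBlDr ltr_pdivlMr// => /andP[h st].
have /andP[h1 h2] := hK s t s0 st tt'.
by rewrite ger0_norm// (le_trans h2)// ltW// mulrC.
Qed.

Lemma clock_strict s t : 0 <= s -> s < t -> alive t -> z s < z t.
Proof.
move=> s0 st at_; have as_ := alive_down s0 (ltW st) at_.
have ps := alive_pos s0 as_.
have p2 : 0 < p s / 2 by rewrite divr_gt0.
have [r r0 hr] := clock_right_deriv s0 as_ p2.
pose u := Num.min t (s + r / 2).
have su : s < u by rewrite lt_min st ltrDl divr_gt0.
have ur : u < s + r by rewrite gt_min ltrD2l ltr_pdivrMr// ltr_pMr// ltr1n orbT.
have ut : u <= t by rewrite ge_min lexx.
have := hr u; rewrite (ltW su) ur => /(_ isT); rewrite ler_norml => /andP[h _].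
have [K _ hK] := clock_lipschitz (le_trans s0 (ltW st)) at_.
have /andP[h' _] := hK u t (le_trans s0 (ltW su)) ut (lexx t).
have : 0 < p s / 2 * (u - s) by rewrite mulr_gt0// subr_gt0.
lra.
Qed.

Lemma clock0 : z 0 = 0.
Proof. by rewrite /age Iint0. Qed.

Lemma clock_mono_alive s t : 0 <= s -> s <= t -> alive t -> z s <= z t.
Proof.
move=> s0; rewrite le_eqVlt => /orP[/eqP-> //|st] at_; exact/ltW/clock_strict.
Qed.

Lemma clock_inj s t : 0 <= s -> 0 <= t -> alive s -> alive t -> z s = z t -> s = t.
Proof.
move=> s0 t0 as_ at_ zst; have [//|] := eqVneq s t.
rewrite neq_lt => /orP[] h.
  by have := clock_strict s0 h at_; rewrite zst ltxx.
by have := clock_strict t0 h as_; rewrite zst ltxx.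
Qed.

Hypothesis alive0 : alive 0.

(* After its death the clock keeps the value it had just before. *)
Lemma clock_dead (t : R) (r : R) : 0 <= t -> (r%:E < Iint p t%:E)%E ->
  exists2 u, 0 <= u <= t & alive u /\ r < z u.
Proof.
move=> t0 rt.
have [at_|nat_] := pselect (alive t).
  exists t; first by rewrite t0 lexx.
  by split => //; rewrite -lte_fin fineK// clock_fin.
pose S := [set u : R | 0 <= u /\ alive u].
have S0 : S 0 by split.
have ubS : ubound S t.
  move=> u [u0 au]; rewrite leNgt; apply/negP => tu.
  by apply: nat_; exact: alive_down (ltW tu) au.
have hS : has_sup S by split; [exists 0|exists t].
pose c := sup S.
have c0 : 0 <= c by apply: ub_le_sup => //; case: hS.
have ct : c <= t by apply: ge_sup => //; exists 0.
have nac u : c <= u -> ~ alive u.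
  move=> cu au; have u0 := le_trans c0 cu.
  have [d d0 ad] := alive_open u0 au.
  have : S (u + d) by split => //; rewrite addr_ge0// ltW.
  move=> /(ub_le_sup (proj2 hS)); rewrite leNgt; apply/negP.
  by rewrite negbK (le_lt_trans cu)// ltrDl.
have ac u : 0 <= u -> u < c -> alive u.
  move=> u0 uc; have [v [v0 av] uv] := lt_sup_exists hS uc.
  exact: alive_down (ltW uv) av.
have cp : 0 < c.
  rewrite lt_neqAle c0 andbT; apply/negP => /eqP c00.
  by apply: (nac 0) => //; rewrite -c00.
have ztc : Iint p t%:E = Iint p c%:E.
  rewrite (Iint_split p0 mp c0 ct).
  rewrite (@integral0_eq _ _ _ mu `[c, t[%classic) ?adde0// => u /=.
  rewrite in_itv /= => /andP[cu _]; congr EFin; apply: dead_zero; last exact: nac.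
  exact: le_trans cu.
(* The death time [c] is not itself a living time, so the integral up to [c] is reached by monotone
   convergence from living times. *)
have ndF : nondecreasing_seq (fun n : nat => `[0, c - (c * n.+1%:R^-1)[%classic).
  move=> m n mn; apply/subsetPset => u /=; rewrite !in_itv /= => /andP[-> um] /=.
  apply: lt_le_trans um _; rewrite lerD2l lerN2 ler_pM2l//.
  by rewrite lef_pV2 ?posrE// ler_nat.
have UF : \bigcup_n `[0, c - (c * n.+1%:R^-1)[%classic = `[0, c[%classic.
  apply/seteqP; split => u /=.
    move=> [n _ /=]; rewrite !in_itv /= => /andP[-> /= h].
    by rewrite (lt_le_trans h)// gerBl mulr_ge0.
  rewrite in_itv /= => /andP[u0 uc].
  have cu : 0 < (c - u) / c by rewrite divr_gt0// subr_gt0.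
  pose n := Num.truncn ((c - u) / c)^-1.
  exists n => //=; rewrite in_itv /= u0 /=.
  rewrite ltrBrDl -ltrBrDr -ltr_pdivlMl// mulrC.
  rewrite -[ltRHS]invrK ltf_pV2 ?posrE ?invr_gt0//.
  exact: truncnS_gt.
have f0 i x : `[0, c - (c * i.+1%:R^-1)[%classic x -> (0 <= (EFin \o p) x)%E.
  by rewrite /= in_itv /= => /andP[x0 _]; rewrite lee_fin p0.
have cv := @ge0_nondecreasing_set_cvg_integral _ (measurableTypeR R) R
  (fun n : nat => `[0, c - (c * n.+1%:R^-1)[%classic) (EFin \o p) mu ndF
  (fun i => measurable_itv _) (fun i => @itv_measurable _ p mp 0 _ (lexx 0)) f0.
rewrite UF in cv.
apply: contrapT => hno.
have : (Iint p c%:E <= r%:E)%E.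
  rewrite /Iint Iset_fin -(cvg_lim _ cv)//.
  apply: lime_le; first exact: cvgP cv.
  apply: nearW => n.
  have n1 : n.+1%:R^-1 <= 1 :> R by rewrite invf_le1// ler1n.
  have u0 : 0 <= c - c * n.+1%:R^-1 by rewrite subr_ge0 ler_piMr.
  have uc : c - c * n.+1%:R^-1 < c by rewrite gtrBl mulr_gt0.
  have au := ac _ u0 uc.
  rewrite -Iset_fin -/(Iint p _) leNgt; apply/negP => h; apply: hno.
  exists (c - c * n.+1%:R^-1); first by rewrite u0 (le_trans (ltW uc)).
  by split => //; rewrite -lte_fin fineK// clock_fin.
by rewrite leNgt -ztc rt.
Qed.

Lemma clock_oo (r : R) : (r%:E < Iint p +oo)%E ->
  exists2 u, 0 <= u & alive u /\ r < z u.
Proof.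
move=> /(Iint_oo_gt p0 mp)[n hn].
have [u /andP[u0 _] h] := clock_dead (ler0n _ n) hn.
by exists u.
Qed.

Lemma clock_ivt t s : 0 <= t -> alive t -> 0 <= s <= z t ->
  exists2 u, 0 <= u <= t & z u = s.
Proof.
move=> t0 at_ /andP[s0 st].
have [K K0 hK] := clock_lipschitz t0 at_.
have lip u v : 0 <= u <= t -> 0 <= v <= t -> `|z u - z v| <= K * `|u - v|.
  move=> /andP[u0 ut] /andP[v0 vt]; have [uv|vu] := leP u v.
    have /andP[h1 h2] := hK u v u0 uv vt.
    have /ger0_norm : 0 <= v - u by rewrite subr_ge0.
    by move=> huv; rewrite (distrC (z u)) (distrC u) huv (ger0_norm h1).
  have /andP[h1 h2] := hK v u v0 (ltW vu) ut.
  have /ger0_norm -> : 0 <= u - v by rewrite subr_ge0 ltW.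
  by rewrite (ger0_norm h1).
have cz : {within `[0, t], continuous z}.
  apply/subspace_continuousP => u /=; rewrite in_itv /= => ut.
  apply/cvgrPdist_le => e e0; near=> v.
  have vt : 0 <= v <= t.
    by near: v; apply: filterS (@withinT _ _ _ _) => v /=; rewrite in_itv.
  rewrite (le_trans (lip u v ut vt))// -ler_pdivlMl//.
  near: v; exists (K^-1 * e) => /=; first by rewrite mulr_gt0 ?invr_gt0.
  by move=> v /= /ltW.
have := @IVT R z 0 t s t0 cz.
rewrite (@clock0) ge_min s0 le_max st orbT => /(_ isT)[u].
by rewrite in_itv /= => ut zu; exists u.
Unshelve. all: by end_near.
Qed.

End age.

(** * Measurable functionals of regular paths *)

Section grid.
Variable R : realType.

(** The first multiple of 1/(n+1) strictly after [u]: approximation from the right is what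
    right-continuity controls. *)
Definition grid (n : nat) (u : R) : R := (Num.truncn (u * n.+1%:R)).+1%:R / n.+1%:R.

Lemma grid_bounds n u : 0 <= u -> u < grid n u <= u + n.+1%:R^-1.
Proof.
move=> u0; have u1 : 0 <= u * n.+1%:R by rewrite mulr_ge0.
rewrite /grid ltr_pdivlMr// truncnS_gt/=.
by rewrite ler_pdivrMr// mulrDl mulVf ?pnatr_eq0// -natr1 lerD2r truncn_le.
Qed.

Context (d : measure_display) (T : measurableType d).

(** Progressive measurability. The approximations are constant in time on each cell of the grid,
    hence jointly measurable, and converge by right-continuity; the minimum with [t] prevents them
    from looking beyond [t]. *)
Lemma grid_measurable (D : set T) (F : T -> R -> R) (t : R) : 0 <= t -> measurable D ->
  (forall s, 0 <= s <= t -> measurable_fun setT (F^~ s)) ->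
  (forall w u, D w -> 0 <= u <= t -> forall e, 0 < e ->
    exists2 r, 0 < r & forall s, u <= s < u + r -> `|F w s - F w u| <= e) ->
  measurable_fun (D `*` (`[0, t]%classic : set (measurableTypeR R)))
    (fun p => F p.1 p.2).
Proof.
move=> t0 mD mF rF.
apply: (@measurable_fun_cvg _ (T * measurableTypeR R)%type R _
  (fun n p => F p.1 (Num.min t (grid n p.2)))).
  move=> n.
  pose C k : set (T * measurableTypeR R) :=
    setT `*` (`[k%:R / n.+1%:R, k.+1%:R / n.+1%:R[%classic : set (measurableTypeR R)).
  have mC k : measurable (C k) by apply: measurableX => //; exact: measurable_itv.
  apply: (@measurable_funS _ _ _ _ (\bigcup_k C k)).
  - exact: bigcup_measurable.
  - move=> [w u] /= [_]; rewrite in_itv /= => /andP[u0 ut].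
    exists (Num.truncn (u * n.+1%:R)) => //; split => //=.
    rewrite in_itv /= ler_pdivrMr// ltr_pdivlMr//.
    by rewrite truncnS_gt truncn_le ?mulr_ge0.
  - apply/measurable_fun_bigcup => // k.
    pose s : R := Num.min t (k.+1%:R / n.+1%:R).
    apply: (@eq_measurable_fun _ _ _ _ _ (fun p => F p.1 s)).
      move=> [w u]; rewrite inE => -[_ /=]; rewrite in_itv /= => /andP[ku uk].
      congr (F w (Num.min t _)); rewrite /grid; congr (_.+1%:R / _).
      apply/esym/truncn_def; rewrite -ler_pdivrMr// ku/=.
      by rewrite -ltr_pdivlMr.
    apply: measurable_funTS; apply: (measurableT_comp (mF s _)) => //.
      by rewrite le_min t0 ge_min lexx divr_ge0.
move=> [w u] [/= Dw]; rewrite in_itv /= => ut.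
apply/cvgrPdist_le => e e0; have [r r0 hr] := rF w u Dw ut e e0.
have /andP[u0 ut'] := ut.
exists (Num.truncn r^-1) => // n /= hn.
rewrite distrC; have /andP[g1 g2] := @grid_bounds n u u0.
apply: hr; rewrite le_min ut' (ltW g1)/= gt_min; apply/orP; right.
apply: (le_lt_trans g2); rewrite ltrD2l -[ltRHS]invrK ltf_pV2 ?posrE ?invr_gt0//.
by rewrite (lt_le_trans (truncnS_gt _))// ler_nat.
Qed.

End grid.

(** The deterministic case of [grid_measurable], over the one-point space [unit]. *)
Lemma right_cont_measurable (R : realType) (p : R -> R) :
  (forall u, 0 <= u -> forall e, 0 < e ->
    exists2 r, 0 < r & forall s, u <= s < u + r -> `|p s - p u| <= e) ->
  measurable_fun (`[(0:R), +oo[%classic : set (measurableTypeR R)) p.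
Proof.
move=> rp.
apply: (@measurable_funS _ _ _ _ (\bigcup_n (`[(0 : R), n%:R]%classic : set (measurableTypeR R)))).
- by apply: bigcup_measurable => n _; exact: measurable_itv.
- move=> u /=; rewrite in_itv /= andbT => u0; exists (Num.truncn u).+1 => //=.
  by rewrite in_itv /= u0 ltW// truncnS_gt.
apply/measurable_fun_bigcup => [n|n]; first exact: measurable_itv.
have h := @grid_measurable R _ unit setT (fun _ => p) n%:R (ler0n _ _) measurableT
  (fun s _ => measurable_cst _) (fun w u _ h => rp u (proj1 (andP h))).
have := @measurable_comp _ _ _ _ _ _ _ (fun q : unit * measurableTypeR R => p q.2)
  (`[(0:R), n%:R]%classic : set (measurableTypeR R)) (pair tt) _ _ h.
apply.
- by apply: measurableX => //; exact: measurable_itv.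
- by move=> _ [u hu <-]; split.
- by apply: measurable_funTS; exact: pair1_measurable.
Qed.

Section regular_paths.
Variables (R : realType) (M : metricType R).
Local Notation E := (cemetery_ext M).
Implicit Types w : R -> E.

(** The value 0 at the cemetery makes a clock of speed [extend0 phi] stop at death. *)
Definition extend0 (phi : M -> R) (x : E) : R := if x is Some y then phi y else 0.

(** Confinement in a compact set up to each living time says at once that the cemetery is absorbing
    ([regular_down]) and that continuous functions are bounded along the path before its death. *)
Definition regular w := right_cont w /\
  forall t : R, 0 <= t -> w t <> None ->
    exists2 K, compact K & forall s, 0 <= s <= t -> live K (w s).

Lemma regular_down w s t : regular w -> 0 <= s -> s <= t -> w t <> None -> w s <> None.
Proof.
move=> [_ h] s0 st wt; have [K _ hK] := h t (le_trans s0 st) wt.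
by have := hK s; rewrite s0 st => /(_ isT); case: (w s).
Qed.

Lemma regular_right_nbhs w t (B : set E) : regular w -> 0 <= t -> nbhs (w t) B ->
  exists2 r : R, 0 < r & forall s, t <= s < t + r -> B (w s).
Proof.
move=> [rw _] t0 hB; have /= [r r0 hr] := rw t t0 B hB.
exists r => // s /andP[]; rewrite le_eqVlt => /orP[/eqP <- _|ts str].
  exact: nbhs_singleton.
apply: hr => //=; rewrite distrC ger0_norm ?subr_ge0 ?ltW//.
by rewrite ltrBlDl.
Qed.

Lemma extend0_cvg phi (x : E) (e : R) : continuous phi -> x <> None -> 0 < e ->
  nbhs x [set z | z <> None /\ `|extend0 phi z - extend0 phi x| <= e].
Proof.
case: x => // x cphi _ e0.
have : nbhs x [set z | `|phi z - phi x| <= e].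
  have := cphi x => /cvgrPdist_le/(_ e e0); apply: filterS => z.
  by rewrite distrC.
move=> /one_point_compactification_some_nbhs; apply: filterS => _ [z hz <-]; by split.
Qed.

Lemma regular_extend0_right phi w t : continuous phi -> regular w -> 0 <= t ->
  forall e : R, 0 < e ->
  exists2 r, 0 < r & forall s, t <= s < t + r -> `|extend0 phi (w s) - extend0 phi (w t)| <= e.
Proof.
move=> cphi rw t0 e e0; have [wt|wt] := pselect (w t = None).
  exists 1 => // s /andP[ts _]; have [->|ws] := pselect (w s = None).
    by rewrite wt subrr normr0 ltW.
  by have := regular_down rw t0 ts ws.
have [r r0 hr] := regular_right_nbhs rw t0 (extend0_cvg cphi wt e0).
by exists r => // s /hr[].
Qed.

Lemma regular_alive_right w t : regular w -> 0 <= t -> w t <> None ->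
  exists2 r, 0 < r & w (t + r) <> None.
Proof.
move=> rw t0 wt; have c0 : continuous (fun _ : M => 0 : R) by move=> ?; exact: cvg_cst.
have [r r0 hr] := regular_right_nbhs rw t0 (extend0_cvg c0 wt ltr01).
exists (r / 2); first by rewrite divr_gt0.
have := hr (t + r / 2); rewrite lerDl divr_ge0 ?ltW//= => h.
by apply: (proj1 (h _)); rewrite ltrD2l ltr_pdivrMr// ltr_pMr// ltr1n.
Qed.

Lemma regular_bounded phi w t : continuous phi -> regular w -> 0 <= t -> w t <> None ->
  exists K, forall s, 0 <= s <= t -> extend0 phi (w s) <= K.
Proof.
move=> cphi [_ rw] t0 wt; have [K cK hK] := rw t t0 wt.
have cI : compact (phi @` K).
  by apply: continuous_compact => //; apply: continuous_subspaceT => x; exact: cphi.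
have [B [_ hB]] := compact_bounded cI.
exists (B + 1) => s st; have := hK s st; case: (w s) => //= x Kx.
rewrite (le_trans (ler_norm _))//; apply: (hB (B + 1)); first by rewrite ltrDl.
by exists x.
Qed.

(* The integral of a path is a measurable functional of right-continuous paths only,
   and those do not form an event: the sigma-algebras are enlarged by all the sets
   which agree with one of their events on the regular paths. *)
Definition trace (H : set (set (R -> E))) : set (set (R -> E)) :=
  [set C | exists2 C0, H C0 & forall w, regular w -> (C w <-> C0 w)].

Lemma trace_algebra H : sigma_algebra setT H -> sigma_algebra setT (trace H).
Proof.
move=> [H0 HC HU]; split.
- by exists set0.
- move=> C [C0 h hC]; exists (setT `\` C0); first exact: HC.
  move=> w rw; split => -[_ nC]; split => //; by move=> /(hC w rw).
- move=> F hF; have /choice[G hG] : forall n, exists C0, H C0 /\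
    forall w, regular w -> (F n w <-> C0 w).
    by move=> n; have [C0 h1 h2] := hF n; exists C0.
  exists (\bigcup_n G n); first by apply: HU => n; case: (hG n).
  by move=> w rw; split => -[n _ h]; exists n => //; apply/((hG n).2 w rw).
Qed.

Definition coord_sigma (J : set R) : set (set (R -> E)) :=
  <<s [set C | exists (t : R) (B : set E),
         [/\ J t, borel B & C = [set w : R -> E | B (w t)]]] >>.

Definition rpast (t : R) := trace (coord_sigma [set s | 0 <= s <= t]).
Definition rpath := trace (@path_sigma R E).

Lemma rpast_algebra t : sigma_algebra setT (rpast t).
Proof. exact/trace_algebra/g_sigma. Qed.

Lemma rpath_algebra : sigma_algebra setT rpath.
Proof. exact/trace_algebra/g_sigma. Qed.

Lemma trace_sub H H' : H `<=` H' -> trace H `<=` trace H'.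
Proof. by move=> HH C [C0 /HH h hC]; exists C0. Qed.

Lemma coord_sigma_sub J J' : J `<=` J' -> coord_sigma J `<=` coord_sigma J'.
Proof.
move=> JJ; apply: g_sigma_sub => _ [t [B [/JJ Jt bB ->]]].
by apply: sub_sigma_algebra; exists t, B.
Qed.

Lemma rpast_mono s t : s <= t -> rpast s `<=` rpast t.
Proof.
move=> st; apply: trace_sub; apply: coord_sigma_sub => u /= /andP[-> us] /=.
exact: le_trans st.
Qed.

Lemma rpast_rpath t : rpast t `<=` rpath.
Proof.
by apply: trace_sub; apply: (@coord_sigma_sub _ [set s | 0 <= s]) => u /= /andP[].
Qed.

Lemma coord_rpast s t (B : set E) : 0 <= s <= t -> borel B ->
  rpast t [set w | B (w s)].
Proof.
by move=> st bB; exists [set w | B (w s)] => //; apply: sub_sigma_algebra; exists s, B.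
Qed.

Section pathwise.
Variable t : R.
(** Path space becomes a measurable space, so that Tonelli's theorem applies on its product with a
    time interval. *)
Local Notation paths := (g_sigma_algebraType (rpast t)).

Lemma rpast_measurable (C : set (R -> E)) : @measurable _ paths C <-> rpast t C.
Proof.
have /(@sigma_algebra_id _ setT) h := rpast_algebra t.
by split => [|hC]; rewrite /measurable /= h.
Qed.

Lemma extend0_coord_measurable phi s : continuous phi -> 0 <= s <= t ->
  measurable_fun setT (fun w : paths => extend0 phi (w s)).
Proof.
move=> cphi st; apply: (measurability _ (RGenOInfty.measurableE R)).
move=> _ [_ [x ->] <-]; rewrite setTI.
have op : open [set y | x < phi y].
  by apply: (@open_comp _ _ phi [set r | x < r]) => // y _; exact: cphi.
have [_ hC hU] := g_sigma (@open E).
pose B : set E := live [set y | x < phi y] `|`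
  (if x < 0 then setT `\` live setT else set0).
rewrite (_ : _ @^-1` _ = [set w : paths | B (w s)]).
  apply/rpast_measurable/coord_rpast => //.
  rewrite /B -bigcup2E; apply: hU => -[|[|n]] /=.
  - exact: open_opc_live.
  - case: ifP => _; last by case: (g_sigma (@open E)).
    by apply: hC; exact: (open_opc_live openT).
  - by case: (g_sigma (@open E)).
apply/seteqP; split => w; rewrite /B /= in_itv /= andbT; case: (w s) => [y|] /=.
- by left.
- by move=> ->; right; split.
- by case=> //; case: ifP => // _ [_ []].
- by case=> //; case: ifP.
Qed.

Definition regulars : set paths := [set w | regular w].

Lemma regulars_measurable : measurable regulars.
Proof.
apply/rpast_measurable; exists setT; last by [].
have [h0 hC _] := g_sigma [set C : set (R -> E) | exists (s : R) (B : set E),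
         [/\ 0 <= s <= t, borel B & C = [set w : R -> E | B (w s)]]].
by rewrite -(setD0 setT); exact: hC.
Qed.

Hypothesis t0 : 0 <= t.

Lemma extend0_joint_measurable phi : continuous phi ->
  measurable_fun (regulars `*` (`[0, t]%classic : set (measurableTypeR R)))
    (fun p => extend0 phi (p.1 p.2)).
Proof.
move=> cphi; apply: (@grid_measurable R _ paths regulars (fun w s => extend0 phi (w s)) t) => //.
- exact: regulars_measurable.
- by move=> s st; exact: extend0_coord_measurable.
- by move=> w u rw /andP[u0 ut] e e0; exact: regular_extend0_right.
Qed.

(** By Tonelli's theorem, applied to the speed restricted to regular paths, where it is jointly
    measurable. The restriction is harmless since [rpast] identifies sets that agree on regular
    paths. *)
Lemma Iint_rpast (phi : M -> R) (B : set (\bar R)) : continuous phi -> (forall x, 0 <= phi x) ->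
  measurable B -> rpast t [set w : R -> E | B (Iint (extend0 phi \o w) t%:E)].
Proof.
move=> cphi p0 mB.
pose D := regulars `*` (`[0, t[%classic : set (measurableTypeR R)).
have mD : measurable D.
  by apply: measurableX; [exact: regulars_measurable|exact: measurable_itv].
pose f := (fun p : paths * measurableTypeR R => (extend0 phi (p.1 p.2))%:E) \_ D.
have mf : measurable_fun setT f.
  apply/(measurable_restrictT _ mD)/measurable_EFinP.
  apply: measurable_funS (extend0_joint_measurable cphi).
    by apply: measurableX; [exact: regulars_measurable|exact: measurable_itv].
  move=> [w u] [/= rw]; rewrite !in_itv /= => /andP[u0 ut].
  by split => //=; rewrite u0 ltW.
have f0 p : (0 <= f p)%E.
  rewrite /f patchE; case: ifP => // _; rewrite lee_fin /extend0.
  by case: (p.1 p.2).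
have := measurable_fun_fubini_tonelli_F (m2 := lebesgue_measure) f mf f0.
move=> /(_ measurableT B mB); rewrite setTI => /rpast_measurable[C0 hC0 h].
exists C0 => // w rw; rewrite -h//= /fubini_F /Iint.
rewrite (_ : (\int[_]_y f (w, y))%E =
    (\int[lebesgue_measure]_(s in `[0%R, t[) (extend0 phi (w s))%:E)%E).
  by rewrite Iset_fin.
rewrite [RHS]integral_mkcond; apply: eq_integral => u _.
rewrite /f !patchE /D; congr (if _ then _ else _).
by apply/idP/idP; rewrite !inE => // -[].
Qed.

End pathwise.

End regular_paths.

(** * The age of a path and its inverse *)

Section path_clock.
Variables (R : realType) (M : metricType R).
Local Notation E := (cemetery_ext M).
Implicit Types w : R -> E.
Variable c : M -> R.
Hypotheses (cc : continuous c) (c_gt0 : forall x, 0 < c x).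

Local Notation rate w := (extend0 c \o w).

Lemma regular_speed w : regular w -> clock_speed (rate w) (fun t => w t <> None).
Proof.
move=> rw; split.
- by move=> t _ /=; case: (w t) => //= x; exact: ltW.
- by apply: right_cont_measurable => u u0 e e0; exact: regular_extend0_right.
- by move=> s t; exact: regular_down.
- by move=> t; exact: regular_alive_right.
- by move=> t _ /=; case: (w t) => // x _; exact: c_gt0.
- by move=> t _ /=; case: (w t) => // x; case.
- by move=> t; exact: regular_bounded.
- by move=> t t0 _ e e0; exact: regular_extend0_right.
Qed.

(** On a regular path at most one living time has age [s], and the infimum selects it; it is [+oo]
    when the age never reaches [s]. *)
Definition tau w (s : R) : \bar R := ereal_inf
  [set t%:E | t in [set t : R | [/\ 0 <= t, w t <> None & age (rate w) t = s]]].

Lemma tau_age w t : regular w -> 0 <= t -> w t <> None ->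
  tau w (age (rate w) t) = t%:E.
Proof.
move=> rw t0 wt; rewrite /tau (_ : [set _ | _ in _] = [set t%:E]) ?ereal_inf1//.
apply/seteqP; split => [_ [u [u0 wu ut] <-]|_ ->]; last by exists t.
by congr EFin; apply: (clock_inj (regular_speed rw)).
Qed.

Lemma tau_ge0 w s : (0 <= tau w s)%E.
Proof. by apply: le_ereal_inf_tmp => _ [t [t0 _ _] <-]; rewrite lee_fin. Qed.

Lemma tau_fin w s : regular w -> (tau w s < +oo)%E ->
  exists t, [/\ 0 <= t, w t <> None, age (rate w) t = s & tau w s = t%:E].
Proof.
move=> rw h; apply: contrapT => hn; move: h; rewrite /tau.
rewrite (_ : [set _ | _ in _] = set0) ?ereal_inf0 ?ltxx//.
apply/seteqP; split => // _ [t [t0 wt ts] <-]; apply: hn.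
by exists t; split => //; rewrite -ts tau_age.
Qed.

Lemma age_alive w t : regular w -> 0 <= t -> w t <> None ->
  Iint (rate w) t%:E = (age (rate w) t)%:E.
Proof.
by move=> rw t0 wt; rewrite /age fineK//; exact: (clock_fin (regular_speed rw)).
Qed.

Lemma Iint_gt_alive0 w x (s : R) : regular w -> 0 <= s -> (s%:E < Iint (rate w) x)%E ->
  w 0 <> None.
Proof.
move=> rw s0 h w0; move: h; rewrite /Iint integral0_eq ?lte_fin ?ltNge ?s0//.
move=> u [u0 _] /=; have [->//|wu] := pselect (w u = None).
by have := regular_down rw (lexx 0) u0 wu.
Qed.

Lemma age_reaches w s t : regular w -> 0 <= s -> 0 <= t ->
  (s%:E < Iint (rate w) t%:E)%E ->
  exists u, [/\ 0 <= u <= t, w u <> None & age (rate w) u = s].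
Proof.
move=> rw s0 t0 st; have cs := regular_speed rw.
have [v /andP[v0 vt] [wv sv]] := clock_dead cs (Iint_gt_alive0 rw s0 st) t0 st.
have sv' : 0 <= s <= age (rate w) v by rewrite s0 ltW.
have [u /andP[u0 uv] us] := clock_ivt cs v0 wv sv'.
exists u; split => //; first by rewrite u0 (le_trans uv).
exact: regular_down wv.
Qed.

(** This shows that [tau] is a stopping time: the right-hand side depends on the path up to [t]
    only. In the case of equality life at [t] is required, because a clock stopped by death with
    total age exactly [s] has no living time of age [s]. *)
Lemma tau_le w s t : regular w -> 0 <= s -> 0 <= t ->
  (tau w s <= t%:E)%E <-> (s%:E < Iint (rate w) t%:E)%E \/
                          (Iint (rate w) t%:E = s%:E /\ w t <> None).
Proof.
move=> rw s0 t0; have cs := regular_speed rw; split.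
  move=> h; have [u [u0 wu us tu]] := tau_fin rw (le_lt_trans h (ltry _)).
  move: h; rewrite tu lee_fin le_eqVlt => /orP[/eqP <-|ut].
    by right; rewrite age_alive// us.
  left; have [r r0 wr] := regular_alive_right rw u0 wu.
  pose v := Num.min t (u + r).
  have uv : u < v by rewrite lt_min ut ltrDl.
  have v0 : 0 <= v by rewrite (le_trans u0)// ltW.
  have wv : w v <> None by apply: regular_down wr => //; rewrite ge_min lexx orbT.
  apply: (@lt_le_trans _ _ (Iint (rate w) v%:E)).
    by rewrite age_alive// lte_fin -us; apply: (clock_strict cs).
  apply: Iint_mono => //; first exact: speed_ge0 cs.
    exact: speed_measurable cs.
  by rewrite ge_min lexx.
case=> [h|[h wt]].
  have [u [/andP[u0 ut] wu us]] := age_reaches rw s0 t0 h.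
  by rewrite -us tau_age// lee_fin.
have -> : s = age (rate w) t by apply: EFin_inj; rewrite -age_alive.
by rewrite tau_age.
Qed.

Lemma trace_ext H (C C' : set (R -> E)) : (forall w, regular w -> (C w <-> C' w)) ->
  trace H C -> trace H C'.
Proof.
move=> CC [C0 hC0 h]; exists C0 => // w rw.
exact: iff_trans (iff_sym (CC w rw)) (h w rw).
Qed.

Lemma sigma_algebraUI (U : Type) (G : set (set U)) A B : sigma_algebra setT G ->
  G A -> G B -> G (A `|` B) /\ G (A `&` B).
Proof.
move=> [G0 GC GU] GA GB.
have hU C D : G C -> G D -> G (C `|` D).
  by move=> GC' GD; rewrite -bigcup2E; apply: GU => -[|[|n]].
split; first exact: hU.
rewrite -(setCK (A `&` B)) setCI -setTD; apply: (GC).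
by apply: hU; rewrite -setTD; exact: (GC).
Qed.

Lemma live_rpast s t (B : set M) : 0 <= s <= t -> borel B ->
  rpast t [set w | live B (w s)].
Proof. by move=> st bB; apply: coord_rpast => //; exact: borel_live. Qed.

Lemma tau_rpast s t : 0 <= s -> 0 <= t -> rpast t [set w : R -> E | (tau w s <= t%:E)%E].
Proof.
move=> s0 t0.
have aA : rpast t [set w : R -> E | live setT (w t)].
  by apply: live_rpast; [rewrite t0 lexx|apply: sub_sigma_algebra; exact: openT].
have c0 x : 0 <= c x by exact: ltW.
have m1 : measurable [set x : \bar R | (s%:E < x)%E].
  rewrite (_ : [set x | _] = [set` `]s%:E, +oo[]); first exact: emeasurable_itv.
  by apply/seteqP; split => x /=; rewrite in_itv /= andbT.
have h1 := Iint_rpast t0 cc c0 m1.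
have h2 := Iint_rpast t0 cc c0 (emeasurable_set1 s%:E).
have [_ h3] := sigma_algebraUI (rpast_algebra M t) h2 aA.
have [h4 _] := sigma_algebraUI (rpast_algebra M t) h1 h3.
apply: trace_ext h4 => w rw; apply: (iff_trans _ (iff_sym (tau_le rw s0 t0))).
split=> -[?|[? h]]; [by left|right; split => //|by left|right; split => //].
  by move: h => /=; case: (w t).
by move: h => /=; case: (w t).
Qed.

(** The position at [tau] is known at [tau]. For an open set the event is the positivity of
    [dist_out] at that position, a jointly measurable function of path and time evaluated at a
    measurable time; Borel sets follow by induction. *)
Lemma tau_live_rpast s t (B : set M) : 0 <= s -> 0 <= t -> borel B ->
  rpast t [set w : R -> E | (tau w s <= t%:E)%E /\ live B (w (fine (tau w s)))].
Proof.
move=> s0 t0 bB.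
pose F (B : set M) : set (R -> E) :=
  [set w : R -> E | (tau w s <= t%:E)%E /\ live B (w (fine (tau w s)))].
pose H := [set B : set M | rpast t (F B)].
have [r0 rC rU] := rpast_algebra M t.
have tr := tau_rpast s0 t0.
suff : H B by [].
apply: (@smallest_sub _ _ _ H _ _ B bB); first split.
- rewrite /H /= (_ : F set0 = set0)//; apply/seteqP; split => // w [_].
  by case: (w _).
- move=> A HA; rewrite /H /=.
  have [_] := sigma_algebraUI (rpast_algebra M t) tr (rC _ HA); apply: trace_ext.
  move=> w rw; split => [[/= ht [_ nh]]|[ht]].
    split => //; have [u [u0 wu us tu]] := tau_fin rw (le_lt_trans ht (ltry _)).
    move: nh; rewrite /F /= tu /=; case: (w u) wu => // x _ nA; split => // Ax.
    by apply: nA; rewrite -tu.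
  move=> hA; split => //; split => // -[_]; move: hA.
  by case: (w _) => // x [_ nA].
- move=> G HG; rewrite /H /= (_ : F _ = \bigcup_k F (G k)); first exact: rU.
  apply/seteqP; split => w; rewrite /F /=.
    move=> [ht]; case e : (w (fine _)) => [x|//] [k _ Gx].
    by exists k => //=; rewrite e.
  move=> [k _ [ht]]; case: (w _) => // x Gx; split => //; by exists k.
- move=> Q oQ; rewrite /H /=.
  (* The default value [t] keeps the time in [0, t], where joint measurability is known. *)
  pose sig (w : g_sigma_algebraType (rpast (M := M) t)) : measurableTypeR R :=
    if (tau w s <= t%:E)%E then fine (tau w s) else t.
  have tau_num w x : (tau w s <= x%:E)%E -> (fine (tau w s))%:E = tau w s.
    by move=> h; rewrite fineK// ge0_fin_numE ?tau_ge0// (le_lt_trans h) ?ltry.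
  have sig_in w : 0 <= sig w <= t.
    rewrite /sig; case: ifPn => [h|_]; last by rewrite t0 lexx.
    by rewrite -!lee_fin (tau_num _ _ h) tau_ge0.
  have msig : measurable_fun setT sig.
    apply: (measurability _ (RGenOInfty.measurableE R)).
    move=> _ [_ [x ->] <-]; rewrite setTI.
    rewrite (_ : _ @^-1` _ = ~` [set w | sig w <= x]); last first.
      by apply/seteqP; split => w /=; rewrite in_itv /= andbT ltNge => /negP.
    apply: measurableC; apply/rpast_measurable.
    have [xt|tx] := ltP x t; last first.
      rewrite (_ : [set w | _] = setT); first by rewrite -setC0 -setTD; exact: rC.
      apply/seteqP; split => // w _ /=; have /andP[_ h] := sig_in w.
      exact: le_trans h tx.
    have [x0|x0] := ltP x 0.
      rewrite (_ : [set w | _] = set0); first exact: r0.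
      apply/seteqP; split => // w /=; have /andP[h _] := sig_in w.
      by move=> /(le_trans h); rewrite leNgt x0.
    have := rpast_mono (ltW xt) (tau_rpast s0 x0); apply: trace_ext => w _ /=.
    rewrite /sig; split=> [h|].
      have e : fine (tau w s) <= x by rewrite -lee_fin (tau_num _ _ h).
      have ht : (tau w s <= t%:E)%E by rewrite (le_trans h)// lee_fin ltW.
      by rewrite ht; exact: e.
    case: ifPn => [h e|_ e].
      by rewrite -(tau_num _ _ h) lee_fin; exact: e.
    by have := lt_le_trans xt e; rewrite ltxx.
  have mj := extend0_joint_measurable t0 (@continuous_dist_out R M Q).
  have mpair := measurable_fun_pair (@measurable_id _ _ setT) msig.
  have mc := @measurable_comp _ _ _ _ _ _ _ _ (regulars (M := M) (t := t)) _ _ _ mj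
     (measurable_funTS mpair).
  have m0 : measurable [set x : R | 0 < x].
    rewrite (_ : [set x | _] = `]0, +oo[%classic); first exact: measurable_itv.
    by apply/seteqP; split => x /=; rewrite in_itv /= andbT.
  have /rpast_measurable h : @measurable _ (g_sigma_algebraType (rpast (M := M) t))
      (regulars (M := M) (t := t) `&` [set w | 0 < extend0 (dist_out Q) (w (sig w))]).
    apply: mc m0.
    - by apply: measurableX; [exact: regulars_measurable|exact: measurable_itv].
    - by move=> _ [w rw <-]; split => //=; rewrite in_itv /=; exact: sig_in.
    - exact: regulars_measurable.
  have [_] := sigma_algebraUI (rpast_algebra M t) tr h.
  apply: trace_ext => w rw; rewrite /F /= /sig; split => [[ht [_]]|[ht]].
    rewrite ht => h0; split => //; move: h0; case: (w _) => [x|] /=; last by rewrite ltxx.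
    by rewrite dist_out_gt0// inE.
  rewrite ht; case: (w _) => // x Qx; split => //; split => //=.
  by rewrite dist_out_gt0// inE.
Qed.

Definition good w := Iint (rate w) +oo = +oo%E.

Lemma good_rpath : rpath [set w : R -> E | good w].
Proof.
have [r0 rC rU] := @rpath_algebra R M.
have c0 x : 0 <= c x by exact: ltW.
pose G m : set (R -> E) :=
  \bigcup_n [set w : R -> E | (m%:R%:E < Iint (rate w) n%:R%:E)%E].
have hG m : rpath (G m).
  apply: rU => n; apply: (@rpast_rpath R M n%:R).
  apply: (@Iint_rpast _ _ _ (ler0n _ n) c [set x : \bar R | (m%:R%:E < x)%E]) => //.
  rewrite (_ : [set x | _] = [set` `]m%:R%:E, +oo[]); first exact: emeasurable_itv.
  by apply/seteqP; split => x /=; rewrite in_itv /= andbT.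
have := rC _ (rU _ (fun m => rC _ (hG m))); apply: trace_ext => w rw.
have cs := regular_speed rw; split=> [[_ /= h]|gw].
  apply/eqyP => r r_gt0; rewrite ltW//.
  have : G (Num.truncn r).+1 w by apply: contrapT => nG; apply: h; exists (Num.truncn r).+1.
  move=> [n _ /= hn]; apply: (@lt_le_trans _ _ (Iint (rate w) n%:R%:E)); last first.
    by apply: Iint_le_oo; [exact: speed_ge0 cs|exact: speed_measurable cs].
  by apply: lt_trans hn; rewrite lte_fin truncnS_gt.
split => //= -[m _ [_ /= nG]]; apply: nG.
have [|n hn] := @Iint_oo_gt _ _ (speed_ge0 cs) (speed_measurable cs) m%:R.
  by rewrite gw ltry.
by exists n.
Qed.

Lemma good_exceeds w : regular w ->
  (forall r : R, exists t, [/\ 0 <= t, w t <> None & r <= age (rate w) t]) -> good w.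
Proof.
move=> rw h; have cs := regular_speed rw.
apply/eqyP => r r0; have [t [t0 wt rt]] := h r.
apply: (@le_trans _ _ (Iint (rate w) t%:E)); first by rewrite age_alive// lee_fin.
by apply: Iint_le_oo; [exact: speed_ge0 cs|exact: speed_measurable cs].
Qed.

(* The inverse of the age; meaningful on good paths. *)
Definition inv_age w (s : R) : R := fine (tau w s).

Section good_path.
Variable w : R -> E.
Hypotheses (rw : regular w) (gw : good w).
Local Notation th := (inv_age w).
Local Notation z := (age (rate w)).

Lemma good_start : w 0 <> None.
Proof. by apply: (@Iint_gt_alive0 w +oo%E 0 rw (lexx _)); rewrite gw ltry. Qed.

Lemma inv_age_spec s : 0 <= s ->
  [/\ 0 <= th s, w (th s) <> None, z (th s) = s & tau w s = (th s)%:E].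
Proof.
move=> s0; have cs := regular_speed rw.
have [|v v0 [wv sv]] := @clock_oo _ _ _ cs good_start s; first by rewrite gw ltry.
have [|u [/andP[u0 uv] wu us]] := @age_reaches w s v rw s0 v0.
  by rewrite age_alive// lte_fin.
have e : tau w s = u%:E by rewrite -us tau_age.
by rewrite /inv_age e.
Qed.

Lemma inv_ageK t : 0 <= t -> w t <> None -> th (z t) = t.
Proof. by move=> t0 wt; rewrite /inv_age tau_age. Qed.

Lemma age_ge0 t : 0 <= t -> 0 <= z t.
Proof.
by move=> t0; apply/fine_ge0/Iint_ge0 => u u0; exact: speed_ge0 (regular_speed rw) u u0.
Qed.

Lemma inv_age0 : th 0 = 0.
Proof.
have z0 : z 0 = 0 by rewrite /age Iint0.
by rewrite -[in LHS]z0 inv_ageK//; exact: good_start.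
Qed.

Lemma inv_age_lt s u : 0 <= s -> 0 <= u -> w u <> None -> (s < z u) = (th s < u).
Proof.
move=> s0 u0 wu; have [h0 wh hs _] := inv_age_spec s0.
have cs := regular_speed rw; have [tu|ut] := ltP (th s) u.
  by rewrite -{1}hs (clock_strict cs).
apply/negbTE; rewrite -leNgt -{1}hs; exact: (clock_mono_alive cs).
Qed.

Lemma inv_age_mono s s' : 0 <= s -> s < s' -> th s < th s'.
Proof.
move=> s0 ss; have [h0 wh hs _] := inv_age_spec (ltW (le_lt_trans s0 ss)).
by rewrite -inv_age_lt// hs.
Qed.

Lemma inv_age_mono_le s s' : 0 <= s -> s <= s' -> th s <= th s'.
Proof.
by move=> s0; rewrite le_eqVlt => /orP[/eqP->//|h]; exact/ltW/inv_age_mono.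
Qed.

Lemma inv_age_right s e : 0 <= s -> 0 < e ->
  exists2 d, 0 < d & forall s', s <= s' < s + d -> th s <= th s' < th s + e.
Proof.
move=> s0 e0; have [h0 wh hs _] := inv_age_spec s0.
have [r r0 wr] := regular_alive_right rw h0 wh.
pose u := Num.min (th s + e) (th s + r).
have hu : th s < u by rewrite lt_min !ltrDl e0.
have u0 : 0 <= u by rewrite (le_trans h0)// ltW.
have wu : w u <> None by apply: regular_down wr => //; rewrite ge_min lexx orbT.
exists (z u - s); first by rewrite subr_gt0 inv_age_lt.
move=> s' /andP[ss]; rewrite subrKC => s'u; rewrite inv_age_mono_le//=.
move: s'u; rewrite inv_age_lt// ?(le_trans s0)// => h; apply: lt_le_trans h _.
by rewrite ge_min lexx.
Qed.

Lemma inv_age_left s e : 0 < s -> 0 < e ->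
  exists2 d, 0 < d & forall s', 0 <= s' -> s - d < s' < s -> th s - e < th s' < th s.
Proof.
move=> s0 e0; have [h0 wh hs _] := inv_age_spec (ltW s0).
have hp : 0 < th s by rewrite -inv_age0 inv_age_mono.
pose u := Num.max 0 (th s - e).
have us : u < th s by rewrite gt_max hp ltrBlDr ltrDl.
have u0 : 0 <= u by rewrite le_max lexx.
have wu : w u <> None by apply: regular_down wh => //; exact: ltW.
have zs : z u < s.
  by rewrite ltNge; apply/negP; rewrite le_eqVlt => /orP[/eqP e1|];
    [move: us; rewrite -(inv_ageK u0 wu) -e1 ltxx|rewrite inv_age_lt ?(ltW s0)// ltNge ltW].
exists (s - z u); first by rewrite subr_gt0.
move=> s' s'0; rewrite subKr => /andP[h1 h2]; rewrite inv_age_mono// andbT.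
have : u < th s'.
  by rewrite -[ltLHS](inv_ageK u0 wu) inv_age_mono// age_ge0.
by apply: le_lt_trans; rewrite le_max lexx orbT.
Qed.

Lemma inv_age_right_deriv s : 0 <= s -> right_deriv th s (rate w (th s))^-1.
Proof.
move=> s0 e e0; have [h0 wh hs _] := inv_age_spec s0.
have cs := regular_speed rw.
set C := rate w (th s).
have C0 : 0 < C by exact: (speed_pos cs).
(* The first bound gives [C * D <= 2 * S]; the second one then turns the error [e1 * D] into at most
   [e * C * S]. *)
pose e1 := Num.min (C / 2) (e * C * C / 2).
have e10 : 0 < e1 by rewrite lt_min !divr_gt0// !mulr_gt0.
have [r r0 hr] := clock_right_deriv cs h0 wh e10.
have [d d0 hd] := inv_age_right s0 r0.
exists d => // s' ss'; have /hr := hd s' ss'.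
have /andP[ss _] := ss'.
have [h'0 wh' hs' _] := inv_age_spec (le_trans s0 ss).
rewrite hs hs' -/C => h.
have D0 : 0 <= th s' - th s by rewrite subr_ge0 inv_age_mono_le.
set D := th s' - th s in h D0 *; set S := s' - s in h *.
have S0 : 0 <= S by rewrite subr_ge0.
have b1 : e1 * D <= C / 2 * D by rewrite ler_wpM2r// ge_min lexx.
have b2 : e1 * D <= e * C * C / 2 * D by rewrite ler_wpM2r// ge_min lexx orbT.
move: h; rewrite ler_norml => /andP[l1 l2].
have CD : C * D <= 2 * S by lra.
have k : `|S - C * D| <= e * C * S.
  have : e * C * (C * D) <= e * C * (2 * S) by rewrite ler_pM2l// mulr_gt0.
  by rewrite ler_norml => h; apply/andP; split; lra.
have -> : D - C^-1 * S = C^-1 * (C * D - S) by rewrite [RHS]mulrBr mulKf// gt_eqF.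
rewrite normrM distrC (@gtr0_norm _ C^-1) ?invr_gt0// ler_pdivrMl//.
by rewrite [leRHS]mulrA (mulrC C e).
Qed.

Lemma inv_age_left_cont s : 0 < s -> left_cont th s.
Proof.
move=> s0 e e0; have [d d0 hd] := inv_age_left s0 e0.
exists d => // s' s'0 /andP[h]; rewrite le_eqVlt => /orP[/eqP->|s's].
  by rewrite subrr normr0 ltW.
have := hd s' s'0; rewrite h s's => /(_ isT)/andP[h1 h2].
by rewrite ger0_norm ?subr_ge0 ?(ltW h2)// lerBlDr -lerBlDl ltW.
Qed.

End good_path.

Lemma regular_shift w T0 : regular w -> 0 <= T0 -> regular (fun t => w (T0 + t)).
Proof.
move=> rw T00; split.
  move=> t t0 B hB; have [r r0 hr] := regular_right_nbhs rw (addr_ge0 T00 t0) hB.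
  exists r => // s /=; rewrite -opprB normrN => h ts; apply: hr.
  by rewrite lerD2l (ltW ts) -addrA ltrD2l -ltrBlDl; move: h; rewrite ger0_norm ?subr_ge0// ltW.
move=> t t0 wt; have [K cK hK] := rw.2 _ (addr_ge0 T00 t0) wt.
exists K => // s /andP[s0 st]; apply: hK; by rewrite addr_ge0//= lerD2l.
Qed.

Lemma age_shift w T0 t : regular w -> 0 <= T0 -> 0 <= t -> w (T0 + t) <> None ->
  age (rate (fun t => w (T0 + t))) t = age (rate w) (T0 + t) - age (rate w) T0.
Proof.
move=> rw T00 t0 wt; have rs := regular_shift rw T00.
have cs := regular_speed rw; have css := regular_speed rs.
apply: (@right_deriv_unique R _ (fun t => age (rate w) (T0 + t) - age (rate w) T0)
  (rate (fun t => w (T0 + t))) t t0).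
- move=> u /andP[u0 ut].
  have wu : w (T0 + u) <> None.
    by apply: regular_down wt => //; [exact: addr_ge0|rewrite lerD2l ltW].
  split; first exact: clock_right_deriv css _ u0 wu.
  move=> e e0; have [r r0 hr] := clock_right_deriv cs (addr_ge0 T00 u0) wu e0.
  exists r => // s /andP[us sr].
  have := hr (T0 + s); rewrite lerD2l us -addrA ltrD2l sr => /(_ isT).
  have -> : T0 + s - (T0 + u) = s - u by ring.
  by rewrite opprB addrA subrK.
- move=> u /andP[u0 ut].
  split; first by apply: (clock_left_cont css) => //; exists t.
  move=> e e0.
  have [||r r0 hr] := clock_left_cont cs _ _ e0 (t := T0 + u).
  + by rewrite ltr_wpDl.
  + by exists (T0 + t) => //; rewrite lerD2l.
  exists r => // s s0 /andP[us su].
  have := hr (T0 + s) (addr_ge0 T00 s0); rewrite lerD2l su -addrA ltrD2l us => /(_ isT).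
  by rewrite opprB addrA subrK.
- by rewrite addr0 subrr /age Iint0.
Qed.

Lemma good_shift w T0 : regular w -> 0 <= T0 -> w T0 <> None -> good w ->
  good (fun t => w (T0 + t)).
Proof.
move=> rw T00 wT gw; apply: good_exceeds; first exact: regular_shift.
move=> r; pose s := Num.max 0 r + (age (rate w) T0).
have s0 : 0 <= s by rewrite addr_ge0 ?le_max ?lexx// age_ge0.
have [h0 wh hs _] := inv_age_spec rw gw s0.
have hT : T0 <= inv_age w s.
  rewrite -{1}(inv_ageK rw T00 wT); apply: inv_age_mono_le => //; first exact: age_ge0.
  by rewrite lerDr le_max lexx.
exists (inv_age w s - T0); rewrite subr_ge0 hT subrKC; split => //.
rewrite age_shift ?subrKC ?subr_ge0// hs.
by rewrite addrK le_max lexx orbT.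
Qed.

Lemma inv_age_shift w s r : regular w -> good w -> 0 <= s -> 0 <= r ->
  inv_age w (s + r) = inv_age w s + inv_age (fun t => w (inv_age w s + t)) r.
Proof.
move=> rw gw s0 r0; have [h0 wh hs _] := inv_age_spec rw gw s0.
have rs := regular_shift rw h0; have gs := good_shift rw h0 wh gw.
have [k0 wk hk _] := inv_age_spec rs gs r0.
have := age_shift rw h0 k0 wk; rewrite hk hs => e.
rewrite -(inv_ageK rw (addr_ge0 h0 k0) wk); congr inv_age.
by rewrite [X in s + X]e subrKC.
Qed.

Section scaling.
Variables (g gi : M -> M) (a : R).
Hypotheses (cg : continuous g) (cgi : continuous gi) (gK : cancel g gi)
  (giK : cancel gi g) (a0 : 0 < a) (ca : forall x, c (g x) = a * c x).

Lemma act_alive w t : act g a w t <> None <-> w (a * t) <> None.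
Proof. by rewrite /act; case: (w _). Qed.

Lemma regular_act w : regular w -> regular (act g a w).
Proof.
move=> rw; split; first exact: right_cont_act cg cgi gK giK a0 rw.1.
move=> t t0 /act_alive wt.
have [K cK hK] := rw.2 _ (mulr_ge0 (ltW a0) t0) wt.
exists (g @` K); first by apply: continuous_compact => //; exact: continuous_subspaceT.
move=> s /andP[s0 st]; rewrite /act live_omap.
have := hK (a * s); rewrite mulr_ge0 ?(ltW a0)// ler_pM2l// st => /(_ isT).
by case: (w _) => //= x Kx; exists x.
Qed.

(** The hypothesis [ca] multiplies the speed by [a], exactly as the change of time does on the
    right: both sides have the same right derivative. *)
Lemma age_act w t : regular w -> 0 <= t -> w (a * t) <> None ->
  age (rate (act g a w)) t = age (rate w) (a * t).
Proof.
move=> rw t0 wt; have rs := regular_act rw.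
have cs := regular_speed rw; have css := regular_speed rs.
apply: (@right_deriv_unique R _ (fun t => age (rate w) (a * t))
  (rate (act g a w)) t t0).
- move=> u /andP[u0 ut].
  have wu : w (a * u) <> None.
    by apply: regular_down wt => //; rewrite ?mulr_ge0 ?ler_pM2l// ltW.
  split; first by apply: clock_right_deriv css _ u0 _; exact/act_alive.
  move=> e e0; have e1 : 0 < e / a by rewrite divr_gt0.
  have [r r0 hr] := clock_right_deriv cs (mulr_ge0 (ltW a0) u0) wu e1.
  exists (r / a); first by rewrite divr_gt0.
  move=> s /andP[us sr].
  have := hr (a * s); rewrite ler_pM2l// us -ltr_pdivlMl// mulrDr mulKf ?gt_eqF//.
  rewrite (mulrC a^-1) sr => /(_ isT).
  have -> : rate (act g a w) u = a * rate w (a * u).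
    by rewrite /act /=; case: (w _) => [x|] /=; rewrite ?ca ?mulr0.
  have -> : a * s - a * u = a * (s - u) by ring.
  by rewrite !mulrA divfK ?gt_eqF// (mulrC (rate w _) a).
- move=> u /andP[u0 ut].
  split; first by apply: (clock_left_cont css) => //; exists t => //; exact/act_alive.
  move=> e e0.
  have [||r r0 hr] := clock_left_cont cs _ _ e0 (t := a * u).
  + by rewrite mulr_gt0.
  + by exists (a * t) => //; rewrite ler_pM2l.
  exists (r / a) => [|s s0 /andP[us su]]; first by rewrite divr_gt0.
  apply: hr; first by rewrite mulr_ge0// ltW.
  rewrite ler_pM2l// su andbT -ltr_pdivrMl// mulrBr mulKf ?gt_eqF//.
  by rewrite (mulrC a^-1).
- by rewrite mulr0 /age !Iint0.
Qed.

Lemma good_act w : regular w -> (good (act g a w) <-> good w).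
Proof.
move=> rw; have rs := regular_act rw; split => h; apply: good_exceeds => // r.
  have r0 : 0 <= Num.max 0 r by rewrite le_max lexx.
  have [h0 /act_alive wh hr _] := inv_age_spec rs h r0.
  exists (a * inv_age (act g a w) (Num.max 0 r)); split => //.
    by rewrite mulr_ge0// ltW.
  by rewrite -age_act// hr le_max lexx orbT.
have r0 : 0 <= Num.max 0 r by rewrite le_max lexx.
have [h0 wh hr _] := inv_age_spec rw h r0.
have aK : a * (inv_age w (Num.max 0 r) / a) = inv_age w (Num.max 0 r).
  by rewrite mulrC divfK ?gt_eqF.
exists (inv_age w (Num.max 0 r) / a); split.
- by rewrite divr_ge0// ltW.
- by apply/act_alive; rewrite aK.
- by rewrite age_act ?aK ?hr ?le_max ?lexx ?orbT// divr_ge0// ltW.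
Qed.

Lemma inv_age_act w r : regular w -> good w -> 0 <= r ->
  a * inv_age (act g a w) r = inv_age w r.
Proof.
move=> rw gw r0; have rs := regular_act rw.
have /(good_act rw) gs := gw.
have [k0 /act_alive wk hk _] := inv_age_spec rs gs r0.
rewrite -[in RHS]hk age_act// inv_ageK//.
by rewrite mulr_ge0// ltW.
Qed.

End scaling.

End path_clock.

(** * The time-changed path *)

Section time_changed_path.
Variables (R : realType) (M : metricType R).
Local Notation E := (cemetery_ext M).
Variable c : M -> R.
Hypotheses (cc : continuous c) (c_gt0 : forall x, 0 < c x).
Variable e0 : M.
Local Notation rate w := (extend0 c \o w).
Local Notation th := (inv_age c).

(* The value on paths which are not good is arbitrary. *)
Definition time_change (w : R -> E) (s : R) : M :=
  if `[< good c w >] then odflt e0 (w (th w s)) else e0.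

Section good_path.
Variable w : R -> E.
Hypotheses (rw : regular w) (gw : good c w).
Local Notation L := (time_change w).

Lemma time_changeE s : 0 <= s -> w (th w s) = Some (L s).
Proof.
move=> s0; have [_ wh _ _] := inv_age_spec cc c_gt0 rw gw s0.
by rewrite /time_change asboolT//; case: (w _) wh.
Qed.

Lemma time_change_age t : 0 <= t -> w t <> None -> w t = Some (L (age (rate w) t)).
Proof.
move=> t0 wt; rewrite -time_changeE; last exact: age_ge0.
by rewrite inv_ageK.
Qed.

Lemma time_change_right (O : set M) s : 0 <= s -> nbhs (L s) O ->
  exists2 d : R, 0 < d & forall s', s <= s' < s + d -> O (L s').
Proof.
move=> s0 hO; have [h0 wh _ _] := inv_age_spec cc c_gt0 rw gw s0.
have : nbhs (w (th w s)) (live O).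
  rewrite time_changeE// -liveE; exact: one_point_compactification_some_nbhs.
move=> /(regular_right_nbhs rw h0)[r r0 hr].
have [d d0 hd] := inv_age_right cc c_gt0 rw gw s0 r0.
exists d => // s' ss; have /andP[ss' _] := ss; have := hr _ (hd s' ss).
by rewrite time_changeE// (le_trans s0).
Qed.

Lemma time_change_start : w 0 = Some (L 0).
Proof. by rewrite -time_changeE// inv_age0. Qed.

(** Left limits come from those of [w] at [th w s], through the continuity and strict monotonicity
    of [th w]. The limit is not the cemetery since the path stays in a compact set up to the living
    time [th w s]. *)
Lemma time_change_cadlag (lc : locally_cpt M) :
  (forall t : R, 0 < t -> exists l : E, w s @[s --> t^'-] --> l) -> cadlag L.
Proof.
move=> lw; split.
  move=> s s0 O hO; have [d d0 hd] := time_change_right s0 hO.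
  exists d => // s' /=; rewrite distrC => h ss; apply: hd.
  rewrite (ltW ss)/= -ltrBlDl; apply: le_lt_trans h; exact: ler_norm.
move=> s s0; have [h0 wh _ _] := inv_age_spec cc c_gt0 rw gw (ltW s0).
have hp : 0 < th w s.
  by rewrite -(inv_age0 cc c_gt0 rw gw); exact: inv_age_mono.
have [l' hl'] := lw _ hp.
have [K cK hK] := rw.2 _ h0 wh.
have [l e] : exists l, l' = Some l.
  case: l' hl' => [l|] hl'; first by exists l.
  have oK : nbhs (None : E) (~` live K).
    by apply: open_nbhs_nbhs; split => //; exact: open_dead.
  have /= [r r0 hr] := hl' _ oK.
  pose u := Num.max 0 (th w s - r / 2).
  have us : u < th w s by rewrite gt_max hp ltrBlDr ltrDl divr_gt0.
  have := hr u => /=; rewrite ger0_norm ?subr_ge0 ?(ltW us)// us.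
  case => //; last by apply: hK; rewrite le_max lexx (ltW us).
  rewrite ltrBlDr -ltrBlDl lt_max; apply/orP; right.
  by rewrite ltrD2l ltrN2 ltr_pdivrMr// ltr_pMr// ltr1n.
exists l => O hO.
have : nbhs l' (live O) by rewrite e -liveE; exact: one_point_compactification_some_nbhs.
move=> /hl'/=[r r0 hr].
have [d d0 hd] := inv_age_left cc c_gt0 rw gw s0 r0.
exists (Num.min d s); first by rewrite /= lt_min d0.
move=> s' /=; rewrite lt_min => /andP[h1 h2] ss.
have n1 : `|s - s'| = s - s' by rewrite ger0_norm// subr_ge0 ltW.
rewrite n1 in h1 h2.
have s'0 : 0 <= s' by move: h2; rewrite ltrBlDr ltrDl => /ltW.
have := hd s' s'0; rewrite ltrBlDr -ltrBlDl h1 ss => /(_ isT)/andP[k1 k2].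
have := hr (th w s') => /=; rewrite ger0_norm ?subr_ge0 ?(ltW k2)// k2 time_changeE//.
by apply => //; rewrite ltrBlDr -ltrBlDl.
Qed.

Let q (s : R) := (c (L s))^-1.

Let cVc : continuous (fun x => (c x)^-1).
Proof. by move=> x; apply: cvgV; [rewrite gt_eqF|exact: cc]. Qed.

Let qE s : 0 <= s -> q s = extend0 (fun x => (c x)^-1) (w (th w s)).
Proof. by move=> s0; rewrite time_changeE. Qed.

Lemma time_change_speed : clock_speed q (fun _ => True).
Proof.
have q_right s : 0 <= s -> forall e, 0 < e ->
    exists2 r, 0 < r & forall s', s <= s' < s + r -> `|q s' - q s| <= e.
  move=> s0 e e_gt0; have := @cVc (L s) => /cvgrPdist_le/(_ e e_gt0) hO.
  have [d d0 hd] := time_change_right s0 hO.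
  by exists d => // s' /hd; rewrite distrC.
split.
- by move=> t _; rewrite invr_ge0 ltW.
- by apply: right_cont_measurable => u u0 e e_gt0; exact: q_right.
- by [].
- by move=> t _ _; exists 1.
- by move=> t _ _; rewrite invr_gt0.
- by move=> t _; case.
- move=> t t0 _; have [h0 wh _ _] := inv_age_spec cc c_gt0 rw gw t0.
  have [K hK] := regular_bounded cVc rw h0 wh.
  exists K => s /andP[s0 st]; rewrite qE//; apply: hK.
  have [k0 _ _ _] := inv_age_spec cc c_gt0 rw gw s0.
  by rewrite k0 inv_age_mono_le.
- by move=> t t0 _; exact: q_right.
Qed.

Lemma clock_time_change s : 0 <= s -> clock c L s%:E = (th w s)%:E.
Proof.
move=> s0; have cs := time_change_speed.
change (Iint q s%:E = (th w s)%:E).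
rewrite -(fineK (clock_fin cs s0 I)); congr EFin.
apply: (@right_deriv_unique R (fun s => fine (Iint q s%:E)) (th w) q s s0).
- move=> t /andP[t0 ts]; split; first exact: (clock_right_deriv cs).
  have := inv_age_right_deriv cc c_gt0 rw gw t0.
  by rewrite /= time_changeE.
- move=> t /andP[t0 ts]; split; last exact: inv_age_left_cont.
  by apply: (clock_left_cont cs) => //; exists t.
- by rewrite Iint0 inv_age0.
Qed.

(** The values of the clock are the times [th w s], which run through all the living times.
    Strictness comes from going one unit of age further. *)
Lemma lt_clock_oo t : 0 <= t -> (t%:E < clock c L +oo)%E <-> w t <> None.
Proof.
move=> t0; have cs := time_change_speed; split.
  move=> /(clock_oo cs I)[s s0 [_]].
  have -> : age q s = th w s.
    by rewrite /age -[Iint q _]/(clock c L _) clock_time_change.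
  move=> ts.
  have [h0 wh _ _] := inv_age_spec cc c_gt0 rw gw s0.
  exact: regular_down (ltW ts) wh.
move=> wt; pose s := age (rate w) t.
have s0 : 0 <= s by exact: age_ge0.
have s1 : 0 <= s + 1 by rewrite addr_ge0.
apply: (@lt_le_trans _ _ (clock c L (s + 1)%:E)).
  rewrite clock_time_change// lte_fin -(inv_ageK cc c_gt0 rw t0 wt).
  by apply: inv_age_mono => //; rewrite ltrDl.
by apply: Iint_le_oo; [exact: speed_ge0 cs|exact: speed_measurable cs].
Qed.

Lemma clock_inv_time_change t : 0 <= t -> w t <> None ->
  clock_inv c L t = age (rate w) t.
Proof.
move=> t0 wt; have s0 : 0 <= age (rate w) t by exact: age_ge0.
have inj : {in `[0, +oo[%classic &, injective (fun s => clock c L s%:E)}.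
  move=> u v; rewrite !inE /= !in_itv /= !andbT => u0 v0.
  rewrite !clock_time_change// => -[] uv.
  have [_ _ <- _] := inv_age_spec cc c_gt0 rw gw u0.
  by have [_ _ <- _] := inv_age_spec cc c_gt0 rw gw v0; rewrite uv.
have := pinvKV (fun=> 0) inj (x := age (rate w) t).
by rewrite inE /= in_itv /= s0 clock_time_change// inv_ageK//; exact.
Qed.

Lemma time_change_lifetime (l : \bar R) : (0 <= l)%E ->
  (forall t, 0 <= t -> (t%:E < l)%E <-> w t <> None) ->
  l = clock c L +oo%E /\
  forall t, 0 <= t -> (t%:E < clock c L +oo)%E -> w t = Some (L (clock_inv c L t)).
Proof.
move=> l0 hl; split.
  have le (x y : \bar R) : (0 <= y)%E -> (forall t, 0 <= t -> (t%:E < x)%E -> (t%:E < y)%E) ->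
      (x <= y)%E.
    move=> y0 h; rewrite leNgt; apply/negP => yx.
    case: y y0 h yx => [r| |] // r0 h yx; first by have := h r r0 yx; rewrite ltxx.
    by move: yx; rewrite ltNge leey.
  apply/eqP; rewrite eq_le; apply/andP; split; apply: le => //.
  - by apply: Iint_ge0 => t _; rewrite invr_ge0 ltW.
  - by move=> t t0 /(hl t t0) wt; apply/lt_clock_oo.
  - by move=> t t0 /(lt_clock_oo t0) wt; apply/hl.
move=> t t0 /(lt_clock_oo t0) wt.
by rewrite clock_inv_time_change// time_change_age.
Qed.

End good_path.

End time_changed_path.

(** * The total age is infinite *)

Section regular_process.
Variables (R : realType) (M : metricType R).
Local Notation E := (cemetery_ext M).
Context (d : measure_display) (T : measurableType d) (P : probability T R).
Variable X : M -> T -> R -> E.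
Hypothesis XM : strong_markov_process P X.

Lemma lifetime_confined y om t : (t%:E < lifetime (X y om))%E ->
  exists2 K, compact K & forall s, 0 <= s <= t -> live K (X y om s).
Proof.
move=> /ereal_sup_gt[_ [K [cK _] <-] h]; exists K => // s /andP[s0 st].
apply: contrapT => nK; move: h; apply/negP; rewrite -leNgt.
apply: ge_ereal_inf; exists s%:E; last by rewrite lee_fin.
by exists s => //; split => //; rewrite liveE.
Qed.

Lemma process_alive y om t : 0 <= t ->
  (t%:E < lifetime (X y om))%E <-> X y om t <> None.
Proof.
move=> t0; split => [/lifetime_confined[K _ hK]|h].
  by have := hK t; rewrite t0 lexx => /(_ isT); case: (X y om t).
by rewrite ltNge; apply/negP => /(process_absorbed XM t0).
Qed.

Lemma process_regular y om : regular (X y om).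
Proof.
split; first exact: cadlag_right_cont (process_cadlag XM y om).
by move=> t t0 /(process_alive y om t0)/lifetime_confined.
Qed.

Lemma rpath_measurable y C : rpath C -> measurable (X y @^-1` C).
Proof.
move=> [C0 pC0 h]; rewrite (_ : _ @^-1` _ = X y @^-1` C0).
  by apply: measurable_process_path => //; exact: (process_measurable XM).
by apply/seteqP; split => om; apply h; exact: process_regular.
Qed.

Lemma rpath_shift (C : set (R -> E)) t : 0 <= t -> rpath C ->
  rpath [set w : R -> E | C (fun s => w (t + s))].
Proof.
move=> t0 [C0 pC0 h]; exists [set w : R -> E | C0 (fun s => w (t + s))].
  exact: path_sigma_shift.
by move=> w rw; apply: h; exact: regular_shift.
Qed.

Lemma rpast_past y t C : rpast t C -> past (X y) t (X y @^-1` C).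
Proof.
move=> [C0 pC0 h]; rewrite (_ : _ @^-1` _ = X y @^-1` C0); last first.
  by apply/seteqP; split => om; apply h; exact: process_regular.
apply: (@sigma_algebra_preimage_sub _ _ (X y) _ _ (past_algebra (X y) t) _ _ pC0).
move=> _ [s [B [st bB ->]]]; apply: sub_sigma_algebra; exists s, B; split => //.
Qed.

Lemma past_measurable y t A : past (X y) t A -> measurable A.
Proof.
move=> pA; apply: (smallest_sub _ _ pA); first exact: sigma_algebra_measurable.
by move=> _ [s [B [/andP[s0 _] bB ->]]]; exact: (process_measurable XM).
Qed.

Lemma past_mono y s t : s <= t -> past (X y) s `<=` past (X y) t.
Proof.
move=> st; apply: g_sigma_sub => _ [u [B [/andP[u0 us] bB ->]]].
by apply: sub_sigma_algebra; exists u, B; split => //; rewrite u0 (le_trans us).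
Qed.

Lemma eq_law_regular (Y Z : T -> R -> E) C : (forall om, regular (Y om)) ->
  (forall om, regular (Z om)) -> eq_law P Y Z -> rpath C -> law P Y C = law P Z C.
Proof.
move=> rY rZ YZ [C0 pC0 h]; rewrite /law.
rewrite (_ : Y @^-1` C = Y @^-1` C0); last by apply/seteqP; split => om; apply h.
rewrite (_ : Z @^-1` C = Z @^-1` C0); last by apply/seteqP; split => om; apply h.
exact: YZ.
Qed.

(** An event with the same probability from all starting points turns the integral of the strong
    Markov property into a product; independence of increments will be of this form. Events of
    [rpath] are allowed because shifted paths remain regular. *)
Lemma strong_markov_const y tau A C (g : \bar R) :
  stopping_time (X y) tau -> stopped_past (X y) tau A -> rpath C ->
  (forall om, A om -> (tau om < +oo)%E -> X y om (fine (tau om)) <> None) ->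
  (forall x, law P (X x) C = g) ->
  P (A `&` [set om | (tau om < +oo)%E] `&` [set om | C (fun s => X y om (fine (tau om) + s))]) =
  (g * P (A `&` [set om | (tau om < +oo)%E]))%E.
Proof.
move=> st sp [C0 pC0 h] alv hg.
have := process_strong_markov XM st sp pC0.
rewrite /=; set D := A `&` _ => sm.
have tau0 om : 0 <= fine (tau om) by apply: fine_ge0; exact: st.1.
rewrite (_ : D `&` _ = D `&` [set om | C0 (fun s => X y om (fine (tau om) + s))]); last first.
  by apply/seteqP; split => om [Do Co]; split => //=; apply/h => //;
    apply: regular_shift (tau0 om); exact: process_regular.
rewrite sm -[RHS]integral_cst; last first.
  apply: measurableI; first exact: sp.1.
  rewrite (_ : [set om | _] = \bigcup_n [set om | (tau om <= n%:R%:E)%E]).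
    by apply: bigcup_measurable => n _; apply: past_measurable; apply st.2; exact: ler0n.
  apply/seteqP; split => om /=.
    have := st.1 om; case e : (tau om) => [r| |]// r0 _.
    by exists (Num.truncn r).+1 => //=; rewrite e lee_fin ltW// truncnS_gt.
  by move=> [n _ /= /le_lt_trans]; apply; exact: ltry.
apply: eq_integral => om; rewrite inE => -[Aom /= tom].
have := alv om Aom tom; case: (X y om _) => // x _ /=.
rewrite -(hg x) /law; congr (P _); apply/seteqP; split => o; apply h; exact: process_regular.
Qed.

Lemma markov_const y t A C (g : \bar R) : 0 <= t -> past (X y) t A -> rpath C ->
  (forall om, A om -> X y om t <> None) -> (forall x, law P (X x) C = g) ->
  P (A `&` [set om | C (fun s => X y om (t + s))]) = (g * P A)%E.
Proof.
move=> t0 pA rC alv hg.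
have := @strong_markov_const y (fun=> t%:E) A C g.
rewrite (_ : [set om | (t%:E < +oo)%E] = setT) ?setIT; last first.
  by apply/seteqP; split => // om _ /=; rewrite ltry.
apply => //.
- split=> [om|s s0]; first by rewrite lee_fin.
  have [ts|ts] := boolP (t <= s).
    rewrite (_ : [set om | _] = setT); first exact: pastT.
    by apply/seteqP; split => // om _ /=; rewrite lee_fin.
  rewrite (_ : [set om | _] = set0); first exact: past0.
  by apply/seteqP; split => // om /=; rewrite lee_fin (negbTE ts).
- split=> [|s s0]; first exact: past_measurable pA.
  have [ts|ts] := boolP (t <= s).
    rewrite (_ : [set om | _] = setT) ?setIT; first exact: past_mono pA.
    by apply/seteqP; split => // om _ /=; rewrite lee_fin.
  rewrite (_ : [set om | _] = set0) ?setI0; first exact: past0.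
  by apply/seteqP; split => // om /=; rewrite lee_fin (negbTE ts).
- by move=> om Aom _; exact: alv.
Qed.

End regular_process.

Section no_explosion.
Variables (R : realType) (M : metricType R).
Local Notation E := (cemetery_ext M).
Context (d : measure_display) (T : measurableType d) (P : probability T R).
Variable X : M -> T -> R -> E.
Hypothesis XM : strong_markov_process P X.
Hypothesis lc : locally_cpt M.
Variables (y0 : M) (f finv : M -> M -> M) (c : M -> R).
Hypothesis ic : invariance_components P X y0 f finv c.
Hypothesis cmul : forall x y, c (f x y) = c x * c y.

Let cc : continuous c := component_c_continuous ic.
Let c_gt0 : forall x, 0 < c x := component_c_gt0 ic.
Local Notation rate w := (extend0 c \o w).
Local Notation Y := (X y0).

Lemma component_slices y : continuous (f y) /\ continuous (finv y).
Proof.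
have [_ _ cf cfi _] := component_moving ic.
by split => x; [exact: (@continuous_slice _ _ _ _ y cf)|exact: (@continuous_slice _ _ _ _ y cfi)].
Qed.

Lemma component_regular_act y w : regular w -> regular (act (f y) (c y) w).
Proof.
have [h1 h2] := component_slices y.
by apply: (regular_act h1 h2) => //; [exact: (component_fK ic)|exact: (component_fVK ic)].
Qed.

Lemma law_invariant C y : rpath C ->
  (forall w, regular w -> w 0 = Some y0 -> (C (act (f y) (c y) w) <-> C w)) ->
  law P (X y) C = law P Y C.
Proof.
move=> rC hC.
rewrite (eq_law_regular _ _ (component_eq_law ic y) rC).
- have h om := hC (Y om) (process_regular XM y0 om) (process_start XM y0 om).
  by rewrite /law; congr (P _); apply/seteqP; split => om /(h om).
- by move=> om; exact: (process_regular XM y om).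
- by move=> om; exact: (component_regular_act y (process_regular XM y0 om)).
Qed.

(** The total age is at most [r]; the quantifier over living times avoids the [fine] of an infinite
    integral. *)
Definition short (r : R) (w : R -> E) :=
  forall t, 0 <= t -> w t <> None -> age (rate w) t <= r.

Lemma short_rpath r : 0 <= r -> rpath (short r).
Proof.
move=> r0; have [_ rC rU] := @rpath_algebra R M.
have c0 x : 0 <= c x by exact: ltW.
pose G n : set (R -> E) := [set w : R -> E | (r%:E < Iint (rate w) n%:R%:E)%E].
have hG n : rpath (G n).
  apply: (@rpast_rpath R M n%:R).
  apply: (@Iint_rpast _ _ _ (ler0n _ n) c [set x : \bar R | (r%:E < x)%E]) => //.
  rewrite (_ : [set x | _] = [set` `]r%:E, +oo[]); first exact: emeasurable_itv.
  by apply/seteqP; split => x /=; rewrite in_itv /= andbT.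
have := rC _ (rU _ hG); apply: trace_ext => w rw.
have cs := regular_speed cc c_gt0 rw; split=> [[_ /= h] t t0 wt|h].
  rewrite leNgt; apply/negP => rt; apply: h; exists (Num.truncn t).+1 => //=.
  apply: (@lt_le_trans _ _ (Iint (rate w) t%:E)); first by rewrite age_alive.
  apply: Iint_mono => //; [exact: speed_ge0 cs|exact: speed_measurable cs|].
  by rewrite ltW// truncnS_gt.
split => // -[n _ /= hn].
have [v /andP[v0 _] [wv]] := clock_dead cs (Iint_gt_alive0 rw r0 hn) (ler0n _ n) hn.
by rewrite ltNge h.
Qed.

(** The action permutes the living times by the factor [c y] and preserves the age at corresponding
    times, thanks to [cmul]. *)
Lemma short_act r y w : regular w -> short r (act (f y) (c y) w) <-> short r w.
Proof.
move=> rw; have [h1 h2] := component_slices y.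
have cy := c_gt0 y.
have ae t : 0 <= t -> w (c y * t) <> None ->
    age (rate (act (f y) (c y) w)) t = age (rate w) (c y * t).
  by apply: (age_act cc c_gt0 h1 h2) => //; [exact: (component_fK ic)|exact: (component_fVK ic)].
split => h t t0 wt.
  have e : c y * (t / c y) = t by rewrite mulrC divfK ?gt_eqF.
  rewrite -e -ae ?e//; last by rewrite divr_ge0// ltW.
  by apply: h; [rewrite divr_ge0// ltW|apply/act_alive; rewrite e].
move/act_alive: wt => wt; rewrite ae//; apply: h => //.
by rewrite mulr_ge0// ltW.
Qed.

Definition short_prob (r : R) : \bar R := law P Y (short r).

Lemma law_short r y : 0 <= r -> law P (X y) (short r) = short_prob r.
Proof.
by move=> r0; apply: law_invariant; [exact: short_rpath|move=> w rw _; exact: short_act].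
Qed.

Lemma short_prob0 : short_prob 0 = 0%E.
Proof.
rewrite /short_prob /law (_ : _ @^-1` _ = set0) ?measure0//.
apply/seteqP; split => // om /= h.
have rw := process_regular XM y0 om; have cs := regular_speed cc c_gt0 rw.
have w0 : Y om 0 <> None by rewrite (process_start XM).
have [r r0 wr] := regular_alive_right rw (lexx 0) w0.
rewrite add0r in wr.
have := h r (ltW r0) wr; rewrite leNgt; apply/negP; rewrite negbK.
by rewrite -(clock0 (rate (Y om))); exact: (clock_strict cs).
Qed.

Variable K : set M.
Hypotheses (cK : compact K) (K0 : nbhs y0 K).

Let oK : open (~` K).
Proof. by apply: closed_openC; apply: compact_closed => //; exact: metric_hausdorff. Qed.

(** Exit from [K] is observed at discrete times, where the Markov property at fixed times suffices.
    The levels are nested, so that the escape events increase with [m]. *)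
Definition dyadic (m j : nat) : R := j%:R / 2 ^+ m.

Lemma dyadic_ge0 m j : 0 <= dyadic m j.
Proof. by rewrite divr_ge0// exprn_ge0. Qed.

Lemma dyadic_dense (a b : R) : 0 <= a -> a < b -> exists m j, a < dyadic m j < b.
Proof.
move=> a0 ab; have e0 : 0 < b - a by rewrite subr_gt0.
pose m := Num.truncn (b - a)^-1.
have hm : (2 ^+ m)^-1 < b - a.
  rewrite -[ltRHS]invrK ltf_pV2 ?posrE ?exprn_gt0 ?invr_gt0//.
  apply: lt_le_trans (truncnS_gt _) _; rewrite -natrX ler_nat; exact: ltn_expl.
exists m, (Num.truncn (a * 2 ^+ m)).+1; rewrite /dyadic.
have p0 : 0 < 2 ^+ m :> R by rewrite exprn_gt0.
have a1 : 0 <= a * 2 ^+ m by rewrite mulr_ge0// ltW.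
rewrite ltr_pdivlMr// truncnS_gt/= -natr1 mulrDl mul1r.
apply: (@le_lt_trans _ _ (a + (2 ^+ m)^-1)); last by rewrite -ltrBrDl.
by rewrite lerD2r ler_pdivrMr// truncn_le.
Qed.

Definition outside (m j : nat) : set T := [set om | live (~` K) (Y om (dyadic m j))].

Lemma outside_past m j : past Y (dyadic m j) (outside m j).
Proof.
apply: (@rpast_past _ _ _ _ _ X XM y0 _ [set w | live (~` K) (w (dyadic m j))]).
apply: live_rpast; first by rewrite dyadic_ge0 lexx.
exact: sub_sigma_algebra.
Qed.

Definition early (eps : R) (m j : nat) : set T :=
  [set om | (Iint (rate (Y om)) (dyadic m j)%:E <= eps%:E)%E].

Lemma early_past eps m j : past Y (dyadic m j) (early eps m j).
Proof.
apply: (@rpast_past _ _ _ _ _ X XM y0 _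
  [set w : R -> E | [set x : \bar R | (x <= eps%:E)%E] (Iint (rate w) (dyadic m j)%:E)]).
apply: Iint_rpast => //; first exact: dyadic_ge0.
  by move=> x; exact: ltW.
rewrite (_ : [set x | _] = [set` `]-oo, eps%:E]]); first exact: emeasurable_itv.
by apply/seteqP; split => x /=; rewrite in_itv.
Qed.

Definition escapes_early (eps : R) : set T :=
  \bigcup_m \bigcup_j (outside m j `&` early eps m j).

Lemma escapes_early_measurable eps : measurable (escapes_early eps).
Proof.
apply: bigcup_measurable => m _; apply: bigcup_measurable => j _.
apply: measurableI; apply: (past_measurable XM (y := y0) (t := dyadic m j)).
  exact: outside_past.
exact: early_past.
Qed.

(** Every path remains in [K] for a while, and its age becomes positive meanwhile; so it does not
    escape before the age 1/(n+1) for some [n]. One of these countably many events has positive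
    probability. *)
Lemma escapes_early_small : exists2 eps, 0 < eps & (P (escapes_early eps) < 1)%E.
Proof.
have mC n := measurableC (escapes_early_measurable n.+1%:R^-1).
have [|n hn] := @bigcup_gt0 R d T P (fun n => ~` escapes_early n.+1%:R^-1) mC.
  rewrite (_ : \bigcup_n _ = setT); first by rewrite probability_setT lte01.
  apply/seteqP; split => // om _; apply: contrapT => hno.
  have rw := process_regular XM y0 om; have cs := regular_speed cc c_gt0 rw.
  have hK : nbhs (Y om 0) (live K).
    by rewrite (process_start XM) -liveE; exact: one_point_compactification_some_nbhs.
  have [r r0 hr] := regular_right_nbhs rw (lexx 0) hK.
  have w0 : Y om 0 <> None by rewrite (process_start XM).
  have [r' r'0 wr'] := regular_alive_right rw (lexx 0) w0.
  rewrite add0r in wr'.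
  pose u := Num.min (r / 2) r'.
  have u0 : 0 < u by rewrite lt_min r'0 divr_gt0.
  have wu : Y om u <> None.
    by apply: (regular_down rw (ltW u0) _ wr'); rewrite ge_min lexx orbT.
  have zu : 0 < age (rate (Y om)) u.
    by rewrite -(clock0 (rate (Y om))); exact: (clock_strict cs).
  apply: hno; exists (Num.truncn (age (rate (Y om)) u)^-1) => //= -[m _ [j _ [out]]].
  rewrite /early /= => ear.
  have wj : Y om (dyadic m j) <> None by move: out; rewrite /outside /=; case: (Y om _).
  move: ear; rewrite age_alive ?dyadic_ge0// lee_fin leNgt => /negP; apply.
  apply: (@lt_le_trans _ _ (age (rate (Y om)) u)).
    rewrite -[ltRHS]invrK ltf_pV2 ?posrE ?invr_gt0//; exact: truncnS_gt.
  apply: (clock_mono_alive cs) => //; first exact: ltW.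
  rewrite leNgt; apply/negP => ju.
  have : live K (Y om (dyadic m j)).
    apply: hr; rewrite dyadic_ge0/= add0r (lt_le_trans ju)// ge_min.
    by rewrite ler_pdivrMr// ler_peMr ?ler1n// ltW.
  by move: out; rewrite /outside /=; case: (Y om _) => // x nK Kx.
exists n.+1%:R^-1; first by rewrite invr_gt0.
rewrite ltNge; apply/negP => h; move: hn.
rewrite probability_setC; last exact: escapes_early_measurable.
have -> : P (escapes_early n.+1%:R^-1) = 1%E.
  by apply/eqP; rewrite eq_le h andbT probability_le1//; exact: escapes_early_measurable.
by rewrite subee ?ltxx.
Qed.

Definition escapes (m : nat) : set T := \bigcup_j outside m j.

Lemma escapes_mono : nondecreasing_seq escapes.
Proof.
apply/nondecreasing_seqP => m; apply/subsetPset => om [j _ h].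
exists (2 * j)%N => //; rewrite /outside /= (_ : dyadic m.+1 (2 * j) = dyadic m j)//.
by rewrite /dyadic exprS natrM invfM mulrACA divff ?mul1r.
Qed.

(* A path of finite total age must leave [K]: it stays alive forever with a speed
   bounded below on [K], or it dies by going to the cemetery continuously. *)
Lemma short_escapes r om : short r (Y om) -> exists m, escapes m om.
Proof.
move=> sh; have rw := process_regular XM y0 om; have cs := regular_speed cc c_gt0 rw.
suff [t [t0 ht]] : exists t, 0 <= t /\ live (~` K) (Y om t).
  have hn : nbhs (Y om t) (live (~` K)).
    move: ht; case: (Y om t) => // x nKx; rewrite -liveE.
    by apply: one_point_compactification_some_nbhs; exact: open_nbhs_nbhs.
  have [e e0 he] := regular_right_nbhs rw t0 hn.
  have [|m [j /andP[h1 h2]]] := @dyadic_dense t (t + e) t0; first by rewrite ltrDl.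
  by exists m, j => //; apply: he; rewrite (ltW h1).
apply: contrapT => hno.
have inK t : 0 <= t -> Y om t <> None -> live K (Y om t).
  move=> t0; case e : (Y om t) => [x|//] _ /=; apply: contrapT => nKx.
  by apply: hno; exists t; split => //; rewrite e.
have [alv|] := pselect (forall t, 0 <= t -> Y om t <> None).
  have [b b0 hb] : exists2 b, 0 < b & forall x, K x -> b <= c x.
    have cV : continuous (fun x => (c x)^-1) by move=> x; apply: cvgV; [rewrite gt_eqF|exact: cc].
    have cI : compact ((fun x => (c x)^-1) @` K).
      by apply: continuous_compact => //; apply: continuous_subspaceT => x; exact: cV.
    have [B [_ hB]] := compact_bounded cI.
    exists (Num.max 1 (B + 1))^-1; first by rewrite invr_gt0 lt_max ltr01.
    move=> x Kx; rewrite -[leRHS]invrK lef_pV2 ?posrE ?invr_gt0// ?lt_max ?ltr01//.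
    rewrite le_max; apply/orP; right; apply: le_trans (ler_norm _) _.
    by apply: (hB (B + 1)); [rewrite ltrDl|exists x].
  have r0 : 0 <= r.
    apply: le_trans (sh 0 (lexx 0) (alv 0 (lexx 0))); by rewrite clock0.
  (* At speed at least [b], the age at this time is at least [r + 1]. *)
  pose t := (r + 1) / b.
  have t0 : 0 <= t by rewrite divr_ge0 ?addr_ge0// ltW.
  have := sh t t0 (alv t t0); rewrite leNgt => /negP; apply.
  rewrite -lte_fin -age_alive//; last exact: alv.
  rewrite /Iint Iset_fin.
  apply: (@lt_le_trans _ _ (b * (t - 0))%:E).
    by rewrite lte_fin subr0 /t mulrC divfK ?gt_eqF// ltrDl.
  apply: (itv_integral_ge (speed_measurable cs) (lexx 0) t0 (ltW b0)).
  move=> u /andP[u0 _] /=; have := inK u u0 (alv u u0).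
  by case: (Y om u) => //= x; exact: hb.
move=> /existsNP[t /not_implyP[t0 /contrapT wt]].
have lt : (lifetime (Y om) <= t%:E)%E.
  rewrite leNgt; apply/negP => /(process_alive XM y0 om t0); exact.
have lp : (0%:E < lifetime (Y om))%E.
  by apply/(process_alive XM y0 om (lexx 0)); rewrite (process_start XM).
have [z lz] : exists z : R, lifetime (Y om) = z%:E.
  by move: lt lp; case: (lifetime _) => // z _ _; exists z.
rewrite lz lte_fin in lp.
have := process_no_killing XM lz.
have oN : nbhs (None : E) (~` live K) by apply: open_nbhs_nbhs; split => //; exact: open_dead.
move=> /(_ _ oN)/= [e e0 he].
pose u := Num.max 0 (z - e / 2).
have uz : u < z by rewrite gt_max lp ltrBlDr ltrDl divr_gt0.
have u0 : 0 <= u by rewrite le_max lexx.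
have := he u => /=; rewrite ger0_norm ?subr_ge0 ?(ltW uz)// uz.
case => //.
  rewrite ltrBlDr -ltrBlDl lt_max; apply/orP; right.
  by rewrite ltrD2l ltrN2 ltr_pdivrMr// ltr_pMr// ltr1n.
by apply: inK => //; apply/(process_alive XM y0 om u0); rewrite lz lte_fin.
Qed.

Lemma short_outside r eps m j om : 0 < eps -> 0 <= r ->
  short (r + eps) (Y om) -> outside m j om ->
  (early eps m j om /\ short (r + eps) (fun s => Y om (dyadic m j + s))) \/
  short r (fun s => Y om (dyadic m j + s)).
Proof.
move=> e0 r0 sh out; set t := dyadic m j.
have t0 : 0 <= t by exact: dyadic_ge0.
have rw := process_regular XM y0 om.
have wt : Y om t <> None by move: out; rewrite /outside /= -/t; case: (Y om t).
have sh' s : 0 <= s -> Y om (t + s) <> None ->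
    age (rate (fun s => Y om (t + s))) s <= r + eps - age (rate (Y om)) t.
  move=> s0 ws; rewrite age_shift// lerD2r; apply: sh => //; exact: addr_ge0.
have [h|h] := leP (age (rate (Y om)) t) eps.
  left; split; first by rewrite /early /= -/t age_alive// lee_fin.
  move=> s s0 ws; apply: le_trans (sh' s s0 ws) _.
  by rewrite lerBlDr lerDl age_ge0.
right => s s0 ws; apply: le_trans (sh' s s0 ws) _.
by rewrite lerBlDr lerD2l ltW.
Qed.

(* The first dyadic exit from [K] splits a total age at most [r + eps]: either the
   exit comes at an age at most [eps], and the shifted path again has total age at
   most [r + eps], or the shifted path has total age at most [r]. The law of the
   total age does not depend on the starting point, so the first case contributes
   at most the probability of an early escape times the same probability. *)
Lemma short_prob_step r eps : 0 < eps -> (P (escapes_early eps) < 1)%E -> 0 <= r ->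
  short_prob r = 0%E -> short_prob (r + eps) = 0%E.
Proof.
move=> e0 he r0 G0.
have re0 : 0 <= r + eps by rewrite addr_ge0// ltW.
pose S := Y @^-1` short (r + eps).
have mS : measurable S := rpath_measurable XM y0 (short_rpath re0).
have mo m j : measurable (outside m j) := past_measurable XM (@outside_past m j).
have me m j : measurable (early eps m j) := past_measurable XM (@early_past eps m j).
(* At level [m], the index [j] is the first one at which the path is outside [K]. *)
pose F m j := seqDU (outside m) j.
have pF m j : past Y (dyadic m j) (F m j).
  have [p0 pC pU] := past_algebra Y (dyadic m j).
  rewrite /F /seqDU setDE; apply: (sigma_algebraUI (past_algebra _ _) (@outside_past m j) _).2.
  rewrite -setTD; apply: (pC); apply: (big_ind (past Y (dyadic m j))) => //.
    by move=> A B pA pB; exact: (sigma_algebraUI (past_algebra _ _) pA pB).1.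
  move=> k _; apply: past_mono (@outside_past m k).
  by rewrite ler_pM2r ?invr_gt0 ?exprn_gt0// ler_nat ltnW.
have mF m j : measurable (F m j) := past_measurable XM (pF m j).
have Fo m j : F m j `<=` outside m j by move=> om [].
have Fal m j om : F m j om -> Y om (dyadic m j) <> None.
  by move=> /Fo; rewrite /outside /=; case: (Y om _).
pose sh q m j : set T := [set om | short q (fun s => Y om (dyadic m j + s))].
have msh q m j : 0 <= q -> measurable (sh q m j).
  move=> q0; exact: (rpath_measurable XM y0 (rpath_shift (dyadic_ge0 m j) (short_rpath q0))).
have gfin : short_prob (r + eps) \is a fin_num by exact: fin_num_measure.
have bound m j : (P (S `&` F m j) <= short_prob (r + eps) * P (F m j `&` early eps m j))%E.
  have mFe : past Y (dyadic m j) (F m j `&` early eps m j).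
    exact: (sigma_algebraUI (past_algebra _ _) (pF m j) (@early_past eps m j)).2.
  have e1 := markov_const XM (dyadic_ge0 m j) mFe (short_rpath re0)
    (fun om h => Fal m j om h.1) (fun x => law_short x re0).
  have e2 := markov_const XM (dyadic_ge0 m j) (pF m j) (short_rpath r0)
    (Fal m j) (fun x => law_short x r0).
  rewrite G0 mul0e in e2.
  rewrite -e1 -[leRHS]adde0 -e2.
  apply: (@le_trans _ _ (P ((F m j `&` early eps m j `&` sh (r + eps) m j) `|`
      (F m j `&` sh r m j)))); last first.
    apply: measureU2; apply: measurableI => //; [exact: measurableI|exact: msh|exact: msh].
  apply: le_measure; rewrite ?inE.
  - exact: measurableI.
  - by apply: measurableU; apply: measurableI => //; [exact: measurableI|exact: msh|exact: msh].
  move=> om [So Fom].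
  by have [[h1 h2]|h] := short_outside e0 r0 So (Fo m j om Fom); [left|right].
have step m : (P (S `&` escapes m) <= short_prob (r + eps) * P (escapes_early eps))%E.
  rewrite /escapes seqDU_bigcup_eq setI_bigcupr measure_semi_bigcup; last 3 first.
  - by move=> j; apply: measurableI => //; exact: mF.
  - by apply: trivIset_setIl; exact: trivIset_seqDU.
  - by apply: bigcup_measurable => j _; apply: measurableI => //; exact: mF.
  apply: (@le_trans _ _ (\sum_(j <oo) (short_prob (r + eps) * P (F m j `&` early eps m j)))%E).
    by apply: lee_nneseries => // j _; exact: bound.
  rewrite -(fineK gfin) nneseriesZl; last by move=> j _; exact: measure_ge0.
  rewrite lee_wpmul2l//; first by rewrite fineK// measure_ge0.
  rewrite -measure_semi_bigcup; last 3 first.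
  - by move=> j; exact: measurableI.
  - by apply: trivIset_setIr; exact: trivIset_seqDU.
  - by apply: bigcup_measurable => j _; exact: measurableI.
  apply: le_measure; rewrite ?inE.
  - by apply: bigcup_measurable => j _; exact: measurableI.
  - exact: escapes_early_measurable.
  by move=> om [j _ [/Fo h1 h2]]; exists m => //; exists j.
have mSe m : measurable (S `&` escapes m).
  by apply: measurableI => //; apply: bigcup_measurable => j _.
have US : S = \bigcup_m (S `&` escapes m).
  apply/seteqP; split => [om So|om [m _ []]//].
  by have [m hm] := short_escapes So; exists m.
have cv := nondecreasing_cvg_mu (mu := P) mSe.
(* Letting [m] tend to infinity, as every short path escapes at some level. A factor less than 1
   then leaves only the value 0. *)
have GS : (short_prob (r + eps) <= short_prob (r + eps) * P (escapes_early eps))%E.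
  rewrite {1}/short_prob /law -/S {1}US -(cvg_lim _ (cv _ _))//; last 2 first.
  - by rewrite -US.
  - move=> m n mn; apply/subsetPset; apply: setIS; apply/subsetPset; exact: escapes_mono.
  apply: lime_le; last exact: nearW.
  apply/cvg_ex; eexists; apply: cv; first by rewrite -US.
  move=> m n mn; apply/subsetPset; apply: setIS; apply/subsetPset; exact: escapes_mono.
have afin : P (escapes_early eps) \is a fin_num.
  by apply: fin_num_measure; exact: escapes_early_measurable.
have G1 : (0 <= short_prob (r + eps))%E by exact: measure_ge0.
move: GS he G1; rewrite -(fineK gfin) -(fineK afin) -EFinM !lee_fin lte_fin => h1 h2 h3.
congr EFin; apply/eqP; rewrite eq_le h3 andbT.
have : fine (short_prob (r + eps)) * (1 - fine (P (escapes_early eps))) <= 0.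
  by rewrite mulrBr mulr1 subr_le0.
by rewrite pmulr_lle0// subr_gt0.
Qed.

(** The same [eps] serves at each step, so finitely many steps from 0 pass any [r]. *)
Lemma short_prob_eq0 r : 0 <= r -> short_prob r = 0%E.
Proof.
move=> r0; have [eps e0 he] := escapes_early_small.
have hn n : short_prob (n%:R * eps) = 0%E.
  elim: n => [|n IH]; first by rewrite mul0r short_prob0.
  by rewrite -natr1 mulrDl mul1r; apply: short_prob_step => //; rewrite mulr_ge0// ltW.
have n0 : 0 <= (Num.truncn (r / eps)).+1%:R * eps by rewrite mulr_ge0// ltW.
apply/eqP; rewrite eq_le measure_ge0 andbT -(hn (Num.truncn (r / eps)).+1).
apply: le_measure; rewrite ?inE.
- exact: (rpath_measurable XM y0 (short_rpath r0)).
- exact: (rpath_measurable XM y0 (short_rpath n0)).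
move=> om h t t0 wt; apply: le_trans (h t t0 wt) _.
by rewrite -ler_pdivrMr// ltW// truncnS_gt.
Qed.

End no_explosion.

Section almost_surely_good.
Variables (R : realType) (M : metricType R).
Context (d : measure_display) (T : measurableType d) (P : probability T R).
Variable X : M -> T -> R -> cemetery_ext M.
Hypothesis XM : strong_markov_process P X.
Hypothesis lc : locally_cpt M.
Variables (y0 : M) (f finv : M -> M -> M) (c : M -> R).
Hypothesis ic : invariance_components P X y0 f finv c.
Hypothesis cmul : forall x y, c (f x y) = c x * c y.

Lemma good_measurable : measurable [set om | good c (X y0 om)].
Proof.
apply: (rpath_measurable XM y0 (@good_rpath _ _ c _ _)).
  exact: component_c_continuous ic.
exact: component_c_gt0 ic.
Qed.

Lemma good_full : P (~` [set om | good c (X y0 om)]) = 0%E.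
Proof.
have [K cK nK] := lc y0.
apply: measure_negligible; first exact/measurableC/good_measurable.
apply: (negligibleS (A := \bigcup_n (X y0 @^-1` short c n%:R))).
  move=> om ng; apply: contrapT => hno; apply: ng.
  apply: (good_exceeds (component_c_continuous ic) (component_c_gt0 ic)).
    exact: (process_regular XM y0 om).
  move=> r; apply: contrapT => /forallNP hr; apply: hno.
  exists (Num.truncn r).+1 => //= t t0 wt; rewrite leNgt; apply/negP => h.
  apply: (hr t); split => //; apply: ltW; apply: lt_trans h; exact: truncnS_gt.
apply: negligible_bigcup => n; exists (X y0 @^-1` short c n%:R); split => //.
  exact: (rpath_measurable XM y0 (short_rpath ic (ler0n _ n))).
exact: (short_prob_eq0 XM ic cmul cK nK (ler0n _ n)).
Qed.

End almost_surely_good.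

(** * The Levy process *)

(** Events do not see negative times. The property is proved for [C] together with its complement,
    as the implication alone is not stable under complements. *)
Lemma path_sigma_agree (R : realType) (S : topologicalType) (C : set (R -> S)) v v' :
  path_sigma C -> (forall t : R, 0 <= t -> v t = v' t) -> C v <-> C v'.
Proof.
move=> pC vv.
pose H := [set C : set (R -> S) | forall v v', (forall t : R, 0 <= t -> v t = v' t) -> C v -> C v'].
suff hC : H C by split; apply: hC => // t /vv.
have {v v' vv} : [set C | H C /\ H (~` C)] C; last by case.
apply: (@smallest_sub _ _ _ [set C | H C /\ H (~` C)] _ _ C pC); first split.
- by split.
- by move=> A [h1 h2]; split; rewrite setTD // setCK.
- move=> F hF; split => u u' uu.
    by move=> [n _ Fv]; exists n => //; exact: (hF n).1 Fv.
  move=> nF [n _ Fv]; apply: nF; exists n => //.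
  by apply: (hF n).1 Fv => t /uu.
- move=> _ [t [B [t0 bB ->]]]; split => u u' uu /=; by rewrite uu.
Qed.

Lemma levy_process_hom (R : realType) (G : topologicalType) (op : G -> G -> G)
    (inv : G -> G) (e : G) (d : measure_display) (T : measurableType d)
    (P : probability T R) (L : T -> R -> G) (phi : G -> R) :
  continuous phi -> (forall x y, phi (op x y) = phi x + phi y) ->
  (forall x, phi (inv x) = - phi x) -> phi e = 0 ->
  levy_process op inv e P L ->
  levy_process (fun a b : R => a + b) (fun a : R => - a) 0 P (fun om t => phi (L om t)).
Proof.
move=> cphi phiM phiV phi1 [mL cL L0 hL].
have pre (B : set R) : borel B -> borel (phi @^-1` B).
  apply: sigma_algebra_preimage_sub; first exact: g_sigma.
  move=> Q oQ; apply: sub_sigma_algebra; apply: open_comp => // x _; exact: cphi.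
have prep (C : set (R -> R)) : path_sigma C -> path_sigma [set v : R -> G | C (phi \o v)].
  apply: path_sigma_preimage; first exact: g_sigma.
  move=> t Q t0 oQ; apply: (@path_sigma_coord _ _ t (phi @^-1` Q)) => //.
  by apply: pre; exact: sub_sigma_algebra.
split.
- by move=> t B t0 bB; exact: (mL t (phi @^-1` B) t0 (pre B bB)).
- move=> om; have [r l] := cL om; split => [t t0|t t0].
    by apply: (@cvg_comp _ _ _ (L om) phi _ (nbhs (L om t))); [exact: r|exact: cphi].
  have [x hx] := l t t0; exists (phi x).
  by apply: (@cvg_comp _ _ _ (L om) phi _ (nbhs x)); [exact: hx|exact: cphi].
- by move=> om; rewrite L0.
move=> t t0; have [h1 h2] := hL t t0.
have e1 : (fun om s => - phi (L om t) + phi (L om (t + s))) =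
    (fun om => phi \o (fun s => op (inv (L om t)) (L om (t + s)))).
  by apply/funext => om; apply/funext => s /=; rewrite phiM phiV.
split => [C pC|A C pA pC].
  by rewrite /= e1; exact: h1 _ (prep C pC).
rewrite /= e1; apply: (h2 A _ _ (prep C pC)).
apply: g_sigma_sub pA => _ [s [B [st bB ->]]].
by apply: sub_sigma_algebra; exists s, (phi @^-1` B); split => //; exact: pre.
Qed.

Section time_change_law.
Variables (R : realType) (M : metricType R).
Local Notation E := (cemetery_ext M).
Variable c : M -> R.
Hypotheses (cc : continuous c) (c_gt0 : forall x, 0 < c x).
Variable e0 : M.
Local Notation tc := (time_change c e0).

Lemma time_change_shift (w : R -> E) s t : regular w -> good c w -> 0 <= s -> 0 <= t ->
  tc (fun u => w (inv_age c w s + u)) t = tc w (s + t).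
Proof.
move=> rw gw s0 t0; have [h0 wh _ _] := inv_age_spec cc c_gt0 rw gw s0.
have gs := good_shift cc c_gt0 rw h0 wh gw.
by rewrite /time_change !asboolT// -inv_age_shift.
Qed.

Lemma good_unshift (w : R -> E) s : regular w -> 0 <= s -> w s <> None ->
  good c (fun u => w (s + u)) -> good c w.
Proof.
move=> rw s0 ws gs; apply: (good_exceeds cc c_gt0 rw) => r.
have rs := regular_shift rw s0.
have r0 : 0 <= Num.max 0 r by rewrite le_max lexx.
have [h0 wh hs _] := inv_age_spec cc c_gt0 rs gs r0.
exists (s + inv_age c (fun u => w (s + u)) (Num.max 0 r)); split => //.
  exact: addr_ge0.
have := age_shift cc c_gt0 rw s0 h0 wh; rewrite hs => e.
apply: (@le_trans _ _ (Num.max 0 r)); first by rewrite le_max lexx orbT.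
by rewrite [leLHS]e lerBlDr lerDl; exact: age_ge0.
Qed.

Lemma time_change_rpath t (B : set M) : 0 <= t -> borel B ->
  rpath [set w : R -> E | B (tc w t)].
Proof.
move=> t0 bB; have [r0 rC rU] := @rpath_algebra R M.
have rg := good_rpath (M := M) cc c_gt0.
pose V := \bigcup_n [set w : R -> E |
  (tau c w t <= n%:R%:E)%E /\ live B (w (fine (tau c w t)))].
have rV : rpath V.
  by apply: rU => n; apply: (@rpast_rpath _ _ n%:R); exact: tau_live_rpast.
have h1 := (sigma_algebraUI (@rpath_algebra R M) rg rV).2.
(* Bad paths are sent to the constant [e0], so they are all in the event or all out of it. *)
have h2 : rpath (if `[< B e0 >] then ~` [set w : R -> E | good c w] else set0).
  by case: ifP => _ //; rewrite -setTD; exact: rC.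
apply: trace_ext (sigma_algebraUI (@rpath_algebra R M) h1 h2).1 => w rw /=.
have [gw|ng] := pselect (good c w).
  have [h0 wh _ th] := inv_age_spec cc c_gt0 rw gw t0.
  have wE := time_changeE cc c_gt0 e0 rw gw t0.
  split => [[[_ [n _ [_]]]|]|Bt].
  - by rewrite /= -/(inv_age c w t) wE.
  - by case: ifP => // _.
  left; split => //; exists (Num.truncn (inv_age c w t)).+1 => //=; split.
    by rewrite th lee_fin ltW// truncnS_gt.
  by rewrite -/(inv_age c w t) wE.
have -> : tc w t = e0 by rewrite /time_change asboolF.
split => [[[]//|]|Be].
  by case: asboolP.
by right; rewrite asboolT.
Qed.

Lemma time_change_path_rpath (C : set (R -> M)) : path_sigma C ->
  rpath [set w : R -> E | C (tc w)].
Proof.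
move=> pC; refine (@path_sigma_preimage R M (R -> E) (@rpath R M) (fun w => tc w) _ _ C pC).
  exact: rpath_algebra.
by move=> t Q t0 oQ; apply: time_change_rpath => //; exact: sub_sigma_algebra.
Qed.

End time_change_law.

Section levy.
Variables (R : realType) (M : metricType R).
Local Notation E := (cemetery_ext M).
Context (d : measure_display) (T : measurableType d) (P : probability T R).
Variable X : M -> T -> R -> E.
Hypothesis XM : strong_markov_process P X.
Hypotheses (lc : locally_cpt M) (sep : separable M).
Variables (y0 : M) (f finv : M -> M -> M) (c : M -> R).
Hypothesis ic : invariance_components P X y0 f finv c.
Hypothesis cmul : forall x y, c (f x y) = c x * c y.
Hypothesis fA : forall x y z, f x (f y z) = f (f x y) z.

Let fK := component_fK ic.
Let fVK := component_fVK ic.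
Let cc : continuous c := component_c_continuous ic.
Let c_gt0 : forall x, 0 < c x := component_c_gt0 ic.
Local Notation Y := (X y0).
Local Notation tc := (time_change c y0).

(** The solution of f_x z = y0, hence a right inverse by construction; associativity and injectivity
    of f_x make it a left inverse. *)
Definition group_inv (x : M) : M := finv x y0.

Lemma component_unitr x : f x y0 = x.
Proof. exact: (component_start XM ic). Qed.

Lemma component_unitl x : f y0 x = x.
Proof. by apply: (can_inj (fK y0)); rewrite fA component_unitr. Qed.

Lemma component_invr x : f x (group_inv x) = y0.
Proof. exact: fVK. Qed.

Lemma component_invl x : f (group_inv x) x = y0.
Proof.
apply: (can_inj (fK x)).
by rewrite fA component_invr component_unitl component_unitr.
Qed.

Lemma component_c1 : c y0 = 1.
Proof.
have := cmul y0 y0; rewrite component_unitr => /esym/eqP.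
by rewrite -subr_eq0 -{3}(mulr1 (c y0)) -mulrBr mulf_eq0 gt_eqF//= subr_eq0 => /eqP.
Qed.

Lemma component_invM x y : group_inv (f x y) = f (group_inv y) (group_inv x).
Proof.
apply: (can_inj (fK (f x y))).
by rewrite component_invr -fA (fA y) component_invr component_unitl component_invr.
Qed.

Lemma group_inv1 : group_inv y0 = y0.
Proof. by rewrite -[LHS]component_unitl component_invr. Qed.

Let cop : continuous (fun p : M * M => f p.1 p.2) := component_f_continuous ic.

Let cinv : continuous group_inv.
Proof.
move=> x; have := component_fV_continuous ic => h.
apply: (@cvg_comp _ _ _ (fun x => (x, y0)) (fun p : M * M => finv p.1 p.2) _ (nbhs (x, y0))).
  by apply: cvg_pair; [exact: cvg_id|exact: cvg_cst].
exact: (h (x, y0)).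
Qed.

Definition increments (t : R) (v : R -> M) (s : R) : M :=
  f (group_inv (v t)) (v (t + s)).

(** An increment depends on two positions through a map that is continuous on the product; its open
    preimages are countable unions of rectangles, whose sides are events of a single time. *)
Lemma increments_rpath t C : 0 <= t -> path_sigma C ->
  rpath [set w : R -> E | C (increments t (tc w))].
Proof.
move=> t0 pC.
refine (@path_sigma_preimage R M (R -> E) (@rpath R M) (fun w => increments t (tc w)) _ _ C pC).
  exact: rpath_algebra.
move=> s Q s0 oQ.
pose W : set (M * M) := [set p | Q (f (group_inv p.1) p.2)].
have oW : open W.
  have hc : continuous (fun p : M * M => f (group_inv p.1) p.2).
    move=> p; apply: (@continuous_comp _ _ _ (fun p : M * M => (group_inv p.1, p.2))
      (fun p => f p.1 p.2) p); last exact: cop.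
    apply: cvg_pair; last exact: cvg_snd.
    by apply: (@continuous_comp _ _ _ (@fst M M) group_inv p); [exact: cvg_fst|exact: cinv].
  by apply: (@open_comp _ _ (fun p : M * M => f (group_inv p.1) p.2) Q) => // p _; exact: hc.
have [U [V [oU oV WE]]] := open_prod_rectangles sep y0 oW.
have [_ _ rU] := @rpath_algebra R M.
rewrite (_ : [set w | _] = \bigcup_n ([set w : R -> E | U n (tc w t)] `&`
    [set w : R -> E | V n (tc w (t + s))])).
  apply: rU => n; apply: (sigma_algebraUI (@rpath_algebra R M) _ _).2.
    by apply: time_change_rpath => //; exact: sub_sigma_algebra.
  by apply: time_change_rpath; rewrite ?addr_ge0//; exact: sub_sigma_algebra.
rewrite -[RHS]/((fun w => (tc w t, tc w (t + s))) @^-1` (\bigcup_n (U n `*` V n))).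
by rewrite -WE.
Qed.

(** The inverse age of the transformed path is divided by [c y], which compensates the time scale:
    only the left translation by [y] remains. *)
Lemma time_change_act y w : regular w -> good c w -> forall s, 0 <= s ->
  tc (act (f y) (c y) w) s = f y (tc w s).
Proof.
move=> rw gw s s0; have [h1 h2] := component_slices ic y.
have fy := fK y; have fyV := fVK y.
have ra := component_regular_act ic y rw.
have cy x : c (f y x) = c y * c x by exact: cmul.
have ga : good c (act (f y) (c y) w).
  by apply/(good_act cc c_gt0 h1 h2 fy fyV (c_gt0 y) cy).
apply: Some_inj.
rewrite -(time_changeE cc c_gt0 y0 ra ga s0).
rewrite /act (inv_age_act cc c_gt0 h1 h2 fy fyV (c_gt0 y) cy rw gw s0).
by rewrite (time_changeE cc c_gt0 y0 rw gw s0).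
Qed.

(** Increments from time 0 cancel the left translation by the starting point, so that the
    probability of this event is the same from every point. *)
Definition from_start (C : set (R -> M)) : set (R -> E) :=
  [set w | good c w /\ C (increments 0 (tc w))].

Lemma from_start_rpath C : path_sigma C -> rpath (from_start C).
Proof.
move=> pC; apply: (sigma_algebraUI (@rpath_algebra R M) _ _).2; first exact: good_rpath.
exact: increments_rpath.
Qed.

Definition levy_path (om : T) : R -> M := tc (Y om).

Lemma full_eq A B : measurable A -> measurable B ->
  (forall om, good c (Y om) -> A om <-> B om) -> P A = P B.
Proof.
have mG := good_measurable XM ic; have G0 := good_full XM lc ic cmul.
have le A' B' : measurable A' -> measurable B' ->
    (forall om, good c (Y om) -> A' om -> B' om) -> (P A' <= P B')%E.
  move=> mA mB AB; rewrite -[leRHS]adde0 -G0.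
  apply: (@le_trans _ _ (P (B' `|` ~` [set om | good c (Y om)]))).
    apply: le_measure; rewrite ?inE//; first by apply: measurableU => //; exact: measurableC.
    by move=> om Aom; have [g|ng] := pselect (good c (Y om)); [left; exact: AB|right].
  by apply: measureU2 => //; exact: measurableC.
move=> mA mB AB; apply/eqP; rewrite eq_le !le// => om gom; by apply AB.
Qed.

Lemma law_from_start C y : path_sigma C -> law P (X y) (from_start C) = law P levy_path C.
Proof.
move=> pC.
have e1 : law P (X y) (from_start C) = law P Y (from_start C).
  apply: (law_invariant XM ic (from_start_rpath pC)) => w rw w0.
  have [h1 h2] := component_slices ic y.
  have ga : good c (act (f y) (c y) w) <-> good c w.
    by apply: (good_act cc c_gt0 h1 h2 (fK y) (fVK y) (c_gt0 y)) => // x; exact: cmul.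
  have agree : good c w -> forall s, 0 <= s ->
      increments 0 (tc (act (f y) (c y) w)) s = increments 0 (tc w) s.
    move=> gw s s0; rewrite /increments add0r !time_change_act//.
    by rewrite component_invM -fA (fA (group_inv y)) component_invl component_unitl.
  rewrite /from_start /=; split => -[/ga gw h].
    split; first exact/ga/ga.
    by apply/(path_sigma_agree pC (agree _)); [exact/ga/ga|].
  have gw' : good c w by exact/ga.
  by split => //; apply/(path_sigma_agree pC (agree gw')).
rewrite e1 /law; apply: full_eq.
- exact: (rpath_measurable XM y0 (from_start_rpath pC)).
- exact: (rpath_measurable XM y0 (time_change_path_rpath cc c_gt0 y0 pC)).
move=> om gom.
have rY := process_regular XM y0 om.
have L0 : tc (Y om) 0 = y0.
  by apply: Some_inj; rewrite -(time_change_start cc c_gt0 y0 rY gom) (process_start XM).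
have agree s : 0 <= s -> increments 0 (tc (Y om)) s = tc (Y om) s.
  by move=> s0; rewrite /increments add0r L0 group_inv1 component_unitl.
split => [[_ h]|h]; [|split => //]; exact/(path_sigma_agree pC agree).
Qed.

(** Events of [levy_path] before [t] are events of the process before its stopping time [tau],
    except that bad paths, on which [levy_path] is constant by convention, must be ignored. *)
Lemma levy_past t A : 0 <= t -> past levy_path t A ->
  exists2 A', stopped_past Y (fun om => tau c (Y om) t) A' &
    forall om, good c (Y om) -> (A om <-> A' om).
Proof.
move=> t0 pA; pose tt om := tau c (Y om) t.
have ptt s : 0 <= s -> past Y s [set om | (tt om <= s%:E)%E].
  by move=> s0; exact: (rpast_past XM (tau_rpast cc c_gt0 t0 s0)).
pose H := [set A | exists2 A', stopped_past Y tt A' &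
    forall om, good c (Y om) -> (A om <-> A' om)].
suff : H A by [].
apply: (@smallest_sub _ _ _ H _ _ A pA); first split.
- exists set0 => //; split => // s s0; rewrite set0I; exact: past0.
- move=> B [B' [mB' pB'] BB']; exists (~` B'); last first.
    move=> om gom; rewrite setTD /setC /=; split => nB h; apply: nB; exact/(BB' om gom).
  split=> [|s s0]; first exact: measurableC.
  have [_ pC _] := past_algebra Y s.
  rewrite (_ : _ `&` _ = [set om | (tt om <= s%:E)%E] `&`
      (setT `\` (B' `&` [set om | (tt om <= s%:E)%E]))).
    apply: (sigma_algebraUI (past_algebra Y s) (ptt s s0) _).2; apply: (pC); exact: pB'.
  apply/seteqP; split => om.
    by move=> [nB h]; split => //; split => // -[].
  by move=> [h [_ nB]]; split => // B'om; apply: nB.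
- move=> F hF; have /choice[F' hF'] : forall n, exists A', stopped_past Y tt A' /\
      forall om, good c (Y om) -> (F n om <-> A' om).
    by move=> n; have [A' h1 h2] := hF n; exists A'.
  exists (\bigcup_n F' n); last first.
    by move=> om gom; split => -[n _ h]; exists n => //; apply/((hF' n).2 om gom).
  split=> [|s s0]; first by apply: bigcup_measurable => n _; exact: (hF' n).1.1.
  have [_ _ pU] := past_algebra Y s.
  by rewrite setI_bigcupl; apply: (pU) => n; exact: (hF' n).1.2.
- move=> _ [r [B [/andP[r0 rt] bB ->]]].
  exists [set om | (tau c (Y om) r < +oo)%E /\ live B (Y om (fine (tau c (Y om) r)))].
    split=> [|s s0].
      rewrite (_ : [set om | _] = \bigcup_n [set om | (tau c (Y om) r <= n%:R%:E)%E /\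
          live B (Y om (fine (tau c (Y om) r)))]).
        apply: bigcup_measurable => n _; apply: (past_measurable XM (y := y0) (t := n%:R)).
        exact: (rpast_past XM (tau_live_rpast cc c_gt0 r0 (ler0n _ n) bB)).
      apply/seteqP; split => om /=.
        move=> [h hl]; have [u [u0 wu us tu]] := tau_fin cc c_gt0 (process_regular XM y0 om) h.
        by exists (Num.truncn u).+1 => //=; split => //; rewrite tu lee_fin ltW// truncnS_gt.
      by move=> [n _ /= [h hl]]; split => //; apply: le_lt_trans h _; exact: ltry.
    have h1 := rpast_past XM (y := y0) (tau_live_rpast cc c_gt0 r0 s0 bB).
    have := (sigma_algebraUI (past_algebra Y s) h1 (ptt s s0)).2.
    congr past; apply/seteqP; split => om /=.
      by move=> [[h hl] hs]; split => //; split => //; apply: le_lt_trans h _; exact: ltry.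
    move=> [[h hl] hs]; split => //; split => //.
    have rY := process_regular XM y0 om.
    (* The age [r <= t] is reached no later than the age [t]. *)
    apply/(tau_le cc c_gt0 rY r0 s0).
    have [k|[k1 k2]] := (tau_le cc c_gt0 rY t0 s0).1 hs.
      by left; apply: le_lt_trans k; rewrite lee_fin.
    move: rt; rewrite le_eqVlt => /orP[/eqP ->|rt]; first by right.
    by left; rewrite k1 lte_fin.
  move=> om gom; have rY := process_regular XM y0 om.
  have [h0 wh _ th] := inv_age_spec cc c_gt0 rY gom r0.
  rewrite /= /levy_path -/(inv_age c (Y om) r) (time_changeE cc c_gt0 y0 rY gom r0) th.
  by split => [?|[]//]; split => //; exact: ltry.
Qed.

Lemma levy_markov t A C : 0 <= t -> past levy_path t A -> path_sigma C ->
  P (A `&` [set om | C (increments t (levy_path om))]) = (P A * law P levy_path C)%E.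
Proof.
move=> t0 pA pC.
have [A' sA' AA'] := levy_past t0 pA.
pose tt om := tau c (Y om) t.
have stt : stopping_time Y tt.
  split=> [om|s s0]; first exact: tau_ge0.
  exact: (rpast_past XM (tau_rpast cc c_gt0 t0 s0)).
have alv om : A' om -> (tt om < +oo)%E -> Y om (fine (tt om)) <> None.
  move=> _ h; have [u [u0 wu us tu]] := tau_fin cc c_gt0 (process_regular XM y0 om) h.
  by rewrite /tt tu.
have mA : measurable A.
  apply: (smallest_sub _ _ pA); first exact: sigma_algebra_measurable.
  move=> _ [s [B [/andP[s0 _] bB ->]]].
  exact: (rpath_measurable XM y0 (time_change_rpath cc c_gt0 y0 s0 bB)).
have mtt : measurable [set om | (tt om < +oo)%E].
  rewrite (_ : [set om | _] = \bigcup_n [set om | (tt om <= n%:R%:E)%E]).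
    apply: bigcup_measurable => n _; apply: (past_measurable XM (y := y0) (t := n%:R)).
    by apply: stt.2; exact: ler0n.
  apply/seteqP; split => om /=.
    move=> h; have [u [u0 wu us tu]] := tau_fin cc c_gt0 (process_regular XM y0 om) h.
    by exists (Num.truncn u).+1 => //=; rewrite /tt tu lee_fin ltW// truncnS_gt.
  by move=> [n _ /= h]; apply: le_lt_trans h _; exact: ltry.
have mI : measurable [set om | C (increments t (levy_path om))].
  exact: (rpath_measurable XM y0 (increments_rpath t0 pC)).
have mG := good_measurable XM ic.
(* After the time when the age reaches [t], the path starts afresh from a living point, and its
   increments from there are the increments of [levy_path] after [t]. *)
have sm := strong_markov_const XM stt sA' (from_start_rpath pC) alv
  (fun x => law_from_start x pC).
have eA : P (A' `&` [set om | (tt om < +oo)%E]) = P A.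
  apply: full_eq => //; first by apply: measurableI => //; exact: sA'.1.
  move=> om gom; have [_ _ _ th] := inv_age_spec cc c_gt0 (process_regular XM y0 om) gom t0.
  split => [[A'om _]|Aom]; first exact/(AA' om gom).
  by split; [exact/(AA' om gom)|rewrite /= /tt th ltry].
(* The shifted path is good only if the path itself is, which makes this event
   measurable although the null set of bad paths is not completed. *)
have sE : A' `&` [set om | (tt om < +oo)%E] `&`
    [set om | from_start C (fun s => Y om (fine (tt om) + s))] =
    A' `&` [set om | (tt om < +oo)%E] `&`
    ([set om | good c (Y om)] `&` [set om | C (increments t (levy_path om))]).
  have agree om : good c (Y om) -> forall s, 0 <= s ->
      increments 0 (tc (fun s => Y om (inv_age c (Y om) t + s))) s =
      increments t (levy_path om) s.
    move=> gom s s0; have rY := process_regular XM y0 om.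
    by rewrite /increments add0r !(time_change_shift cc c_gt0 y0 rY gom t0)// addr0.
  apply/seteqP; split => om [[A'om tom] [h1 h2]]; split => //.
    have gom : good c (Y om).
      have tt0 : 0 <= fine (tt om) by apply: fine_ge0; exact: stt.1.
      by have := good_unshift cc c_gt0 (process_regular XM y0 om) tt0 (alv om A'om tom) h1.
    by split => //; apply/(path_sigma_agree pC (agree om gom)).
  have rY := process_regular XM y0 om.
  have [h0 wh _ th] := inv_age_spec cc c_gt0 rY h1 t0.
  split; first exact: (good_shift cc c_gt0 rY h0 wh h1).
  by apply/(path_sigma_agree pC (agree om h1)).
rewrite muleC -eA -sm sE; apply: full_eq.
- exact: measurableI.
- by apply: measurableI; apply: measurableI => //; exact: sA'.1.
move=> om gom; have rY := process_regular XM y0 om.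
have [h0 wh _ th] := inv_age_spec cc c_gt0 rY gom t0.
split=> [[Aom h]|[[A'om _] [_ h]]].
  by split=> //; split; [exact/(AA' om gom)|rewrite /= /tt th ltry].
by split => //; exact/(AA' om gom).
Qed.

Lemma levy_path_levy : levy_process f group_inv y0 P levy_path.
Proof.
split.
- move=> t B t0 bB; exact: (rpath_measurable XM y0 (time_change_rpath cc c_gt0 y0 t0 bB)).
- move=> om; have [gom|ng] := pselect (good c (Y om)).
    apply: (time_change_cadlag cc c_gt0 y0 (process_regular XM y0 om) gom lc).
    by have [] := process_cadlag XM y0 om.
  have -> : levy_path om = fun _ => y0.
    by apply/funext => s; rewrite /levy_path /time_change asboolF.
  by split => [t t0|t t0]; [|exists y0]; exact: cvg_cst.
- move=> om; have [gom|ng] := pselect (good c (Y om)).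
    apply: Some_inj; rewrite -(time_change_start cc c_gt0 y0 (process_regular XM y0 om) gom).
    by rewrite (process_start XM).
  by rewrite /levy_path /time_change asboolF.
move=> t t0 incr.
have e1 C : path_sigma C -> law P incr C = law P levy_path C.
  move=> pC; have := levy_markov t0 (@pastT _ _ _ _ levy_path t) pC.
  by rewrite setTI probability_setT mul1e.
split => [C|A C pA pC]; first exact: e1.
by rewrite e1//; exact: levy_markov.
Qed.

End levy.

Lemma time_changed_levy (R : realType) (M : metricType R) (d : measure_display)
    (T : measurableType d) (P : probability T R) (X : M -> T -> R -> cemetery_ext M)
    (y0 : M) (f finv : M -> M -> M) (c : M -> R) :
  strong_markov_process P X -> locally_cpt M -> separable M ->
  invariance_components P X y0 f finv c ->
  (forall x y, c (f x y) = c x * c y) -> (forall x y z, f x (f y z) = f (f x y) z) ->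
  exists L : T -> R -> M,
    [/\ levy_process f (fun x => finv x y0) y0 P L,
        {ae P, forall om,
           lifetime (X y0 om) = clock c (L om) +oo%E /\
           forall t : R, 0 <= t -> (t%:E < clock c (L om) +oo%E)%E ->
             X y0 om t = Some (L om (clock_inv c (L om) t))} &
        let xi := fun om t => ln (1 / c (L om t)) in
        levy_process (fun a b : R => a + b) (fun a : R => - a) 0 P xi /\
        {ae P, forall om,
           lifetime (X y0 om) =
           (\int[lebesgue_measure]_(s in `[0%R, +oo[) (expR (xi om s))%:E)%E}].
Proof.
move=> XM lc sep ic cmul fA.
have cc := component_c_continuous ic; have c_gt0 := component_c_gt0 ic.
pose L := levy_path X y0 c.
have hL := levy_path_levy XM lc sep ic cmul fA.
have good_ae (Q : T -> Prop) : (forall om, good c (X y0 om) -> Q om) ->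
    {ae P, forall om, Q om}.
  move=> hQ; exists (~` [set om | good c (X y0 om)]); split.
  - exact/measurableC/(good_measurable XM ic).
  - exact: (good_full XM lc ic cmul).
  - by move=> om nQ gom; apply: nQ; exact: hQ.
have lifeL om : good c (X y0 om) ->
    lifetime (X y0 om) = clock c (L om) +oo%E /\
    forall t : R, 0 <= t -> (t%:E < clock c (L om) +oo%E)%E ->
      X y0 om t = Some (L om (clock_inv c (L om) t)).
  move=> gom; apply: (time_change_lifetime cc c_gt0 y0 (process_regular XM y0 om) gom).
    apply: ltW; apply/(process_alive XM y0 om (lexx 0)).
    by rewrite (process_start XM).
  by move=> t t0; exact: (process_alive XM y0 om t0).
exists L; split => //.
- exact: good_ae.
split.
  apply: (levy_process_hom (phi := fun x => ln (1 / c x)) _ _ _ _ hL).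
  - move=> x; apply: (@continuous_comp _ _ _ (fun x => 1 / c x) (@ln R) x).
      apply: cvgM; first exact: cvg_cst.
      by apply: cvgV; [rewrite gt_eqF|exact: cc].
    by apply: continuous_ln; rewrite divr_gt0.
  - by move=> x y; rewrite cmul -lnM ?posrE ?divr_gt0// mulrACA mulr1 invfM.
  - move=> x; apply/eqP; rewrite -addr_eq0 -lnM ?posrE ?divr_gt0//.
    rewrite mulrACA mulr1 -invfM -cmul (component_invl XM ic fA).
    by rewrite (component_c1 XM ic cmul) divr1 ln1.
  - by rewrite (component_c1 XM ic cmul) divr1 ln1.
apply: good_ae => om gom; rewrite (lifeL om gom).1 /clock Iset_oo.
by apply: eq_integral => s _; rewrite lnK ?posrE ?divr_gt0// div1r.
Qed.

Theorem theorem1p8 (R : realType) (k n : nat) (M : metricType R)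
    (A : set (chart M 'rV[R]_n)) (d : measure_display) (T : measurableType d)
    (P : probability T R) (X : M -> T -> R -> cemetery_ext M) (y0 : M)
    (k_ge1 : (1 <= k)%N)
    (M_manifold : Ck_manifold k A)
    (M_connected : connected [set: M])
    (X_markov : strong_markov_process P X)
    (X_self_similar : Ck_self_similar k A P X)
    (X_support : process_support P (X y0) = [set: M] \/
                 exists y : M, interior (process_support P (X y)) y)
    (X_symmetries : discrete_homs (symmetries P (X y0))) :
  exists (op : M -> M -> M) (inv : M -> M) (h : M -> R),
    [/\ Ck_lie_group k A op inv y0,
        Ck_hom_to_posreals k A op h &
        exists L : T -> R -> M,
          [/\ levy_process op inv y0 P L,
              {ae P, forall om,
                 lifetime (X y0 om) = clock h (L om) +oo%E /\
                 forall t : R, 0 <= t -> (t%:E < clock h (L om) +oo%E)%E ->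
                   X y0 om t = Some (L om (clock_inv h (L om) t))} &
              let xi := fun om t => ln (1 / h (L om t)) in
              levy_process (fun a b : R => a + b) (fun a : R => - a) 0 P xi /\
              {ae P, forall om,
                 lifetime (X y0 om) =
                 (\int[lebesgue_measure]_(s in `[0%R, +oo[) (expR (xi om s))%:E)%E}]].
Proof.
case: k k_ge1 M_manifold X_self_similar => // k _ M_manifold.
move=> [y1 [f1 [finv1 [c1 ic1]]]].
have lc := manifold_locally_cpt M_manifold.
have [sep atlas] := M_manifold.
have supp : exists y, interior (process_support P (X y)) y.
  case: X_support => // supp0; exists y0; rewrite supp0 interiorT.
  by [].
have [f [finv [c [Cic fA cmul]]]] :=
  group_components atlas X_markov lc sep M_connected supp X_symmetries ic1.
have ic := Ck_component_inv Cic.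
exists f, (fun x => finv x y0), c; split.
- split.
  + exact: fA.
  + by split => x; [exact: (component_unitl X_markov ic fA)|exact: (component_unitr X_markov ic)].
  + by split => x; [exact: (component_invl X_markov ic fA)|exact: component_fVK ic x y0].
  + exact: Ck_component_f Cic.
  apply/Ck_map_onT.
  apply: (Ck_op atlas (Ck_atlas_is atlas) openT (Ck_of_map (Ck_component_fV Cic))).
    exact: Ck_map_on_id.
  exact: Ck_map_on_cst.
- by split; [exact: component_c_gt0 ic|exact: cmul|exact: Ck_component_c Cic].
exact: (time_changed_levy X_markov lc sep ic cmul fA).
Qed.
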